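(* Let $B>0$ and $\beta\ge3d/2$. Assume that the eigenfunctions of the covariance kernel $K$ satisfy $|\psi_j(t)|\le C_\psi$ for all $j\in\mathbb{N}^d$, $t\in[0,1]^d$, for a global constant $C_\psi>0$, and that its one-dimensional eigenvalues are polynomially decaying with $\alpha=\beta$: $C^{-1}i^{-1-2\beta/d}\le\mu_i\le Ci^{-1-2\beta/d}$ for all $i\in\mathbb{N}$, for some $C>0$. Let $m=o(N^{\frac{2\beta-3d}{4\beta}})$. Then the aggregated posterior $\Pi^\dagger_{n,m}(\cdot|\mathbb{D}_N)$ and its mean $\hat f_{n,m}$ resulting from either Method I or Method II satisfy $$\sup_{f_0\in\Theta^\beta(B)}E_0\|\hat f_{n,m}-f_0\|_2^2\lesssim(N/\sigma^2)^{-2\beta/(2\beta+d)}\log^{d-1}(N/\sigma^2),$$ and for all sequences $M_N\to+\infty$, $$\sup_{f_0\in\Theta^\beta(B)}E_0\Pi^\dagger_{n,m}\Big(f:\|f-f_0\|_2>M_N(N/\sigma^2)^{-\beta/(2\beta+d)}(\log(N/\sigma^2))^{(d-1)/2}\,\Big|\,\mathbb{D}_N\Big)\to0.$$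
   Context: $\mathbb{N}=\{1,2,\dots\}$; $\mathcal{X}=[0,1]^d$; $\|\cdot\|_2$ is the $L_2(\mathcal{X})$-norm. $a_N\lesssim b_N$ means $a_N\le Cb_N$ for a constant $C$ not depending on $n,m,N$. $K$ is a stationary positive definite kernel on $\mathbb{R}^d\times\mathbb{R}^d$ with expansion $K(x,x')=\sum_{j\in\mathbb{N}^d}\mu_j\psi_j(x)\psi_j(x')$ on $\mathcal{X}$, where $(\psi_j)$ is an orthonormal basis of $L_2(\mathcal{X})$. Eigenfunctions and eigenvalues factorize: $\psi_j(x)=\prod_{k=1}^d\psi_{j_k}(x_k)$, $\mu_j=\prod_{k=1}^d\mu_{j_k}$, in terms of one-dimensional eigenfunctions $(\psi_i)_{i\in\mathbb{N}}$ and eigenvalues $(\mu_i)_{i\in\mathbb{N}}$. Define $\Theta^\beta(B)=\{f=\sum_{j\in\mathbb{N}^d}f_j\psi_j\in L_2(\mathcal{X}):\sum_j(\sum_{i=1}^dj_i^2)^\beta f_j^2\le B^2\}$. Distributed regression model: $N=nm$ observations are split over $m$ machines; machine $k\in\{1,\dots,m\}$ holds $\mathbb{D}_n^{(k)}=(X_i^{(k)},Y_i^{(k)})_{i=1}^n$ with $Y_i^{(k)}=f_0(X_i^{(k)})+\varepsilon_i^{(k)}$, $X_i^{(k)}$ i.i.d. uniform on $[0,1]^d$, $\varepsilon_i^{(k)}$ i.i.d. $\mathcal{N}(0,\sigma^2)$ independent of the design, $\sigma^2$ known with $\sigma^2\gtrsim1$ (bounded below by a positive constant). $\mathbb{D}_N$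 is the whole data set; $E_0$ is expectation under $f_0$. $\mathbb{X}^{(k)},\mathbb{Y}^{(k)}$ collect the local design points and observations, and $K(A,B)$ is the matrix of kernel evaluations. In both methods the local (adjusted) posterior mean is $\hat f_n^{(k)}(x)=K(x,\mathbb{X}^{(k)})[K(\mathbb{X}^{(k)},\mathbb{X}^{(k)})+m^{-1}\sigma^2I_n]^{-1}\mathbb{Y}^{(k)}$. Put $C_n^{(k)}(x,x')=K(x,x')-K(x,\mathbb{X}^{(k)})[K(\mathbb{X}^{(k)},\mathbb{X}^{(k)})+m^{-1}\sigma^2I_n]^{-1}K(\mathbb{X}^{(k)},x')$. Method I (prior $GP(0,mK)$ in each machine, averaging of draws): the local posterior is $GP(\hat f_n^{(k)},mC_n^{(k)})$; a draw from the global posterior is the average of one independent draw from each local posterior, so the global posterior is the Gaussian process with mean $m^{-1}\sum_k\hat f_n^{(k)}$ and covariance kernel $m^{-2}\sum_k mC_n^{(k)}$. Method II (prior $GP(0,K)$, local likelihood raised to the power $m$, Wasserstein barycenter): the local posterior is $GP(\hat f_n^{(k)},C_n^{(k)})$; the global posterior is the 2-Wasserstein barycenter of the $m$ local posteriors, i.e. the minimizer over probability measures $\mu$ with finite second moment of $m^{-1}\sum_{k=1}^mW_2^2(\mu,\mu_k)$, where $\mu_k$ is the $k$-th local posterior and $W_2^2(\mu,\nu)=\inf_\gamma\iint\|x-y\|_2^2\,\gamma(dx,dy)$ over couplings $\gamma$ of $\mu$ and $\nu$. It is the Gaussian process with mean $m^{-1}\sum_k\hat f_n^{(k)}$ and covariance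 operator $\hat C$ satisfying $\hat C=m^{-1}\sum_k(\hat C^{1/2}C_n^{(k)}\hat C^{1/2})^{1/2}$. *)

(* Defs.v *)
From HB Require Import structures.
From mathcomp Require Import all_boot all_order all_algebra finmap.
From mathcomp Require Import all_classical all_reals all_analysis.
From mathcomp Require Import showcase.summability.

Set Implicit Arguments.
Unset Strict Implicit.
Unset Printing Implicit Defensive.

Import Order.TTheory GRing.Theory Num.Theory.
Import numFieldNormedType.Exports.

Local Open Scope classical_set_scope.
Local Open Scope ring_scope.

Section prod_prob.
Context {dT : measure_display} {T : measurableType dT} {R : realType}.

Definition tcons n (p : T * n.-tuple T) : n.+1.-tuple T :=
  [tuple of p.1 :: p.2].

Lemma measurable_tcons n : measurable_fun [set: T * n.-tuple T] (@tcons n).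
Proof. exact: (measurable_cons measurable_fst measurable_snd). Qed.

HB.instance Definition _ n :=
  isMeasurableFun.Build _ _ _ _ (@tcons n) (@measurable_tcons n).

Fixpoint prod_prob n : ('I_n -> probability T R) -> probability (n.-tuple T) R :=
  match n with
  | 0 => fun _ => \d_([tuple] : 0.-tuple T)
  | k.+1 => fun P =>
      distribution (P ord0 \x prod_prob (fun i => P (lift ord0 i)))%E (@tcons k)
  end.

End prod_prob.

(* The library carries its distributions on R by a copy of the Borel structure
   of R whose display differs from the one of the canonical structure of R. *)

Section real_probability.
Context {R : realType}.

Definition toR : measurableTypeR R -> R := idfun.

Lemma measurable_toR : measurable_fun setT toR.
Proof. by move=> _ A mA; rewrite setTI. Qed.

HB.instance Definition _ := isMeasurableFun.Build _ _ _ _ toR measurable_toR.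

Definition uniform01 : probability R R :=
  distribution (uniform_prob (@ltr01 R)) toR.

Definition normalR (a s : R) : probability R R :=
  distribution (normal_prob a s) toR.

End real_probability.

(* The unit cube and its uniform law; L_2 of the cube is L_2 of [unif]. *)

Definition cube {R : realType} {d : nat} : set (d.-tuple R) :=
  [set x | forall i, 0 <= tnth x i <= 1].

Definition unif (R : realType) (d : nat) : probability (d.-tuple R) R :=
  prod_prob (fun _ : 'I_d => uniform01).

(* Square-integrable functions with the Borel sigma-algebra of the L_2
   seminorm. The elements are functions, not classes, but no measurable set
   separates two functions that are equal almost everywhere, so probability
   measures on this type are the Borel probability measures on L_2. *)

Section L2.
Context {dT : measure_display} {T : measurableType dT} {R : realType}.
Variable mu : probability T R.

Definition L2 : Type := LfunType mu (lee1n 2).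

HB.instance Definition _ := GRing.Lmodule.on L2.
HB.instance Definition _ := isPointed.Build L2 0.

Definition L2_norm (f : T -> R) : \bar R := 'N[mu]_2%:E[EFin \o f]%E.

Definition L2_dist (f g : T -> R) : \bar R := L2_norm (f \- g).

Definition L2_open : set (set L2) :=
  [set A : set L2 | forall f : L2, A f -> exists2 r : R, 0 < r &
    forall g : L2, (L2_dist g f < r%:E)%E -> A g].

Definition L2_measurable : set (set L2) := <<s L2_open >>.

Lemma L2_measurable0 : L2_measurable set0.
Proof. exact: sigma_algebra0. Qed.

Lemma L2_measurableC A : L2_measurable A -> L2_measurable (~` A).
Proof. exact: sigma_algebraC. Qed.

Lemma L2_measurable_bigcup (F : (set L2)^nat) :
  (forall i, L2_measurable (F i)) -> L2_measurable (\bigcup_i F i).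
Proof. exact: sigma_algebra_bigcup. Qed.

HB.instance Definition _ := isMeasurable.Build (sigma_display L2_open) L2
  L2_measurable0 L2_measurableC L2_measurable_bigcup.

Definition finite_second_moment (nu : probability L2 R) :=
  (\int[nu]_f (L2_norm f ^+ 2) < +oo)%E.

Definition coupling (nu1 nu2 : probability L2 R)
    (g : probability (L2 * L2)%type R) :=
  forall A, measurable A ->
    g (A `*` [set: L2]) = nu1 A /\ g ([set: L2] `*` A) = nu2 A.

Definition W2_sq (nu1 nu2 : probability L2 R) : \bar R :=
  ereal_inf [set (\int[g]_p (L2_dist p.1 p.2 ^+ 2))%E
            | g in coupling nu1 nu2].

Definition barycenter_cost m (L : 'I_m -> probability L2 R)
    (nu : probability L2 R) : \bar R :=
  ((m%:R^-1)%:E * \sum_(k < m) W2_sq nu (L k))%E.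

Definition W2_barycenter m (L : 'I_m -> probability L2 R)
    (nu : probability L2 R) :=
  finite_second_moment nu /\
  forall nu', finite_second_moment nu' ->
    (barycenter_cost L nu <= barycenter_cost L nu')%E.

Definition average_law m (L : 'I_m -> probability L2 R)
    (nu : probability L2 R) :=
  forall A, measurable A ->
    nu A = prod_prob L
      [set t : m.-tuple L2 | A (m%:R^-1 *: \sum_(k < m) tnth t k)].

End L2.

Arguments L2_norm {dT T R} mu f.

(* N(a, v) with variance v; the library's [normal_prob a 0] is not a Dirac mass *)
Definition gauss {R : realType} (a v : R) : set R -> \bar R :=
  if v == 0 then \d_a else normal_prob a (Num.sqrt v).

Section gaussian_process.
Context {dT : measure_display} {T : measurableType dT} {R : realType}.

(* Finite-dimensional distributions on the index set D, through their linear
   combinations. *)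
Definition is_GP (D : set T) {dO : measure_display} {O : measurableType dO}
    (Q : probability O R) (G : O -> T -> R) (a : T -> R) (C : T -> T -> R) :=
  forall (r : nat) (x : 'I_r -> T) (c : 'I_r -> R), (forall i, D (x i)) ->
  forall A : set R, measurable A ->
    Q [set w | A (\sum_(i < r) c i * G w (x i))] =
    gauss (\sum_(i < r) c i * a (x i))
          (\sum_(i < r) \sum_(j < r) c i * c j * C (x i) (x j)) A.

(* The joint measurability of the process makes its law on L_2 a function of
   the mean and of the covariance kernel. *)
Definition GP_law (mu : probability T R) (D : set T) (nu : probability (L2 mu) R)
    (a : T -> R) (C : T -> T -> R) :=
  exists (dO : measure_display) (O : measurableType dO) (Q : probability O R)
    (G : O -> L2 mu),
    [/\ measurable_fun ([set: O] `*` D) (fun p : O * T => (G p.1 : T -> R) p.2),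
        is_GP D Q (fun w => (G w : T -> R)) a C
      & forall A, measurable A -> nu A = Q (G @^-1` A)].

End gaussian_process.

Section kernel.
Context {R : realType} {d : nat}.
Local Notation point := (d.-tuple R).

Definition shift (h x : point) : point :=
  [tuple tnth x i + tnth h i | i < d].

Definition stationary (K : point -> point -> R) :=
  forall h x x', K (shift h x) (shift h x') = K x x'.

Definition positive_definite (K : point -> point -> R) :=
  (forall x x', K x x' = K x' x) /\
  forall (r : nat) (x : 'I_r -> point) (c : 'I_r -> R),
    0 <= \sum_(i < r) \sum_(j < r) c i * c j * K (x i) (x j).

(* Indices start at 0: the natural number i stands for the index i + 1 of
   N = {1, 2, ...}, both in one-dimensional indices and in multi-indices. *)
Definition multi_index := {ffun 'I_d -> nat}.

Definition prod_fun (psi : nat -> R -> R) (j : multi_index) : point -> R :=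
  fun x => \prod_(k < d) psi (j k) (tnth x k).

Definition prod_val (lam : nat -> R) (j : multi_index) : R :=
  \prod_(k < d) lam (j k).

Definition inner (f g : point -> R) : R :=
  (\int[unif R d]_(x in cube) (f x * g x))%R.

Definition cube_norm (f : point -> R) : \bar R :=
  L2_norm (unif R d) (f \_ cube).

Definition cube_dist (f g : point -> R) : \bar R := cube_norm (f \- g).

Definition orthonormal_basis (e : multi_index -> point -> R) :=
  [/\ forall j, measurable_fun cube (e j) /\ (cube_norm (e j) < +oo)%E,
      forall j j', inner (e j) (e j') = (j == j')%:R
    & forall f : L2 (unif R d),
        cube_norm (fun x => f x - partial_sum (fun j => inner f (e j) * e j x) J)
          @[J --> totally] --> 0%E].

Definition expansion (K : point -> point -> R) (lam : multi_index -> R)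
    (e : multi_index -> point -> R) :=
  forall x x', cube x -> cube x' ->
    partial_sum (fun j => lam j * e j x * e j x') @ totally --> K x x'.

Definition Theta (e : multi_index -> point -> R) (beta B : R)
    : set (L2 (unif R d)) :=
  [set f | (\esum_(j in [set: multi_index])
     (((\sum_(i < d) ((j i).+1%:R : R) ^+ 2) `^ beta * inner f (e j) ^+ 2)%:E)
     <= (B ^+ 2)%:E)%E].

End kernel.

Section model.
Context {R : realType} {d : nat}.
Local Notation point := (d.-tuple R).

(* m machines, n pairs (design point, observation) in each *)
Definition data (n m : nat) := m.-tuple (n.-tuple (point * R)).

Definition design n m (D : data n m) (k : 'I_m) (i : 'I_n) : point :=
  (tnth (tnth D k) i).1.

Definition response n m (D : data n m) (k : 'I_m) (i : 'I_n) : R :=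
  (tnth (tnth D k) i).2.

(* joint law of all the pairs (X_i^(k), eps_i^(k)) *)
Definition sample_law (n m : nat) (sigma : R)
    : probability (m.-tuple (n.-tuple (point * R))) R :=
  prod_prob (fun _ : 'I_m => prod_prob (fun _ : 'I_n =>
    (unif R d \x normalR 0 sigma)%E : probability (point * R)%type R)).

Definition observe n m (f0 : point -> R)
    (w : m.-tuple (n.-tuple (point * R))) : data n m :=
  [tuple [tuple (let p := tnth (tnth w k) i in (p.1, f0 p.1 + p.2)) | i < n]
         | k < m].

Definition expect n m (sigma : R) (f0 : point -> R) (F : data n m -> \bar R)
    : \bar R :=
  (\int[sample_law n m sigma]_w F (observe f0 w))%E.

Section posterior.
Variables (K : point -> point -> R) (sigma : R) (n m : nat) (D : data n m).

Definition gram_inv (k : 'I_m) : 'M[R]_n :=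
  invmx (\matrix_(i, j) K (design D k i) (design D k j)
         + (m%:R^-1 * sigma ^+ 2)%:M).

Definition local_mean (k : 'I_m) (x : point) : R :=
  ((\row_i K x (design D k i)) *m gram_inv k *m (\col_i response D k i)) 0 0.

Definition local_cov (k : 'I_m) (x x' : point) : R :=
  K x x' -
  ((\row_i K x (design D k i)) *m gram_inv k *m (\col_i K (design D k i) x')) 0 0.

Definition global_mean (x : point) : R :=
  m%:R^-1 * \sum_(k < m) local_mean k x.

Definition posterior_I (Pi : probability (L2 (unif R d)) R) :=
  exists2 L : 'I_m -> probability (L2 (unif R d)) R,
    forall k, GP_law cube (L k) (local_mean k)
                (fun x x' => m%:R * local_cov k x x')
    & average_law L Pi.

Definition posterior_II (Pi : probability (L2 (unif R d)) R) :=
  exists2 L : 'I_m -> probability (L2 (unif R d)) R,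
    forall k, GP_law cube (L k) (local_mean k) (local_cov k)
    & W2_barycenter L Pi.

End posterior.

Inductive method := MethodI | MethodII.

Definition global_posterior (a : method) :=
  match a with MethodI => posterior_I | MethodII => posterior_II end.

End model.

(* Main.v *)
Require Import Defs.
From HB Require Import structures.
From mathcomp Require Import all_boot all_order all_algebra finmap.
From mathcomp Require Import all_classical all_reals all_analysis.
From mathcomp Require Import showcase.summability measurable_realfun ring lra.
Set Implicit Arguments.
Unset Strict Implicit.
Unset Printing Implicit Defensive.
Import Order.TTheory GRing.Theory Num.Theory.
Import numFieldNormedType.Exports.
Local Open Scope classical_set_scope.
Local Open Scope ring_scope.

(** The proof takes place in the coordinates of the basis. Let [t = sigma^2 / m]
    be the regularisation of a machine, let [l = t / n], which is [sigma^2 / N],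
    and let [mu_j] be the eigenvalues. With infinitely many observations, the
    local posterior mean would multiply the coefficient of index [j] by [a_j =
    mu_j / (mu_j + l)]. This [l] is the regularisation that suits the whole data
    set: the adjustment of the local posteriors gives every machine the bias of
    a nonparametric estimator that sees all the observations.

    With [n] observations, the coefficients [theta] of the local mean are the
    fixed point of [theta_j = a_j (b_j - \sum_k E_jk theta_k)]
    ([ridge_normal_eq]), where [b] are the empirical coefficients of the
    responses and [E] is the deviation of the empirical Gram matrix of the basis
    functions from the identity. In the norm with weights [1 / a], the operator
    [a E] has squared Hilbert-Schmidt norm [Q = \sum_jk a_j a_k E_jk^2]. If [Q
    <= 1/4], then [theta] is comparable with [a b], and the bias, the noise and
    the posterior variance have explicit bounds ([ridge_bias], [ridge_noise],
    [ridge_variance]). The noise part of [theta] is [a U], with [U] linear in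
    the errors, up to a remainder whose squared norm is of relative size [Q].
    Averaging over the machines divides the variance of [a U] by [m], but not
    the remainder; so the good event is [Q <= 1 / (4 m)].

    The entries of [E] are averages of [n] bounded centred variables, whence the
    expectation of [Q^p] is at most [C_p (D^2 / n)^p], with the effective
    dimension [D = \sum_j a_j] ([hs_moment_le]), and the bad event has
    probability at most [C_p (m D^2 / n)^p]. Counting the multi-indices in a
    hyperbolic cross gives [D <= C x (1 + ln x)^(d - 1)] with [x = (N /
    sigma^2)^(d / (2 beta + d))] ([multi_sum_le], [box_dim_le]), and the growth
    condition on [m] turns [m D^2 / n] into a negative power of [N]. With [p]
    large, the bad event is so rare that crude bounds, polynomial in [N],
    suffice on it. On the good event, the squared bias is of order [l^(2 beta /
    (2 beta + d))] on the ellipsoid ([shrink_bias_le]), and the variance of the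
    averaged noise and the posterior variance are both of order [l D]. All of
    these have the announced size.

    The posterior enters only through [\int |f - f0|^2] and the inequality of
    Markov. For a Gaussian process law, the second moment about the mean is at
    most a multiple of the integral of the variance function ([GP_law_moments]).
    Averaging one draw per machine divides by [m] the variances that Method I
    has multiplied by [m] ([average_law_second_moment]). For Method II, the
    barycenter costs no more than the Dirac mass at the average of the
    means, and this alone bounds its spread by that of the local posteriors
    ([barycenter_second_moment]).

    Since there are infinitely many eigenfunctions, all of this is done for the
    indices in a finite box. The kernel is the limit of its truncations to boxes
    and the regularised inverse is continuous ([reg_sol_cvg]), so that local
    means and variances are pointwise limits. The lemma of Fatou, for the point
    at which the functions are read and then for the data, brings the bounds to
    the limit ([fatou_le]). *)

(** * Integrals *)

Section integral_tools.
Context {d} {T : measurableType d} {R : realType}.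

(** The integral of a nonnegative function is a supremum over the simple
    functions below it, hence monotone on all functions. The expectations of
    posterior probabilities, whose dependence on the data is arbitrary, are
    bounded in this way. *)
Lemma le_integral_nomeas (mu : {measure set T -> \bar R}) (f g : T -> \bar R) :
  (forall x, 0 <= f x)%E -> (forall x, f x <= g x)%E ->
  (\int[mu]_x f x <= \int[mu]_x g x)%E.
Proof.
move=> f0 fg; rewrite !ge0_integralTE//; last first.
  by move=> x; exact: le_trans (fg x).
apply: ge_ereal_sup => _ [h hf <-]; apply: ereal_sup_ubound; exists h => // x.
exact: le_trans (fg x).
Qed.

(** Raising [g] to infinity outside [A] does not change its integral. *)
Lemma integral_le_ae (mu : {measure set T -> \bar R}) (A : set T)
    (f g : T -> \bar R) : measurable A -> mu (~` A) = 0%E ->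
  (forall x, 0 <= f x)%E -> (forall x, 0 <= g x)%E ->
  measurable_fun [set: T] g ->
  (forall x, A x -> f x <= g x)%E -> (\int[mu]_x f x <= \int[mu]_x g x)%E.
Proof.
move=> mA A0 f0 g0 mg fg.
pose h x := if x \in A then g x else +oo%E.
have mh : measurable_fun [set: T] h.
  apply: measurable_fun_ifT => //.
  apply: (measurable_fun_bool true).
  rewrite setTI (_ : _ @^-1` _ = A)//; apply/seteqP; split=> x /=.
    exact: set_mem.
  exact: mem_set.
have h0 x : (0 <= h x)%E by rewrite /h; case: ifP.
apply: (@le_trans _ _ (\int[mu]_x h x)%E).
  apply: le_integral_nomeas => // x; rewrite /h.
  by case: ifPn => [/set_mem/fg//|_]; rewrite leey.
rewrite le_eqVlt; apply/orP; left; apply/eqP.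
apply: ge0_ae_eq_integral => //.
exists (~` A); split; [exact: measurableC|by []|].
move=> x /= H Ax; apply: H => _; rewrite /h.
by rewrite mem_set.
Qed.

End integral_tools.

(** The truncations [f_ q] to finite boxes of indices are explicit and
    measurable; their limit [F] is only compared with them. This form of the
    lemma of Fatou serves for the point at which a function is read as well as
    for the data. *)
Lemma fatou_le {d} {T : measurableType d} {R : realType} (mu : probability T R)
    (A : set T) (f_ : nat -> T -> R) (F : T -> \bar R) (B_ : nat -> R) :
  measurable A -> mu (~` A) = 0%E ->
  (forall q, measurable_fun [set: T] (f_ q)) -> (forall q x, 0 <= f_ q x) ->
  (forall x, 0 <= F x)%E ->
  (forall x, A x -> (F x <= limn_einf (fun q => (f_ q x)%:E))%E) ->
  (forall q, \int[mu]_x (f_ q x)%:E <= (B_ q)%:E)%E ->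
  (\int[mu]_x F x <= limn_einf (fun q => (B_ q)%:E))%E.
Proof.
move=> mA A0 mf f0 F0 Ff fB.
apply: (@le_trans _ _ (\int[mu]_x limn_einf (fun q => (f_ q x)%:E))%E).
  apply: (integral_le_ae mA A0) => //.
  - move=> x; rewrite limn_einf_lim; apply: lime_ge; first exact: is_cvg_einfs.
    by apply: nearW => q; apply: le_ereal_inf_tmp => _ [k /= _ <-]; rewrite lee_fin.
  - rewrite (_ : (fun x => _) = fun x => (- limn_esup (fun q => (- f_ q x)%:E))%E); last first.
      by apply/funext => x; rewrite -[LHS]oppeK -limn_esupN.
    apply: (measurableT_comp (@oppe_measurable _ _)).
    apply: measurable_fun_limn_esup => q; apply/measurable_EFinP.
    exact: (measurableT_comp (@oppr_measurable _ _) (mf q)).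
apply: le_trans (fatou mu measurableT (f := fun q x => (f_ q x)%:E) _ _) _.
- by move=> q; exact/measurable_EFinP.
- by move=> q x _; rewrite lee_fin.
rewrite !limn_einf_lim; apply: lee_lim; [exact: is_cvg_einfs..|].
apply: nearW => q; apply: le_ereal_inf_tmp => _ [k /= qk <-].
apply: le_trans (fB k); apply: ereal_inf_lbound; by exists k.
Qed.

Lemma limn_einf_le {R : realType} (u v : nat -> R) : (forall q, u q <= v q) ->
  (limn_einf (fun q => (u q)%:E) <= limn_einf (fun q => (v q)%:E))%E.
Proof.
move=> uv; rewrite !limn_einf_lim; apply: lee_lim; [exact: is_cvg_einfs..|].
apply: nearW => q; apply: le_ereal_inf_tmp => _ [k /= qk <-].
apply: (@le_trans _ _ (u k)%:E); last by rewrite lee_fin.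
apply: ereal_inf_lbound; by exists k.
Qed.

Lemma cvg_limn_einf {R : realType} (u : nat -> R) (l : R) :
  u q @[q --> \oo] --> l -> limn_einf (fun q => (u q)%:E) = l%:E.
Proof.
move=> ul; have H : (u q)%:E @[q --> \oo] --> l%:E.
  by apply: cvg_EFin => //; exact: nearW.
by rewrite is_cvg_limn_einfE; [rewrite (cvg_lim _ H)|apply/cvg_ex; exists l%:E].
Qed.

Lemma le_limn_einf {R : realType} (u v : nat -> R) (l : R) :
  u q @[q --> \oo] --> l -> (forall q, u q <= v q) ->
  (l%:E <= limn_einf (fun q => (v q)%:E))%E.
Proof. by move=> /cvg_limn_einf <-; exact: limn_einf_le. Qed.

Lemma limn_einf_lin {R : realType} (u v : nat -> R) (a b : R) :
  (forall q, 0 <= u q) -> (forall q, 0 <= v q) -> 0 <= a -> 0 <= b ->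
  (a%:E * limn_einf (fun q => (u q)%:E) + b%:E * limn_einf (fun q => (v q)%:E) <=
   limn_einf (fun q => (a * u q + b * v q)%:E))%E.
Proof.
move=> u0 v0 a0 b0; pose U q := (u q)%:E; pose V q := (v q)%:E.
have ge0 (w : nat -> R) : (forall q, 0 <= w q) -> (0 <= limn_einf (fun q => (w q)%:E))%E.
  by move=> w0; apply: (le_limn_einf (u := fun=> 0)) => //; exact: cvg_cst.
have cU : einfs U q @[q --> \oo] --> limn_einf U by rewrite limn_einf_lim; exact: is_cvg_einfs.
have cV : einfs V q @[q --> \oo] --> limn_einf V by rewrite limn_einf_lim; exact: is_cvg_einfs.
have c1 : (a%:E * einfs U q + b%:E * einfs V q)%E @[q --> \oo] -->
    (a%:E * limn_einf U + b%:E * limn_einf V)%E.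
  apply: cvgeD; [|exact: cvgeZl..].
  by apply: ge0_adde_def; rewrite inE mule_ge0// ?lee_fin//; exact: ge0.
rewrite -(cvg_lim _ c1)// limn_einf_lim; apply: lee_lim.
- by apply/cvg_ex; eexists; exact: c1.
- exact: is_cvg_einfs.
apply: nearW => q; apply: le_ereal_inf_tmp => _ [k /= qk <-].
rewrite EFinD !EFinM; apply: leeD; apply: lee_wpmul2l; rewrite ?lee_fin//;
  by apply: ereal_inf_lbound; exists k.
Qed.

Section square_integrable.
Context {d} {T : measurableType d} {R : realType}.
Variable P : probability T R.

Lemma integral_cstP (c : \bar R) : (\int[P]_x c = c)%E.
Proof.
by rewrite integral_cst// [X in (_ * X)%E](_ : _ = 1%E) ?mule1//; exact: probability_setT.
Qed.

Lemma sq_integrable (f : T -> R) : measurable_fun [set: T] f ->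
  (\int[P]_x (f x ^+ 2)%:E < +oo)%E -> P.-integrable [set: T] (EFin \o f).
Proof.
move=> mf f2.
have mf2 : measurable_fun [set: T] (fun x => f x ^+ 2) by exact: measurable_funX.
have i2 : P.-integrable [set: T] (fun x => (1 + f x ^+ 2)%:E).
  rewrite (_ : (fun x => _) = (cst 1%:E \+ (fun x => (f x ^+ 2)%:E))%E)//.
  apply: integrableD => //.
    exact: finite_measure_integrable_cst.
  apply/integrableP; split; first exact/measurable_EFinP.
  under eq_integral do rewrite gee0_abs ?lee_fin ?sqr_ge0//.
  exact: f2.
apply: (le_integrable _ _ _ i2) => //; first exact/measurable_EFinP.
move=> x _; rewrite /= lee_fin.
rewrite [leRHS]ger0_norm ?addr_ge0 ?sqr_ge0//.
rewrite -[f x ^+ 2]real_normK ?num_real//.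
have := sqr_ge0 (`|f x| - 1).
have : 0 <= `|f x| by [].
move: (`|f x|) => y; nra.
Qed.

End square_integrable.

(** * Finite products of probability measures *)

Section product.
Context {dT} {T : measurableType dT} {R : realType}.

Lemma tnth_tcons0 n (p : T * n.-tuple T) : tnth (tcons p) ord0 = p.1.
Proof. by rewrite (tnth_nth p.1). Qed.

Lemma tnth_tconsS n (p : T * n.-tuple T) (i : 'I_n) :
  tnth (tcons p) (lift ord0 i) = tnth p.2 i.
Proof. by rewrite !(tnth_nth p.1). Qed.

(** The first coordinate is integrated last, which is what inductions on the
    number of factors need. *)
Lemma integral_prod_probS n (P : 'I_n.+1 -> probability T R)
    (F : n.+1.-tuple T -> \bar R) :
  measurable_fun [set: n.+1.-tuple T] F -> (forall t, 0 <= F t)%E ->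
  (\int[prod_prob P]_t F t =
   \int[P ord0]_x \int[prod_prob (fun i : 'I_n => P (lift ord0 i))]_t F (tcons (x, t)))%E.
Proof.
move=> mF F0.
rewrite /= (ge0_integral_pushforward (@measurable_tcons _ _ n))//=.
rewrite preimage_setT.
rewrite (@fubini_tonelli1 _ _ _ _ _ _ _ (F \o @tcons _ _ n))//=.
apply: measurableT_comp => //; exact: measurable_tcons.
Qed.

Lemma ge0_integral_tnth n (P : 'I_n -> probability T R) (i : 'I_n)
    (G : T -> \bar R) : measurable_fun [set: T] G -> (forall x, 0 <= G x)%E ->
  (\int[prod_prob P]_t G (tnth t i) = \int[P i]_x G x)%E.
Proof.
move=> mG G0.
elim: n P i => [P []//|n IH P i].
rewrite integral_prod_probS//; last first.
  by apply: measurableT_comp => //; exact: measurable_tnth.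
have [->|] := eqVneq i ord0.
  apply: eq_integral => x _.
  under eq_integral do rewrite tnth_tcons0/=.
  by rewrite integral_cstP.
rewrite eq_sym => /unlift_some[/= j -> _].
under eq_integral do (under eq_integral do rewrite tnth_tconsS/=).
under eq_integral do rewrite (IH (fun i : 'I_n => P (lift ord0 i)))//.
by rewrite integral_cstP.
Qed.

Lemma integral_tnth n (P : 'I_n -> probability T R) (i : 'I_n)
    (G : T -> \bar R) : measurable_fun [set: T] G ->
  (\int[prod_prob P]_t G (tnth t i) = \int[P i]_x G x)%E.
Proof.
move=> mG; rewrite integralE [RHS]integralE; congr (_ - _)%E.
  rewrite -(ge0_integral_tnth P i (measurable_funepos mG))//.
  by rewrite (funepos_comp G (fun t : n.-tuple T => tnth t i)).
rewrite -(ge0_integral_tnth P i (measurable_funeneg mG))//.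
by rewrite (funeneg_comp G (fun t : n.-tuple T => tnth t i)).
Qed.

Lemma prod_prob_tnth n (P : 'I_n -> probability T R) (i : 'I_n) (A : set T) :
  measurable A -> prod_prob P [set t | A (tnth t i)] = P i A.
Proof.
move=> mA.
have mB : measurable [set t : n.-tuple T | A (tnth t i)].
  by rewrite -[X in measurable X]setTI; exact: measurable_tnth.
rewrite -(setIT [set t | _]) -integral_indic//.
rewrite -[in RHS](setIT A) -integral_indic//.
rewrite -(integral_tnth P i (G := fun x => (\1_A x)%:E))//.
exact/measurable_EFinP/measurable_indic.
Qed.

Lemma prod_prob_forall n (P : 'I_n -> probability T R) (A : 'I_n -> set T) :
  (forall i, measurable (A i)) -> (forall i, P i (~` A i) = 0%E) ->
  measurable [set t : n.-tuple T | forall i, A i (tnth t i)] /\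
  prod_prob P (~` [set t | forall i, A i (tnth t i)]) = 0%E.
Proof.
move=> mA A0.
have mB i : measurable [set t : n.-tuple T | A i (tnth t i)].
  by rewrite -[X in measurable X]setTI; exact: measurable_tnth.
have E : [set t : n.-tuple T | forall i, A i (tnth t i)] =
    \bigcap_(i in [set: 'I_n]) [set t | A i (tnth t i)].
  by apply/seteqP; split => t /= H i; [move=> _; exact: H|exact: H].
split.
  by rewrite E; apply: fin_bigcap_measurable => // *; exact: finite_finset.
have : prod_prob P (\bigcup_(i in [set: 'I_n]) ~` [set t | A i (tnth t i)]) = 0%E.
  apply/eqP; rewrite eq_le measure_ge0 andbT.
  have fin : finite_set [set: 'I_n] by exact: finite_finset.
  have mC i : measurable (~` [set t : n.-tuple T | A i (tnth t i)]) by exact: measurableC.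
  have mU : measurable (\bigcup_(i in [set: 'I_n])
      ~` [set t : n.-tuple T | A i (tnth t i)]).
    by apply: fin_bigcup_measurable => // i _; exact: mC.
  apply: (le_trans (@content_sub_fsum _ _ _ (prod_prob P) _ _ _ _ fin
    (fun i _ => mC i) mU (@subset_refl _ _))).
  rewrite fsbig1// => i _.
  exact: etrans (prod_prob_tnth P i (measurableC (mA i))) (A0 i).
by rewrite -setC_bigcap -E.
Qed.

Lemma measurable_sum_tnth n (xi : 'I_n -> T -> R) :
  (forall i, measurable_fun [set: T] (xi i)) ->
  measurable_fun [set: n.-tuple T] (fun t => \sum_(i < n) xi i (tnth t i)).
Proof.
move=> mxi; apply: measurable_sum => i.
by apply: measurableT_comp => //; exact: measurable_tnth.
Qed.

(** Orthogonality of independent centred variables. The cross terms are removed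
    one coordinate at a time: once the first coordinate is fixed, the other ones
    only meet a constant. *)
Lemma integral_sum_sqr n (P : 'I_n -> probability T R) (xi : 'I_n -> T -> R)
    (v : 'I_n -> R) (c : R) :
  (forall i, measurable_fun [set: T] (xi i)) ->
  (forall i, \int[P i]_x (xi i x)%:E = 0)%E ->
  (forall i, \int[P i]_x (xi i x ^+ 2)%:E <= (v i)%:E)%E ->
  (\int[prod_prob P]_t (\sum_(i < n) xi i (tnth t i))%:E = 0)%E /\
  (\int[prod_prob P]_t ((c + \sum_(i < n) xi i (tnth t i)) ^+ 2)%:E <=
     (c ^+ 2 + \sum_(i < n) v i)%:E)%E.
Proof.
move=> mxi xi0 xi2.
have ixi i : (P i).-integrable [set: T] (EFin \o xi i).
  by apply: sq_integrable => //; rewrite (le_lt_trans (xi2 i)) ?ltry.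
have sum0 k (Q : 'I_k -> probability T R) (z : 'I_k -> T -> R) :
    (forall i, measurable_fun [set: T] (z i)) ->
    (forall i, \int[Q i]_x (z i x)%:E = 0)%E ->
    (forall i, (Q i).-integrable [set: T] (EFin \o z i)) ->
    (prod_prob Q).-integrable [set: k.-tuple T]
      (fun t => (\sum_(i < k) z i (tnth t i))%:E) /\
    (\int[prod_prob Q]_t (\sum_(i < k) z i (tnth t i))%:E = 0)%E.
  move=> mz z0 iz.
  have E : (fun t : k.-tuple T => (\sum_(i < k) z i (tnth t i))%:E) =
      (fun t : k.-tuple T => \sum_(i < k) (z i (tnth t i))%:E)%E.
    by apply/funext => t; rewrite sumEFin.
  have I i : (prod_prob Q).-integrable [set: k.-tuple T]
      (fun t => (z i (tnth t i))%:E).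
    apply/integrableP; split.
      by apply/measurable_EFinP; apply: measurableT_comp => //; exact: measurable_tnth.
    rewrite (ge0_integral_tnth Q i (G := fun x => `|(z i x)%:E|%E))//.
      by have /integrableP[] := iz i.
    by apply: measurableT_comp => //; exact/measurable_EFinP.
  rewrite E; split; first by apply: integrable_sum => // i _; exact: I.
  rewrite integral_sum//; apply: big1 => i _.
  rewrite (integral_tnth Q i (G := fun x => (z i x)%:E))//.
  exact/measurable_EFinP.
split; first by case: (sum0 _ P xi mxi xi0 ixi).
elim: n P xi v c mxi xi0 xi2 ixi => [|n IH] P xi v c mxi xi0 xi2 ixi.
  rewrite big_ord0 addr0.
  under eq_integral do rewrite big_ord0 addr0.
  by rewrite integral_cstP.
rewrite integral_prod_probS//; last 2 first.
- apply/measurable_EFinP; apply: measurable_funX; apply: measurable_funD => //.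
  exact: measurable_sum_tnth.
- by move=> t; rewrite lee_fin sqr_ge0.
apply: (@le_trans _ _ (\int[P ord0]_x
  ((c + xi ord0 x) ^+ 2 + \sum_(i < n) v (lift ord0 i))%:E)%E).
  apply: le_integral_nomeas => x.
    by apply: integral_ge0 => t _; rewrite lee_fin sqr_ge0.
  under eq_integral.
    move=> t _; rewrite big_ord_recl tnth_tcons0/= addrA.
    under eq_bigr do rewrite tnth_tconsS/=.
    over.
  exact: (IH (fun i : 'I_n => P (lift ord0 i)) (fun i : 'I_n => xi (lift ord0 i)) _
    (c + xi ord0 x)).
have V0 : 0 <= \sum_(i < n) v (lift ord0 i).
  apply: sumr_ge0 => i _; rewrite -lee_fin (le_trans _ (xi2 _))//.
  by apply: integral_ge0 => x _; rewrite lee_fin sqr_ge0.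
have mx2 : measurable_fun [set: T] (fun x => xi ord0 x ^+ 2).
  exact: measurable_funX.
have i2 : (P ord0).-integrable [set: T] (fun x => (xi ord0 x ^+ 2)%:E).
  apply/integrableP; split; first exact/measurable_EFinP.
  under eq_integral do rewrite gee0_abs ?lee_fin ?sqr_ge0//.
  exact: le_lt_trans (xi2 ord0) (ltry _).
have i1 : (P ord0).-integrable [set: T] (fun x => (c *+ 2)%:E * (xi ord0 x)%:E)%E.
  exact: (integrableZl measurableT _ (ixi ord0)).
have i0 : (P ord0).-integrable [set: T]
   (fun x => (c ^+ 2 + \sum_(i < n) v (lift ord0 i))%:E).
  exact: finite_measure_integrable_cst.
rewrite (_ : (fun x => _) = (fun x => (c ^+ 2 + \sum_(i < n) v (lift ord0 i))%:E +
    ((c *+ 2)%:E * (xi ord0 x)%:E + (xi ord0 x ^+ 2)%:E))%E); last first.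
  by apply/funext => x; rewrite -EFinM -!EFinD; congr EFin; ring.
rewrite integralD//=; last exact: integrableD.
rewrite integralD//=.
rewrite integralZl//; last exact: ixi.
rewrite xi0 mule0 add0e integral_cstP.
have -> : c ^+ 2 + \sum_(i < n.+1) v i =
    c ^+ 2 + \sum_(i < n) v (lift ord0 i) + v ord0.
  by rewrite big_ord_recl; ring.
by rewrite [leRHS]EFinD leeD.
Qed.

Lemma integral_prod_le n (P : 'I_n -> probability T R) (g : 'I_n -> T -> R)
    (c : 'I_n -> R) :
  (forall i, measurable_fun [set: T] (g i)) -> (forall i x, 0 <= g i x) ->
  (forall i, \int[P i]_x (g i x)%:E <= (c i)%:E)%E ->
  (\int[prod_prob P]_t (\prod_(i < n) g i (tnth t i))%:E <= (\prod_(i < n) c i)%:E)%E.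
Proof.
move=> mg g0 gc; elim: n P g c mg g0 gc => [|n IH] P g c mg g0 gc.
  under eq_integral do rewrite big_ord0.
  by rewrite big_ord0 integral_cstP.
rewrite integral_prod_probS//; last 2 first.
- apply/measurable_EFinP; apply: measurable_prod => i _.
  by apply: measurableT_comp => //; exact: measurable_tnth.
- by move=> t; rewrite lee_fin prodr_ge0.
have c0 i : 0 <= c i.
  by rewrite -lee_fin (le_trans _ (gc i))// integral_ge0// => x _; rewrite lee_fin.
apply: (@le_trans _ _ (\int[P ord0]_x ((g ord0 x)%:E *
    (\prod_(i < n) c (lift ord0 i))%:E))%E).
  apply: le_integral_nomeas => x.
    by apply: integral_ge0 => t _; rewrite lee_fin prodr_ge0.
  under eq_integral.
    move=> t _; rewrite big_ord_recl tnth_tcons0/= EFinM.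
    under eq_bigr do rewrite tnth_tconsS/=.
    over.
  rewrite ge0_integralZl//=; last 3 first.
  - apply/measurable_EFinP; apply: (@measurable_prod _ _ _ _ _ _ (fun i t => g (lift ord0 i) (tnth t i))) => i _.
    by apply: measurableT_comp => //; exact: measurable_tnth.
  - by move=> t _; rewrite lee_fin prodr_ge0.
  - by rewrite lee_fin.
  by apply: lee_wpmul2l; [rewrite lee_fin|exact: (IH (fun i : 'I_n => P (lift ord0 i)) (fun i : 'I_n => g (lift ord0 i)))].
rewrite ge0_integralZr//; last 3 first.
- exact/measurable_EFinP.
- by move=> x _; rewrite lee_fin.
- by rewrite lee_fin prodr_ge0.
rewrite big_ord_recl EFinM; apply: lee_wpmul2r; last exact: gc.
by rewrite lee_fin prodr_ge0.
Qed.

End product.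

(** * Kernel ridge regression in coordinates *)

(** Lagrange's identity: the difference of the two sides is a sum of squares. *)
Lemma Cauchy_Schwarz_weighted (R : realFieldType) (I : finType) (a x y : I -> R) :
  (forall i, 0 < a i) ->
  (\sum_i x i * y i) ^+ 2 <= (\sum_i a i * x i ^+ 2) * (\sum_i y i ^+ 2 / a i).
Proof.
move=> a0.
have H : 0 <= \sum_i \sum_j (a i * x i * y j - a j * x j * y i) ^+ 2 / (a i * a j).
  apply: sumr_ge0 => i _; apply: sumr_ge0 => j _.
  by rewrite divr_ge0 ?sqr_ge0// mulr_ge0// ltW.
have E : \sum_i \sum_j (a i * x i * y j - a j * x j * y i) ^+ 2 / (a i * a j) =
  2 * ((\sum_i a i * x i ^+ 2) * (\sum_i y i ^+ 2 / a i) - (\sum_i x i * y i) ^+ 2).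
  rewrite (eq_bigr (fun i => a i * x i ^+ 2 * (\sum_j y j ^+ 2 / a j)
     + (\sum_j a j * x j ^+ 2) * (y i ^+ 2 / a i)
     - 2 * (x i * y i * (\sum_j x j * y j)))).
    by rewrite !big_split/= sumrN -!mulr_sumr -!mulr_suml; ring.
  move=> i _; rewrite !mulr_sumr mulr_suml -big_split/= -sumrN -big_split/=.
  by apply: eq_bigr => j _; field; rewrite !gt_eqF.
by move: H; rewrite E; lra.
Qed.

Lemma Cauchy_Schwarz_sum (R : realFieldType) (I : finType) (x y : I -> R) :
  (\sum_i x i * y i) ^+ 2 <= (\sum_i x i ^+ 2) * (\sum_i y i ^+ 2).
Proof.
have := @Cauchy_Schwarz_weighted R I (fun=> 1) x y (fun=> ltr01).
under [X in _ <= X * _]eq_bigr do rewrite mul1r.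
by under [X in _ <= _ * X]eq_bigr do rewrite divr1.
Qed.

Section fixed_point.
Context {R : realFieldType} {J : finType}.
Variables (a : J -> R) (E : J -> J -> R).
Hypothesis a_gt0 : forall j, 0 < a j.

Definition hs_norm2 := \sum_j \sum_k a j * a k * E j k ^+ 2.

(** In the norm with weights [1 / a], the squared Hilbert-Schmidt norm of the
    operator [theta |-> a * (E theta)] is [hs_norm2], and it bounds the operator
    norm by the weighted inequality of Cauchy and Schwarz. *)
Lemma fixpoint_remainder (theta b : J -> R) :
  (forall j, theta j = a j * (b j - \sum_k E j k * theta k)) ->
  \sum_j (theta j - a j * b j) ^+ 2 / a j <= hs_norm2 * \sum_j theta j ^+ 2 / a j.
Proof.
move=> th.
apply: (@le_trans _ _ (\sum_j (a j * (\sum_k a k * E j k ^+ 2)) *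
    (\sum_j theta j ^+ 2 / a j))).
  apply: ler_sum => j _.
  have -> : (theta j - a j * b j) ^+ 2 / a j = a j * (\sum_k E j k * theta k) ^+ 2.
    by rewrite th; field; rewrite gt_eqF.
  rewrite -mulrA; apply: ler_wpM2l; first exact: ltW.
  exact: Cauchy_Schwarz_weighted.
rewrite -mulr_suml ler_wpM2r//.
  by apply: sumr_ge0 => j _; rewrite divr_ge0 ?sqr_ge0// ltW.
apply: ler_sum => j _; rewrite mulr_sumr le_eqVlt; apply/orP; left; apply/eqP.
by apply: eq_bigr => k _; rewrite mulrA.
Qed.

(** The remainder is at most half the size of the solution, and can be absorbed
    in the left-hand side. *)
Lemma fixpoint_bound (theta b : J -> R) : hs_norm2 <= 4^-1 ->
  (forall j, theta j = a j * (b j - \sum_k E j k * theta k)) ->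
  \sum_j theta j ^+ 2 / a j <= 4 * \sum_j a j * b j ^+ 2.
Proof.
move=> Q4 th; have := fixpoint_remainder th.
set S := \sum_j theta j ^+ 2 / a j; set D := \sum_j _.
have S0 : 0 <= S by apply: sumr_ge0 => j _; rewrite divr_ge0 ?sqr_ge0// ltW.
have : S <= 2 * (\sum_j a j * b j ^+ 2) + 2 * D.
  rewrite !mulr_sumr -big_split/=; apply: ler_sum => j _.
  have -> : 2 * (a j * b j ^+ 2) = 2 * (a j * b j) ^+ 2 / a j by field; rewrite gt_eqF.
  rewrite mulrA -mulrDl; apply: ler_wpM2r; first by rewrite invr_ge0 ltW.
  have := sqr_ge0 (theta j - 2 * (a j * b j)); nra.
have : hs_norm2 * S <= 4^-1 * S by rewrite ler_wpM2r.
lra.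
Qed.

Lemma fixpoint_remainder_bound (theta b : J -> R) : hs_norm2 <= 4^-1 ->
  (forall j, theta j = a j * (b j - \sum_k E j k * theta k)) ->
  \sum_j (theta j - a j * b j) ^+ 2 / a j <=
    4 * hs_norm2 * \sum_j a j * b j ^+ 2.
Proof.
move=> Q4 th; apply: le_trans (fixpoint_remainder th) _.
rewrite [4 * _]mulrC -mulrA ler_wpM2l ?fixpoint_bound//.
by apply: sumr_ge0 => j _; apply: sumr_ge0 => k _; rewrite mulr_ge0 ?sqr_ge0 ?mulr_ge0// ltW.
Qed.

End fixed_point.

Section regularized_system.
Context {R : realFieldType} {n : nat}.
Variables (G : 'I_n -> 'I_n -> R) (t : R).
Hypothesis t_gt0 : 0 < t.
Hypothesis G_psd : forall c : 'I_n -> R, 0 <= \sum_i \sum_j c i * c j * G i j.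

(** Expanding the square of [G c + t c], the cross term is nonnegative. *)
Lemma regularized_bound (c y : 'I_n -> R) :
  (forall i, \sum_j G i j * c j + t * c i = y i) ->
  t ^+ 2 * \sum_i c i ^+ 2 <= \sum_i y i ^+ 2.
Proof.
move=> cy; have := G_psd c.
rewrite (eq_bigr (fun i => c i * \sum_j G i j * c j)); last first.
  by move=> i _; rewrite mulr_sumr; apply: eq_bigr => j _; ring.
move=> H.
rewrite [leRHS](eq_bigr (fun i => (\sum_j G i j * c j) ^+ 2
    + 2 * t * (c i * \sum_j G i j * c j) + t ^+ 2 * c i ^+ 2)); last first.
  by move=> i _; rewrite -cy; ring.
rewrite !big_split/= -!mulr_sumr lerDr addr_ge0//.
  by apply: sumr_ge0 => i _; exact: sqr_ge0.
by rewrite !mulr_ge0// ltW.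
Qed.

End regularized_system.

Section ridge.
Context {R : realFieldType} {J : finType} {n : nat}.
Variables (mu : J -> R) (psi : J -> 'I_n -> R) (t : R).
Hypothesis n_gt0 : (0 < n)%N.
Hypothesis t_gt0 : 0 < t.
Hypothesis mu_gt0 : forall j, 0 < mu j.

Let lam := t / n%:R.
Definition shrink (l : R) (j : J) := mu j / (mu j + l).
Local Notation a := (shrink lam).

Definition gram_dev (j k : J) :=
  n%:R^-1 * (\sum_i psi j i * psi k i) - (j == k)%:R.

Definition emp_kernel (i i' : 'I_n) := \sum_j mu j * psi j i * psi j i'.

Definition ridge_coef (c : 'I_n -> R) (j : J) := mu j * \sum_i c i * psi j i.

Definition hs_dev := hs_norm2 a gram_dev.

Let n0 : n%:R != 0 :> R. Proof. by rewrite pnatr_eq0 -lt0n. Qed.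
Let lam_gt0 : 0 < lam. Proof. by rewrite divr_gt0// ltr0n. Qed.

Lemma shrink_gt0 j : 0 < a j.
Proof. by rewrite divr_gt0// addr_gt0. Qed.

Lemma shrink_le1 j : a j <= 1.
Proof. by rewrite ler_pdivrMr ?addr_gt0// mul1r lerDl ltW. Qed.

Lemma emp_kernel_psd (c : 'I_n -> R) :
  0 <= \sum_i \sum_i' c i * c i' * emp_kernel i i'.
Proof.
have -> : \sum_i \sum_i' c i * c i' * emp_kernel i i' =
   \sum_j mu j * (\sum_i c i * psi j i) ^+ 2.
  transitivity (\sum_i \sum_i' \sum_j c i * c i' * (mu j * psi j i * psi j i')).
    by apply: eq_bigr => i _; apply: eq_bigr => i' _; rewrite mulr_sumr.
  under eq_bigr do rewrite exchange_big/=.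
  rewrite exchange_big/=; apply: eq_bigr => j _.
  rewrite expr2 mulr_suml mulr_sumr; apply: eq_bigr => i _.
  by rewrite !mulr_sumr; apply: eq_bigr => i' _; ring.
by apply: sumr_ge0 => j _; rewrite mulr_ge0 ?sqr_ge0// ltW.
Qed.

Lemma ridge_fit (c : 'I_n -> R) i :
  \sum_i' emp_kernel i i' * c i' = \sum_k ridge_coef c k * psi k i.
Proof.
rewrite /ridge_coef.
transitivity (\sum_i' \sum_k mu k * psi k i * psi k i' * c i').
  by apply: eq_bigr => i' _; rewrite mulr_suml.
rewrite exchange_big/=; apply: eq_bigr => k _.
rewrite mulrAC mulr_sumr; apply: eq_bigr => i' _; ring.
Qed.

(** The normal equations, written with the deviation of the empirical Gram
    matrix from the identity only: the population operator is diagonal in these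
    coordinates and has been inverted. *)
Lemma ridge_normal_eq (c y : 'I_n -> R) :
  (forall i, \sum_i' emp_kernel i i' * c i' + t * c i = y i) ->
  forall j, ridge_coef c j = a j *
    (n%:R^-1 * (\sum_i psi j i * y i) - \sum_k gram_dev j k * ridge_coef c k).
Proof.
move=> cy j; set th := ridge_coef c.
have -> : n%:R^-1 * (\sum_i psi j i * y i) =
    \sum_k n%:R^-1 * (\sum_i psi j i * psi k i) * th k + lam * (th j / mu j).
  have -> : lam * (th j / mu j) = n%:R^-1 * (t * \sum_i c i * psi j i).
    by rewrite /th /ridge_coef /lam; field; rewrite n0 gt_eqF.
  have -> : \sum_k n%:R^-1 * (\sum_i psi j i * psi k i) * th k =
      n%:R^-1 * \sum_i psi j i * (\sum_k th k * psi k i).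
    rewrite mulr_sumr.
    transitivity (\sum_k \sum_i n%:R^-1 * (psi j i * psi k i) * th k).
      by apply: eq_bigr => k _; rewrite mulr_sumr mulr_suml.
    rewrite exchange_big/=; apply: eq_bigr => i _.
    by rewrite !mulr_sumr; apply: eq_bigr => k _; ring.
  rewrite -mulrDr mulr_sumr -big_split/=; congr (_ * _).
  by apply: eq_bigr => i _; rewrite -cy ridge_fit; ring.
have -> : \sum_k gram_dev j k * th k =
    \sum_k n%:R^-1 * (\sum_i psi j i * psi k i) * th k - th j.
  rewrite /gram_dev.
  under eq_bigr do rewrite mulrBl.
  rewrite big_split/= sumrN; congr (_ - _).
  rewrite (bigD1 j)//= eqxx mul1r big1 ?addr0// => k kj.
  by rewrite eq_sym (negbTE kj) mul0r.
rewrite /a; field.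
by rewrite !gt_eqF// addr_gt0.
Qed.

(** A bound that holds for every design, for the event on which the empirical
    Gram matrix is far from the identity. *)
Lemma ridge_coef_bound (c y : 'I_n -> R) (M : R) :
  (forall j i, `|psi j i| <= M) ->
  (forall i, \sum_i' emp_kernel i i' * c i' + t * c i = y i) ->
  \sum_j ridge_coef c j ^+ 2 <=
    (\sum_j mu j ^+ 2) * (M ^+ 2 * n%:R * (\sum_i y i ^+ 2) / t ^+ 2).
Proof.
move=> psiM cy; rewrite mulr_suml; apply: ler_sum => j _.
rewrite /ridge_coef exprMn ler_wpM2l ?sqr_ge0//.
apply: le_trans (Cauchy_Schwarz_sum c (psi j)) _.
have H := regularized_bound t_gt0 emp_kernel_psd cy.
have H1 : \sum_i c i ^+ 2 <= (\sum_i y i ^+ 2) / t ^+ 2.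
  by rewrite ler_pdivlMr ?exprn_gt0// mulrC.
have H2 : \sum_i psi j i ^+ 2 <= M ^+ 2 * n%:R.
  rewrite mulr_natr -[n in _ *+ n]card_ord -sumr_const; apply: ler_sum => i _.
  rewrite -[psi j i ^+ 2]real_normK ?num_real//.
  by rewrite lerXn2r ?nnegrE// (le_trans _ (psiM j i)).
rewrite -mulrA mulrC; apply: ler_pM => //;
  by apply: sumr_ge0 => i _; exact: sqr_ge0.
Qed.

Lemma weighted_le (v : J -> R) : \sum_j v j ^+ 2 <= \sum_j v j ^+ 2 / a j.
Proof.
apply: ler_sum => j _; rewrite ler_pdivlMr ?shrink_gt0//.
by rewrite ler_piMr ?sqr_ge0// shrink_le1.
Qed.

(** Bias. The target of the comparison is the population regularisation
    [a * f] of the signal; only the empirical fluctuation of its residual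
    remains. *)
Lemma ridge_bias (c y : 'I_n -> R) (fc : J -> R) : hs_dev <= 4^-1 ->
  (forall i, \sum_i' emp_kernel i i' * c i' + t * c i = y i) ->
  \sum_j (ridge_coef c j - a j * fc j) ^+ 2 <=
  4 * \sum_j a j * (n%:R^-1 *
        (\sum_i psi j i * (y i - \sum_k a k * fc k * psi k i))
      - (fc j - a j * fc j)) ^+ 2.
Proof.
move=> Q4 cy; apply: le_trans (weighted_le _) _.
apply: (fixpoint_bound shrink_gt0 Q4) => j.
rewrite (ridge_normal_eq cy j).
set th := ridge_coef c.
have -> : \sum_k gram_dev j k * (th k - a k * fc k) =
  \sum_k gram_dev j k * th k - \sum_k gram_dev j k * (a k * fc k).
  by rewrite -sumrB; apply: eq_bigr => k _; ring.
have -> : \sum_k gram_dev j k * (a k * fc k) =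
    n%:R^-1 * \sum_i psi j i * (\sum_k a k * fc k * psi k i) - a j * fc j.
  rewrite /gram_dev.
  under eq_bigr do rewrite mulrBl.
  rewrite big_split/= sumrN (bigD1 j (P := predT) (F := fun k => (j == k)%:R * _))//=.
  rewrite eqxx mul1r [X in _ - (_ + X)]big1 ?addr0; last first.
    by move=> k kj; rewrite eq_sym (negbTE kj) mul0r.
  congr (_ - _); rewrite mulr_sumr.
  transitivity (\sum_k \sum_i n%:R^-1 * (psi j i * psi k i) * (a k * fc k)).
    by apply: eq_bigr => k _; rewrite mulr_sumr mulr_suml.
  rewrite exchange_big/=; apply: eq_bigr => i _.
  by rewrite !mulr_sumr; apply: eq_bigr => k _; ring.
have -> : \sum_i psi j i * (y i - \sum_k a k * fc k * psi k i) =
   (\sum_i psi j i * y i) - \sum_i psi j i * (\sum_k a k * fc k * psi k i).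
  by rewrite -sumrB; apply: eq_bigr => i _; ring.
by ring.
Qed.

Lemma ridge_noise (c e : 'I_n -> R) : hs_dev <= 4^-1 ->
  (forall i, \sum_i' emp_kernel i i' * c i' + t * c i = e i) ->
  \sum_j (ridge_coef c j - a j * (n%:R^-1 * \sum_i psi j i * e i)) ^+ 2 <=
  4 * hs_dev * \sum_j a j * (n%:R^-1 * \sum_i psi j i * e i) ^+ 2.
Proof.
move=> Q4 ce; apply: le_trans (weighted_le _) _.
by apply: (fixpoint_remainder_bound shrink_gt0 Q4) => j; exact: ridge_normal_eq.
Qed.

(** The posterior variance at a point with features [px] is a pairing of [px]
    with the bias [h] of the ridge estimator of the kernel function at this
    point; this [h] solves the same fixed point equation with [b = lam * px]. *)
Lemma ridge_variance (c : 'I_n -> R) (px : J -> R) : hs_dev <= 4^-1 ->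
  (forall i, \sum_i' emp_kernel i i' * c i' + t * c i =
     \sum_j mu j * psi j i * px j) ->
  \sum_j mu j * px j ^+ 2 - \sum_i c i * (\sum_j mu j * psi j i * px j) <=
  2 * lam * \sum_j a j * px j ^+ 2.
Proof.
move=> Q4 cy.
set th := ridge_coef c.
pose h j := mu j * px j - th j.
have -> : \sum_j mu j * px j ^+ 2 - \sum_i c i * (\sum_j mu j * psi j i * px j) =
    \sum_j h j * px j.
  under [X in _ - X]eq_bigr do rewrite mulr_sumr.
  rewrite exchange_big/= -sumrB; apply: eq_bigr => j _.
  rewrite /h /th /ridge_coef mulrBl; congr (_ - _); first by ring.
  by rewrite mulr_sumr mulr_suml; apply: eq_bigr => i _; ring.
have hfix j : h j = a j * (lam * px j - \sum_k gram_dev j k * h k).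
  have := ridge_normal_eq cy j; rewrite -/th.
  have -> : n%:R^-1 * (\sum_i psi j i * (\sum_k mu k * psi k i * px k)) =
     \sum_k gram_dev j k * (mu k * px k) + mu j * px j.
    rewrite /gram_dev.
    under [in RHS]eq_bigr do rewrite mulrBl.
    rewrite [in RHS]big_split/= sumrN.
    rewrite (bigD1 j (P := predT) (F := fun k => (j == k)%:R * _))//=.
    rewrite eqxx mul1r [X in _ - (_ + X)]big1 ?addr0; last first.
      by move=> k kj; rewrite eq_sym (negbTE kj) mul0r.
    rewrite subrK mulr_sumr.
    transitivity (\sum_i \sum_k n%:R^-1 * (psi j i * psi k i) * (mu k * px k)).
      by apply: eq_bigr => i _; rewrite !mulr_sumr; apply: eq_bigr => k _; ring.
    rewrite exchange_big/=; apply: eq_bigr => k _.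
    by rewrite mulr_sumr mulr_suml.
  have -> : \sum_k gram_dev j k * h k =
    \sum_k gram_dev j k * (mu k * px k) - \sum_k gram_dev j k * th k.
    by rewrite -sumrB; apply: eq_bigr => k _; rewrite /h; ring.
  rewrite /h => ->; rewrite /a; field.
  by rewrite gt_eqF// addr_gt0.
have := fixpoint_bound shrink_gt0 Q4 hfix.
have -> : \sum_j a j * (lam * px j) ^+ 2 = lam ^+ 2 * \sum_j a j * px j ^+ 2.
  by rewrite mulr_sumr; apply: eq_bigr => j _; ring.
set P := \sum_j a j * px j ^+ 2; set H := \sum_j h j ^+ 2 / a j => HP.
have P0 : 0 <= P.
  by apply: sumr_ge0 => j _; rewrite mulr_ge0 ?sqr_ge0// ltW// shrink_gt0.
have [l0|l1] := leP (lam * P) 0.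
  have P00 : P = 0 by apply/eqP; rewrite eq_le P0 -(pmulr_rle0 _ lam_gt0) l0.
  have p0 j : px j = 0.
    move/eqP: P00; rewrite psumr_eq0; last first.
      by move=> k _; rewrite mulr_ge0 ?sqr_ge0// ltW// shrink_gt0.
    move=> /allP/(_ j (mem_index_enum _))/=.
    by rewrite mulf_eq0 gt_eqF ?shrink_gt0//= sqrf_eq0 => /eqP.
  by rewrite P00 mulr0 big1// => j _; rewrite p0 mulr0.
apply: (@le_trans _ _ (H / (4 * lam) + lam * P)).
  rewrite /H /P mulr_suml mulr_sumr -big_split/=; apply: ler_sum => j _.
  have aj := shrink_gt0 j.
  rewrite -subr_ge0.
  have -> : h j ^+ 2 / a j / (4 * lam) + lam * (a j * px j ^+ 2) - h j * px j =
     (h j - 2 * lam * a j * px j) ^+ 2 / (a j * (4 * lam)).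
    by field; rewrite !gt_eqF// mulr_gt0.
  by rewrite divr_ge0 ?sqr_ge0// mulr_ge0 ?(ltW aj)// mulr_ge0// ltW.
have : H / (4 * lam) <= lam * P.
  rewrite ler_pdivrMr; last by rewrite mulr_gt0.
  by rewrite (_ : lam * P * (4 * lam) = 4 * (lam ^+ 2 * P)) //; ring.
lra.
Qed.

End ridge.

(** * Counting multi-indices with a small product *)

Section ffun_cons.
Context {d : nat} {S : Type}.

(** Splits the first index off a multi-index, for inductions on the
    dimension. *)
Definition ffun_cons (p : S * {ffun 'I_d -> S}) : {ffun 'I_d.+1 -> S} :=
  [ffun k => if unlift ord0 k is Some k' then p.2 k' else p.1].

Definition ffun_uncons (f : {ffun 'I_d.+1 -> S}) : S * {ffun 'I_d -> S} :=
  (f ord0, [ffun k => f (lift ord0 k)]).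

Lemma ffun_consK : cancel ffun_cons ffun_uncons.
Proof.
move=> [i g]; congr pair; first by rewrite ffunE unlift_none.
by apply/ffunP => k; rewrite !ffunE liftK.
Qed.

Lemma ffun_unconsK : cancel ffun_uncons ffun_cons.
Proof.
move=> f; apply/ffunP => k; rewrite ffunE.
by case: unliftP => [k' ->|->] //=; rewrite ffunE.
Qed.

Lemma ffun_cons0 p : ffun_cons p ord0 = p.1.
Proof. by rewrite ffunE unlift_none. Qed.

Lemma ffun_consS p k : ffun_cons p (lift ord0 k) = p.2 k.
Proof. by rewrite ffunE liftK. Qed.

End ffun_cons.

Section counting.
Context {R : realType}.

Definition idx_prod d q (j : {ffun 'I_d -> 'I_q}) : R := \prod_k (j k).+1%:R.

Lemma idx_prod_ge1 d q (j : {ffun 'I_d -> 'I_q}) : 1 <= idx_prod j.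
Proof.
rewrite /idx_prod; elim/big_rec: _ => // k x _ x1.
by rewrite -[leLHS]mulr1 ler_pM// ler1n.
Qed.

(** Up to a constant factor, [trunc2 (x / p)] dominates the shrinkage factor of
    an eigenvalue of order [p ^ (- s)] at regularisation [x ^ (- s)], for all
    [s >= 2]. Truncated squares replace the indicator of [p <= x], so that the
    tail of the spectrum is counted at the same time. *)
Definition trunc2 (y : R) : R := Num.min 1 (y ^+ 2).

Definition multi_sum d q (x : R) : R :=
  \sum_(j : {ffun 'I_d -> 'I_q}) trunc2 (x / idx_prod j).

Lemma multi_sumS d q x :
  multi_sum d.+1 q x = \sum_(i < q) multi_sum d q (x / i.+1%:R).
Proof.
rewrite /multi_sum (reindex (@ffun_cons d 'I_q)) /=; last first.
  by apply: onW_bij; exists ffun_uncons; [exact: ffun_consK|exact: ffun_unconsK].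
rewrite pair_big/=; apply: eq_bigr => -[i g] _; congr (trunc2 _).
rewrite /idx_prod big_ord_recl ffun_cons0/= invfM mulrA; congr (_ / _).
by apply: eq_bigr => k _; rewrite ffun_consS.
Qed.

Lemma multi_sum0 q x : multi_sum 0 q x = trunc2 x.
Proof.
rewrite /multi_sum (bigD1 [ffun k : 'I_0 => False_rect 'I_q (notF (valP k))])//=.
rewrite big1 ?addr0.
  by rewrite /idx_prod big_ord0 divr1.
by move=> f /eqP[]; apply/ffunP => -[].
Qed.

(** The summand is dominated by the increment of [4 * x^2 / (x + i)]. *)
Lemma sum_trunc2 q x : 0 < x -> \sum_(i < q) trunc2 (x / i.+1%:R) <= 4 * x.
Proof.
move=> x0.
have H k : \sum_(i < k) trunc2 (x / i.+1%:R) <= 4 * x - 4 * x ^+ 2 / (x + k%:R).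
  elim: k => [|k IH].
    by rewrite big_ord0 addr0 le_eqVlt; apply/orP; left; apply/eqP; field; rewrite gt_eqF.
  rewrite big_ord_recr/=.
  have k0 : 0 <= k%:R :> R by [].
  set y : R := k.+1%:R.
  have yE : y = k%:R + 1 by rewrite /y -natr1.
  have y0 : 0 < y by rewrite ltr0n.
  have xy : 0 < x + y by rewrite addr_gt0.
  have xk : 0 < x + k%:R by rewrite ltr_pwDl.
  apply: (@le_trans _ _ (4 * x - 4 * x ^+ 2 / (x + k%:R) + 4 * x ^+ 2 / (x + y) ^+ 2)).
    apply: lerD => //.
    have [kx|kx] := leP y x.
      apply: (@le_trans _ _ 1); first by rewrite ge_min lexx.
      rewrite ler_pdivlMr ?exprn_gt0//; nra.
    apply: (@le_trans _ _ ((x / y) ^+ 2)); first by rewrite ge_min lexx orbT.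
    rewrite expr_div_n ler_pdivrMr ?exprn_gt0// mulrAC ler_pdivlMr ?exprn_gt0//.
    have x2 : 0 < x ^+ 2 by rewrite exprn_gt0.
    have : (x + y) ^+ 2 <= 4 * y ^+ 2 by nra.
    nra.
  have -> : 4 * x - 4 * x ^+ 2 / (x + k%:R) + 4 * x ^+ 2 / (x + y) ^+ 2 =
    4 * x - 4 * x ^+ 2 / (x + y) - 4 * x ^+ 2 / ((x + k%:R) * (x + y) ^+ 2).
    rewrite yE; field.
    by rewrite !gt_eqF// -yE.
  by rewrite lerBlDr lerDl divr_ge0 ?mulr_ge0 ?exprn_ge0 ?ltW ?exprn_gt0.
apply: le_trans (H q) _; rewrite lerBlDr lerDl.
by rewrite divr_ge0 ?mulr_ge0 ?exprn_ge0 ?addr_ge0// ltW.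
Qed.

Lemma harmonic_le q : (0 < q)%N -> \sum_(i < q) (i.+1%:R : R)^-1 <= 1 + ln (q%:R : R).
Proof.
elim: q => // -[|q] IH _; first by rewrite big_ord1 invr1 ln1 addr0.
rewrite big_ord_recr/=; apply: le_trans (lerD (IH isT) (lexx _)) _.
rewrite -addrA lerD2l -lerBrDl.
have q0 : 0 < q.+1%:R :> R by rewrite ltr0n.
have q1 : 0 < q.+2%:R :> R by rewrite ltr0n.
rewrite -ln_div ?posrE//.
have -> : (q.+2%:R / q.+1%:R : R) = (1 - q.+2%:R^-1)^-1.
  rewrite -[q.+2%:R]natr1 in q1 *; field.
  by rewrite !gt_eqF//= -?natr1; lra.
rewrite lnV ?posrE; last first.
  by rewrite subr_gt0 invf_lt1// ltr1n.
rewrite lerNr; apply: le_trans (le_ln1Dx _) _ => //.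
by rewrite ltrN2 invf_lt1// ltr1n.
Qed.

Lemma harmonic_below q (x : R) : 1 <= x ->
  \sum_(i < q | i.+1%:R <= x) (i.+1%:R : R)^-1 <= 1 + ln x.
Proof.
move=> x1; have x0 : 0 < x by lra.
elim: q => [|q IH]; first by rewrite big_ord0 addr_ge0// ln_ge0.
have [qx|qx] := boolP (q.+1%:R <= x).
  rewrite (eq_bigl predT); last first.
    by move=> i; rewrite (le_trans _ qx)// ler_nat.
  apply: le_trans (harmonic_le _) _ => //.
  by rewrite lerD2l ler_ln ?posrE ?ltr0n.
by rewrite big_mkcond big_ord_recr/= (negbTE qx) addr0 -big_mkcond.
Qed.

(** Used for [x <= 1], where no index lies in the cross. *)
Lemma multi_sum_sqr d q (x : R) : 0 < x -> multi_sum d q x <= 4 ^+ d * x ^+ 2.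
Proof.
elim: d x => [|d IH] x x0.
  by rewrite multi_sum0 expr0 mul1r ge_min lexx orbT.
rewrite multi_sumS.
apply: (@le_trans _ _ (\sum_(i < q) 4 ^+ d * x ^+ 2 * trunc2 (1 / i.+1%:R))).
  apply: ler_sum => i _; apply: le_trans (IH _ _) _.
    by rewrite divr_gt0// ltr0n.
  rewrite -mulrA ler_wpM2l ?exprn_ge0//.
  have i1 : (1 / i.+1%:R : R) ^+ 2 <= 1.
    by rewrite expr_le1 ?divr_ge0// div1r invf_le1 ?ltr0n// ler1n.
  rewrite /trunc2 (min_idPr _) ?i1// !expr_div_n expr1n mulrA mulr1; exact: lexx.
rewrite -mulr_sumr [4 ^+ d.+1]exprSr.
have -> : 4 ^+ d * 4 * x ^+ 2 = 4 ^+ d * x ^+ 2 * (4 * 1) by ring.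
by rewrite ler_wpM2l ?sum_trunc2// mulr_ge0 ?exprn_ge0// ltW.
Qed.

(** The hyperbolic cross, by induction on the dimension. Fixing the first index
    [i] replaces [x] by [x / i]. As long as [i <= x], the induction hypothesis
    applies and the sum of [1 / i] brings one more logarithm; beyond, the
    quadratic estimate leaves a single sum of truncated squares. *)
Lemma multi_sum_le d : exists2 c : R, 0 < c & forall q x, 1 <= x ->
  multi_sum d.+1 q x <= c * x * (1 + ln x) ^+ d.
Proof.
elim: d => [|d [c c0 IH]].
  exists 4 => // q x x1; rewrite expr0 mulr1 multi_sumS.
  under eq_bigr do rewrite multi_sum0.
  by apply: sum_trunc2; lra.
exists (c + 4 ^+ d.+2) => [|q x x1]; first by rewrite addr_gt0// exprn_gt0.
have x0 : 0 < x by lra.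
have l1 : 1 <= 1 + ln x by rewrite lerDl ln_ge0.
rewrite multi_sumS (bigID (fun i : 'I_q => i.+1%:R <= x))/= -mulrA mulrDl.
apply: lerD.
  apply: (@le_trans _ _ (\sum_(i < q | i.+1%:R <= x)
      c * x * (1 + ln x) ^+ d * (i.+1%:R)^-1)).
    apply: ler_sum => i ix; have i0 : 0 < i.+1%:R :> R by rewrite ltr0n.
    have x1' : 1 <= x / i.+1%:R by rewrite ler_pdivlMr// mul1r.
    apply: le_trans (IH _ _ x1') _.
    rewrite -!mulrA ler_wpM2l ?(ltW c0)// ler_wpM2l ?(ltW x0)// mulrC.
    rewrite ler_wpM2r ?invr_ge0 ?(ltW i0)// lerXn2r ?nnegrE ?addr_ge0 ?ln_ge0//.
    rewrite lerD2l ler_ln ?posrE//; first by rewrite ler_pdivrMr// ler_peMr ?(ltW x0)// ler1n.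
    by rewrite divr_gt0.
  rewrite -mulr_sumr exprSr.
  have -> : c * (x * ((1 + ln x) ^+ d * (1 + ln x))) =
    c * x * (1 + ln x) ^+ d * (1 + ln x) by ring.
  rewrite ler_wpM2l ?harmonic_below//.
  by rewrite mulr_ge0 ?exprn_ge0 ?mulr_ge0 ?(ltW x0) ?(ltW c0)//; lra.
apply: (@le_trans _ _ (\sum_(i < q | ~~ (i.+1%:R <= x)) 4 ^+ d.+1 * trunc2 (x / i.+1%:R))).
  apply: ler_sum => i; rewrite -ltNge => ix.
  have i0 : 0 < i.+1%:R :> R by rewrite ltr0n.
  rewrite /trunc2 (min_idPr _).
    by apply: multi_sum_sqr; rewrite divr_gt0.
  by rewrite expr_le1 ?divr_ge0 ?(ltW x0)// ler_pdivrMr// mul1r ltW.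
rewrite -mulr_sumr [4 ^+ d.+2]exprSr -mulrA ler_wpM2l ?exprn_ge0//.
apply: (@le_trans _ _ (\sum_(i < q) trunc2 (x / i.+1%:R))).
  rewrite [leRHS](bigID (fun i : 'I_q => i.+1%:R <= x))/= lerDr.
  by apply: sumr_ge0 => i _; rewrite le_min ler01 sqr_ge0.
apply: le_trans (sum_trunc2 _ x0) _.
rewrite ler_wpM2l// ler_peMr ?(ltW x0)//.
by rewrite exprn_ege1.
Qed.

End counting.

(** * Bounds on integrals of real functions *)

Section real_integral_bounds.
Context {d} {T : measurableType d} {R : realType}.
Variable mu : {measure set T -> \bar R}.
Implicit Types f g : T -> R.

Lemma int_add_le f g (u v : \bar R) :
  measurable_fun [set: T] f -> measurable_fun [set: T] g ->
  (forall x, 0 <= f x) -> (forall x, 0 <= g x) ->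
  (\int[mu]_x (f x)%:E <= u)%E -> (\int[mu]_x (g x)%:E <= v)%E ->
  (\int[mu]_x (f x + g x)%:E <= u + v)%E.
Proof.
move=> mf mg f0 g0 fu gv.
under eq_integral do rewrite EFinD.
rewrite ge0_integralD//; [exact: leeD|..].
- by move=> x _; rewrite lee_fin.
- exact/measurable_EFinP.
- by move=> x _; rewrite lee_fin.
- exact/measurable_EFinP.
Qed.

Lemma int_scale_le f (c : R) (u : \bar R) :
  measurable_fun [set: T] f -> (forall x, 0 <= f x) -> 0 <= c ->
  (\int[mu]_x (f x)%:E <= u)%E -> (\int[mu]_x (c * f x)%:E <= c%:E * u)%E.
Proof.
move=> mf f0 c0 fu.
under eq_integral do rewrite EFinM.
rewrite ge0_integralZl//.
- by apply: lee_wpmul2l => //; rewrite lee_fin.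
- exact/measurable_EFinP.
- by move=> x _; rewrite lee_fin.
Qed.

Lemma int_sum_le (I : Type) (r : seq I) (f : I -> T -> R) (u : I -> R) :
  (forall i, measurable_fun [set: T] (f i)) -> (forall i x, 0 <= f i x) ->
  (forall i, \int[mu]_x (f i x)%:E <= (u i)%:E)%E ->
  (\int[mu]_x (\sum_(i <- r) f i x)%:E <= (\sum_(i <- r) u i)%:E)%E.
Proof.
move=> mf f0 fu; elim: r => [|i r IH].
  under eq_integral do rewrite big_nil.
  by rewrite big_nil integral0.
under eq_integral do rewrite big_cons.
rewrite big_cons EFinD; apply: int_add_le => //.
- exact: measurable_sum.
- by move=> x; apply: sumr_ge0.
Qed.

Lemma int_le f g (u : \bar R) : (forall x, 0 <= f x) -> (forall x, f x <= g x) ->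
  (\int[mu]_x (g x)%:E <= u)%E -> (\int[mu]_x (f x)%:E <= u)%E.
Proof.
move=> f0 fg; apply: le_trans; apply: le_integral_nomeas => x; rewrite lee_fin//.
Qed.

End real_integral_bounds.

(** * Moments of averages of bounded independent variables *)

Section power_mean.
Context {R : realFieldType}.

(** Convexity: a power lies above its tangent at [m]. *)
Lemma power_tangent (z m : R) p : 0 <= z -> 0 <= m ->
  p.+1%:R * z * m ^+ p <= z ^+ p.+1 + p%:R * m ^+ p.+1.
Proof.
move=> z0 m0; elim: p => [|p IH]; first by rewrite !expr0 !expr1; lra.
have H : z * (p.+1%:R * z * m ^+ p) <= z * (z ^+ p.+1 + p%:R * m ^+ p.+1).
  by rewrite ler_wpM2l.
have H2 : 0 <= p.+1%:R * m ^+ p * (z - m) ^+ 2.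
  by rewrite mulr_ge0 ?sqr_ge0// mulr_ge0// exprn_ge0.
rewrite -[p.+2%:R]natr1 [z ^+ p.+2]exprS [m ^+ p.+2]exprS.
move: H H2; rewrite ![m ^+ p.+1]exprS -[p.+1%:R]natr1.
set q : R := p%:R; set w := m ^+ p; set zz := z ^+ p.+1.
have -> : z * (zz + q * (m * w)) = z * zz + z * q * (m * w) by ring.
nra.
Qed.

(** Summing the tangent inequalities at the weighted mean gives the inequality
    of Jensen. *)
Lemma power_mean (I : finType) (w z : I -> R) p :
  (forall i, 0 <= w i) -> (forall i, 0 <= z i) -> 0 < \sum_i w i ->
  (\sum_i w i) * (\sum_i w i * z i) ^+ p <=
    (\sum_i w i) ^+ p * \sum_i w i * z i ^+ p.
Proof.
move=> w0 z0 W0; case: p => [|p].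
  by rewrite !expr0 mulr1 mul1r le_eqVlt; apply/orP; left; apply/eqP;
    apply: eq_bigr => i _; rewrite mulr1.
set W := \sum_i w i in W0 *; set S := \sum_i w i * z i.
have S0 : 0 <= S by apply: sumr_ge0 => i _; rewrite mulr_ge0.
pose m := S / W.
have m0 : 0 <= m by rewrite divr_ge0// ltW.
have SE : S = m * W by rewrite /m mulfVK// gt_eqF.
have : \sum_i w i * (p.+1%:R * z i * m ^+ p) <=
       \sum_i w i * (z i ^+ p.+1 + p%:R * m ^+ p.+1).
  by apply: ler_sum => i _; rewrite ler_wpM2l// power_tangent.
have -> : \sum_i w i * (p.+1%:R * z i * m ^+ p) = p.+1%:R * m ^+ p * S.
  by rewrite /S mulr_sumr; apply: eq_bigr => i _; ring.
have -> : \sum_i w i * (z i ^+ p.+1 + p%:R * m ^+ p.+1) =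
    \sum_i w i * z i ^+ p.+1 + p%:R * m ^+ p.+1 * W.
  rewrite /W mulr_sumr -big_split/=; apply: eq_bigr => i _; ring.
set A := \sum_i w i * z i ^+ p.+1 => H.
have H1 : m ^+ p.+1 * W <= A.
  move: H; rewrite SE -natr1 [m ^+ p.+1]exprSr; set q : R := p%:R.
  have -> : (q + 1) * m ^+ p * (m * W) = m ^+ p * m * W + q * (m ^+ p * m) * W by ring.
  by rewrite lerD2r.
rewrite SE exprMn mulrA [W * _]mulrC mulrAC.
have -> : m ^+ p.+1 * W ^+ p.+1 * W = W ^+ p.+1 * (m ^+ p.+1 * W) by ring.
by apply: ler_wpM2l => //; rewrite exprn_ge0// ltW.
Qed.

End power_mean.

Section exp_moments.
Context {R : realType}.

(** Both sides are multiplied by [1 - x], which is at most [expR (- x)]. *)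
Lemma expR_quad (x : R) : `|x| <= 2^-1 -> expR x <= 1 + x + 2 * x ^+ 2.
Proof.
rewrite ler_norml => /andP[x1 x2].
have H := expR_ge1Dx (- x).
have E := expRxMexpNx_1 x.
have P : 0 < expR x := expR_gt0 x.
have : expR x * (1 - x) <= 1 by rewrite -[leRHS]E; apply: ler_wpM2l => //; exact: ltW.
have : 1 <= (1 + x + 2 * x ^+ 2) * (1 - x).
  have : 0 <= x ^+ 2 * (1 - 2 * x) by rewrite mulr_ge0 ?sqr_ge0//; lra.
  nra.
move=> H1 H2; rewrite -(ler_pM2r (_ : 0 < 1 - x)); lra.
Qed.

(** A single term of the exponential series. *)
Lemma pow_fact_le (y : R) p : y ^+ (2 * p) <= (2 * p)`!%:R * (expR y + expR (- y)).
Proof.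
have -> : y ^+ (2 * p) = `|y| ^+ (2 * p).
  by rewrite !exprM real_normK ?num_real.
have F0 : 0 < (2 * p)`!%:R :> R by rewrite ltr0n fact_gt0.
have H : `|y| ^+ (2 * p) <= (2 * p)`!%:R * expR `|y|.
  rewrite mulrC -ler_pdivrMr//.
  case: (2 * p)%N => [|k].
    by rewrite expr0 fact0 divr1; apply: le_trans (expR_ge1Dx _); rewrite lerDl.
  by apply: le_trans (expR_ge1Dxn k (normr_ge0 y)); rewrite lerDr.
apply: le_trans H _; rewrite ler_wpM2l ?(ltW F0)//.
by have [?|?] := ger0P y; rewrite ?lerDl ?lerDr ?expR_ge0.
Qed.

Context {d} {T : measurableType d} (P : probability T R).
Variables (xi : T -> R) (c : R).
Hypothesis mxi : measurable_fun [set: T] xi.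
Hypothesis c_gt0 : 0 < c.
Hypothesis xi_le : forall x, `|xi x| <= c.
Hypothesis xi0 : (\int[P]_x (xi x)%:E = 0)%E.

Lemma exp_moment_le (s : R) : `|s| * c <= 2^-1 ->
  (\int[P]_x (expR (s * xi x))%:E <= (1 + 2 * (s * c) ^+ 2)%:E)%E.
Proof.
move=> sc.
have ix : P.-integrable [set: T] (EFin \o xi).
  apply: sq_integrable => //; apply: (@le_lt_trans _ _ (\int[P]_x (c ^+ 2)%:E)%E).
    apply: le_integral_nomeas => x; rewrite lee_fin ?sqr_ge0//.
    by rewrite -[xi x ^+ 2]real_normK ?num_real// lerXn2r ?nnegrE// ltW.
  by rewrite integral_cstP ltry.
apply: (@le_trans _ _ (\int[P]_x ((1 + 2 * (s * c) ^+ 2)%:E + s%:E * (xi x)%:E))%E).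
  have iR : P.-integrable [set: T] (fun x => (1 + 2 * (s * c) ^+ 2)%:E + s%:E * (xi x)%:E)%E.
    apply: integrableD => //; first exact: finite_measure_integrable_cst.
    exact: integrableZl.
  apply: le_integral_nomeas => x; first by rewrite lee_fin expR_ge0.
  rewrite -EFinM -EFinD lee_fin.
  have sx : `|s * xi x| <= `|s| * c by rewrite normrM ler_wpM2l.
  apply: le_trans (expR_quad (le_trans sx sc)) _.
  have : (s * xi x) ^+ 2 <= (s * c) ^+ 2.
    rewrite -[leLHS]real_normK ?num_real// -[leRHS]real_normK ?num_real//.
    by rewrite lerXn2r ?nnegrE// (normrM s c) (gtr0_norm c_gt0).
  lra.
rewrite integralD//=; last 2 first.
- exact: finite_measure_integrable_cst.
- exact: integrableZl.
by rewrite integralZl// xi0 mule0 adde0 integral_cstP.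
Qed.

(** The even moments of an average of independent bounded variables are read off
    its exponential moments, which factorize over the observations. *)
Lemma mean_moment_le n p : (0 < n)%N ->
  (\int[prod_prob (fun _ : 'I_n => P)]_t
      ((n%:R^-1 * \sum_(i < n) xi (tnth t i)) ^+ (2 * p))%:E <=
    ((2 * p)`!%:R * (2 * expR 1) * (4 * c ^+ 2 / n%:R) ^+ p)%:E)%E.
Proof.
move=> n0.
have nR : 0 < n%:R :> R by rewrite ltr0n.
(* With this scale each of the [n] factors of the exponential moment is at
   most [expR (1 / n)]. *)
pose s := (2 * c * Num.sqrt (n%:R : R))^-1.
have sq0 : 0 < Num.sqrt (n%:R : R) by rewrite sqrtr_gt0.
have s0 : 0 < s by rewrite invr_gt0 !mulr_gt0.
have sq1 : 1 <= Num.sqrt (n%:R : R) by rewrite -[leLHS]sqrtr1; apply: ler_wsqrtr; rewrite ler1n.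
have sq2 : Num.sqrt (n%:R : R) ^+ 2 = n%:R by rewrite sqr_sqrtr.
have scE : s * c = (2 * Num.sqrt (n%:R : R))^-1.
  by rewrite /s; field; rewrite !gt_eqF.
have sc : s * c <= 2^-1.
  by rewrite scE lef_pV2 ?posrE ?mulr_gt0// ler_peMr.
have ex (u : R) : `|u| = s ->
    (\int[prod_prob (fun _ : 'I_n => P)]_t
      (expR (u * \sum_(i < n) xi (tnth t i)))%:E <= (expR 1)%:E)%E.
  move=> us.
  under eq_integral.
    move=> t _; rewrite mulr_sumr expR_sum.
    over.
  apply: le_trans (integral_prod_le (g := fun=> fun x => expR (u * xi x))
    (c := fun=> 1 + 2 * (u * c) ^+ 2) _ _ _) _ => /=.
  - by move=> i; apply: measurableT_comp => //; exact: measurable_funM.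
  - by move=> i x; exact: expR_ge0.
  - by move=> i; apply: exp_moment_le; rewrite us.
  rewrite lee_fin prodr_const card_ord.
  have -> : (u * c) ^+ 2 = (4 * n%:R)^-1.
    by rewrite exprMn -[u ^+ 2]real_normK ?num_real// us -exprMn scE exprVn exprMn sq2 -natrX.
  have H : 1 + 2 * (4 * n%:R)^-1 <= expR (n%:R^-1 : R).
    apply: le_trans (expR_ge1Dx _); rewrite lerD2l.
    have -> : 2 * (4 * n%:R)^-1 = 2^-1 * n%:R^-1 :> R by field; rewrite gt_eqF.
    by rewrite ler_piMl ?invr_ge0 ?(ltW nR)// invf_le1// ler1n.
  apply: (@le_trans _ _ (expR (n%:R^-1 : R) ^+ n)).
    by rewrite lerXn2r ?nnegrE ?expR_ge0// addr_ge0// mulr_ge0// invr_ge0 mulr_ge0.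
  by rewrite -expRM_natr mulVf ?gt_eqF.
have mS : measurable_fun [set: n.-tuple T] (fun t => \sum_(i < n) xi (tnth t i)).
  exact: (measurable_sum_tnth (fun _ : 'I_n => mxi)).
have mexp u : measurable_fun [set: n.-tuple T]
    (fun t => expR (u * \sum_(i < n) xi (tnth t i))).
  by apply: measurableT_comp => //; exact: measurable_funM.
apply: (@int_le _ _ _ _ _ (fun t => (n%:R * s) ^- (2 * p) * (2 * p)`!%:R *
   (expR (s * \sum_(i < n) xi (tnth t i)) + expR (- s * \sum_(i < n) xi (tnth t i))))).
- by move=> t; rewrite exprM exprn_ge0 ?sqr_ge0.
- move=> t; set S := \sum_(i < n) _.
  rewrite -mulrA.
  have -> : n%:R^-1 * S = (n%:R * s)^-1 * (s * S).
    by field; rewrite !gt_eqF.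
  rewrite exprMn exprVn ler_wpM2l ?invr_ge0 ?exprn_ge0 ?mulr_ge0 ?(ltW s0) ?(ltW nR)//.
  by rewrite mulNr; exact: pow_fact_le.
have c0 : 0 <= (n%:R * s) ^- (2 * p) * (2 * p)`!%:R.
  by rewrite mulr_ge0 ?invr_ge0 ?exprn_ge0 ?mulr_ge0 ?(ltW s0) ?(ltW nR).
apply: le_trans (int_scale_le (u := (expR 1 + expR 1)%:E) _ _ c0 _) _.
- exact: measurable_funD.
- by move=> t; rewrite addr_ge0 ?expR_ge0.
- rewrite EFinD; apply: int_add_le => //; try by move=> t; exact: expR_ge0.
    by apply: ex; rewrite gtr0_norm.
  by apply: ex; rewrite normrN gtr0_norm.
rewrite -EFinM lee_fin le_eqVlt; apply/orP; left; apply/eqP.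
have -> : (n%:R * s) ^- (2 * p) = (4 * c ^+ 2 / n%:R) ^+ p :> R.
  rewrite -exprVn exprM; congr (_ ^+ p).
  have -> : (n%:R * s)^-1 = 2 * c * Num.sqrt (n%:R : R) / n%:R.
    by rewrite /s; field; rewrite !gt_eqF.
  rewrite expr_div_n !exprMn sq2; field.
  by rewrite gt_eqF.
by ring.
Qed.

End exp_moments.

Section gram_moment.
Context {R : realType} {d} {T : measurableType d} (P : probability T R).
Context {J : finType}.
Variables (F : J -> T -> R) (M : R) (a : J -> R).
Hypothesis mF : forall j, measurable_fun [set: T] (F j).
Hypothesis F_le : forall j x, `|F j x| <= M.
Hypothesis F_on : forall j k, (\int[P]_x (F j x * F k x)%:E = ((j == k)%:R)%:E)%E.
Hypothesis a_gt0 : forall j, 0 < a j.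

Definition hs_sample n (t : n.-tuple T) : R :=
  hs_norm2 a (@gram_dev R J n (fun j i => F j (tnth t i))).

Lemma gram_dev_mean n (t : n.-tuple T) j k : (0 < n)%N ->
  @gram_dev R J n (fun j i => F j (tnth t i)) j k =
  n%:R^-1 * \sum_(i < n) (F j (tnth t i) * F k (tnth t i) - (j == k)%:R).
Proof.
move=> n0; rewrite /gram_dev big_split/= mulrDr sumrN sumr_const card_ord.
rewrite -mulr_natl; congr (_ + _); field.
by rewrite pnatr_eq0 -lt0n.
Qed.

Lemma measurable_gram_dev n j k : measurable_fun [set: n.-tuple T]
  (fun t => @gram_dev R J n (fun j i => F j (tnth t i)) j k).
Proof.
apply: measurable_funB => //; apply: measurable_funM => //.
apply: measurable_sum => i; apply: measurable_funM;
  by apply: measurableT_comp => //; exact: measurable_tnth.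
Qed.

Lemma measurable_hs_sample n : measurable_fun [set: n.-tuple T] (@hs_sample n).
Proof.
apply: measurable_sum => j; apply: measurable_sum => k.
apply: measurable_funM => //; apply: measurable_funX.
exact: measurable_gram_dev.
Qed.

Lemma hs_sample_ge0 n (t : n.-tuple T) : 0 <= hs_sample t.
Proof.
apply: sumr_ge0 => j _; apply: sumr_ge0 => k _.
by rewrite mulr_ge0 ?sqr_ge0 ?mulr_ge0// ltW.
Qed.

Definition gram_cst (p : nat) := (2 * p)`!%:R * (2 * expR 1) * (4 * (M ^+ 2 + 1) ^+ 2) ^+ p.

(** A weighted power mean reduces the moments of the Hilbert-Schmidt norm to
    those of a single entry. The number of features enters only through the sum
    of their weights, so that the bound is uniform over the boxes. *)
Lemma hs_moment_le n p : (0 < n)%N -> 0 < \sum_j a j ->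
  (\int[prod_prob (fun _ : 'I_n => P)]_t (hs_sample t ^+ p)%:E <=
    (gram_cst p * ((\sum_j a j) ^+ 2 / n%:R) ^+ p)%:E)%E.
Proof.
move=> n0 D0; have nR : 0 < n%:R :> R by rewrite ltr0n.
have entry j k : (\int[prod_prob (fun _ : 'I_n => P)]_t
    ((@gram_dev R J n (fun j i => F j (tnth t i)) j k) ^+ (2 * p))%:E <=
    (gram_cst p * n%:R ^- p)%:E)%E.
  under eq_integral do rewrite gram_dev_mean//.
  have mFF : measurable_fun [set: T] (fun x => F j x * F k x) by exact: measurable_funM.
  have M0 (x : T) : 0 <= M by exact: le_trans (F_le j x).
  have FF x : `|F j x * F k x| <= M ^+ 2.
    by rewrite normrM expr2; apply: ler_pM.
  have m1 : measurable_fun [set: T] (fun x => F j x * F k x - (j == k)%:R).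
    exact: measurable_funB.
  have M1 : 0 < M ^+ 2 + 1 by rewrite ltr_wpDl// sqr_ge0.
  have FM x : `|F j x * F k x - (j == k)%:R| <= M ^+ 2 + 1.
    apply: le_trans (ler_normB _ _) _; apply: lerD => //.
    by case: (j == k); rewrite ?normr1 ?normr0.
  have F0 : (\int[P]_x (F j x * F k x - (j == k)%:R)%:E = 0)%E.
    under eq_integral do rewrite EFinB.
    rewrite integralB//=; last 2 first.
    - apply: sq_integrable => //.
      apply: (@le_lt_trans _ _ (\int[P]_x ((M ^+ 2) ^+ 2)%:E)%E).
        apply: le_integral_nomeas => x; rewrite lee_fin ?sqr_ge0//.
        rewrite -[leLHS]real_normK ?num_real//.
        by rewrite lerXn2r ?nnegrE ?sqr_ge0.
      by rewrite integral_cstP ltry.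
    - exact: finite_measure_integrable_cst.
    by rewrite F_on integral_cstP subee.
  apply: le_trans (mean_moment_le m1 M1 FM F0 p n0) _.
  rewrite lee_fin /gram_cst expr_div_n.
  by rewrite -!mulrA.
set D := \sum_j a j in D0 *.
pose w (jk : J * J) := a jk.1 * a jk.2.
have w0 jk : 0 <= w jk by rewrite mulr_ge0// ltW.
have wE : \sum_jk w jk = D ^+ 2.
  rewrite /w -(pair_big predT predT (fun j k => a j * a k))/=.
  by rewrite expr2 /D mulr_suml; apply: eq_bigr => j _; rewrite mulr_sumr.
pose z (t : n.-tuple T) (jk : J * J) :=
  (@gram_dev R J n (fun j i => F j (tnth t i)) jk.1 jk.2) ^+ 2.
have hE t : hs_sample t = \sum_jk w jk * z t jk.
  by rewrite /hs_sample /hs_norm2 pair_big.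
have Hp t : hs_sample t ^+ p <=
    (D ^+ 2)^-1 * (D ^+ 2) ^+ p * \sum_jk w jk * z t jk ^+ p.
  have := @power_mean _ _ w (z t) p w0 _ _; rewrite -hE wE -mulrA => H.
  rewrite -ler_pdivrMl ?invr_gt0 ?exprn_gt0// invrK H// ?exprn_gt0//.
  by move=> jk; exact: sqr_ge0.
apply: (int_le _ Hp); first by move=> t; rewrite exprn_ge0// hs_sample_ge0.
have c0 : 0 <= (D ^+ 2)^-1 * (D ^+ 2) ^+ p.
  by rewrite mulr_ge0 ?invr_ge0 ?exprn_ge0// ltW.
apply: le_trans (int_scale_le (u := (D ^+ 2 * (gram_cst p * n%:R ^- p))%:E) _ _ c0 _) _.
- apply: measurable_sum => jk; apply: measurable_funM => //.
  by do 2 apply: measurable_funX; exact: measurable_gram_dev.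
- by move=> t; apply: sumr_ge0 => jk _; apply: mulr_ge0; [exact: w0|rewrite exprn_ge0 ?sqr_ge0].
- rewrite -wE mulr_suml; apply: int_sum_le.
  + move=> jk; apply: measurable_funM => //.
    by do 2 apply: measurable_funX; exact: measurable_gram_dev.
  + by move=> jk t; apply: mulr_ge0; [exact: w0|rewrite exprn_ge0 ?sqr_ge0].
  + move=> jk; rewrite EFinM; apply: int_scale_le => //.
    * by do 2 apply: measurable_funX; exact: measurable_gram_dev.
    * by move=> t; rewrite exprn_ge0 ?sqr_ge0.
    * by under eq_integral do rewrite /z -exprM.
rewrite -EFinM lee_fin le_eqVlt; apply/orP; left; apply/eqP.
rewrite expr_div_n; field.
by rewrite !gt_eqF ?exprn_gt0.
Qed.

End gram_moment.

(** * Gaussian and uniform laws *)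

Section law.
Context {d1 d2} {T1 : measurableType d1} {T2 : measurableType d2} {R : realType}.
Variables (Q : probability T1 R) (N : {measure set T2 -> \bar R}) (Y : T1 -> T2).
Hypothesis mY : measurable_fun [set: T1] Y.
Hypothesis YN : forall A, measurable A -> Q (Y @^-1` A) = N A.

Lemma ge0_integral_law (f : T2 -> \bar R) :
  measurable_fun [set: T2] f -> (forall x, 0 <= f x)%E ->
  (\int[Q]_w f (Y w) = \int[N]_x f x)%E.
Proof.
move=> mf f0.
have -> : (\int[Q]_w f (Y w) = \int[pushforward Q Y]_x f x)%E.
  by rewrite (ge0_integral_pushforward mY)// preimage_setT.
by apply: eq_measure_integral => A mA _; exact: YN.
Qed.

Lemma integral_law (f : T2 -> \bar R) : measurable_fun [set: T2] f ->
  (\int[Q]_w f (Y w) = \int[N]_x f x)%E.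
Proof.
move=> mf; rewrite [LHS]integralE [RHS]integralE; congr (_ - _)%E.
  rewrite -(ge0_integral_law (measurable_funepos mf))//.
  by rewrite (funepos_comp f Y).
rewrite -(ge0_integral_law (measurable_funeneg mf))//.
by rewrite (funeneg_comp f Y).
Qed.

End law.

Section density.
Context {d} {T : measurableType d} {R : realType}.
Variables (mu nu : {measure set T -> \bar R}) (g : T -> R).
Hypothesis mg : measurable_fun [set: T] g.
Hypothesis g0 : forall x, 0 <= g x.
Hypothesis nuE : forall A, measurable A -> nu A = (\int[mu]_(x in A) (g x)%:E)%E.

Import HBNNSimple.

(** For a simple function below [f] both integrals agree. *)
Lemma integral_density_le (f : T -> \bar R) : (forall x, 0 <= f x)%E ->
  (\int[nu]_x f x <= \int[mu]_x (f x * (g x)%:E))%E.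
Proof.
move=> f0; rewrite ge0_integralTE//; apply: ge_ereal_sup => _ [h hf <-].
apply: (@le_trans _ _ (\int[mu]_x ((h x)%:E * (g x)%:E))%E); last first.
  apply: le_integral_nomeas => x; first by rewrite mule_ge0 ?lee_fin.
  by apply: lee_wpmul2r; rewrite ?lee_fin//; exact: hf.
rewrite le_eqVlt; apply/orP; left; apply/eqP.
rewrite sintegralE.
have mh r : measurable (h @^-1` [set r]) by exact: measurable_funPTI.
under [RHS]eq_integral.
  move=> x _; rewrite fimfunE -fsumEFin// ge0_mule_fsuml; last first.
    by move=> r; rewrite lee_fin; exact: nnfun_muleindic_ge0.
  over.
rewrite ge0_integral_fsum//; last 2 first.
- move=> r; apply: emeasurable_funM; last exact/measurable_EFinP.
  by apply/measurable_EFinP; apply: measurable_funM.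
- by move=> r x _; rewrite mule_ge0 ?lee_fin// -lee_fin EFinM nnfun_muleindic_ge0.
apply: eq_fsbigr => r /set_mem[x0 _ <-].
rewrite nuE//.
under [RHS]eq_integral do rewrite EFinM -muleA.
rewrite ge0_integralZl//; last 3 first.
- apply: emeasurable_funM; last exact/measurable_EFinP.
  exact/measurable_EFinP/measurable_indic.
- by move=> x _; rewrite mule_ge0 ?lee_fin.
- by rewrite lee_fin.
congr (_ * _)%E; rewrite integral_mkcond/=; apply: eq_integral => x _.
rewrite patchE indicE; case: ifPn => xh; first by rewrite mul1e.
by rewrite mul0e.
Qed.

End density.

Section normal_moments.
Context {R : realType}.
Variables (a s : R).
Hypothesis s_gt0 : 0 < s.
Let leb := @lebesgue_measure R.

(** With [u = (x - a)^2 / (4 s^2)], the bound [u^2 * exp (- u) <= 2] turns the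
    integrand into a multiple of the density of variance [2 s^2], whose integral
    is known. *)
Lemma normal_moment4 :
  (\int[normal_prob a s]_x ((x - a) ^+ 4)%:E <= (64 * s ^+ 4)%:E)%E.
Proof.
have s0 : s != 0 by rewrite gt_eqF.
have s2 : Num.sqrt 2 * s != 0 :> R by rewrite mulf_neq0// gt_eqF// sqrtr_gt0.
apply: le_trans (@integral_density_le _ _ _ leb (normal_prob a s) (normal_pdf a s) _ _ _ _ _) _.
- exact: measurable_normal_pdf.
- exact: normal_pdf_ge0.
- by [].
- by move=> x; rewrite lee_fin exprn_even_ge0.
apply: (@le_trans _ _ (\int[leb]_x ((64 * s ^+ 4)%:E * (normal_pdf a (Num.sqrt 2 * s) x)%:E))%E).
  apply: le_integral_nomeas => x.
    by rewrite mule_ge0 ?lee_fin ?normal_pdf_ge0 ?exprn_even_ge0.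
  rewrite -!EFinM lee_fin (normal_pdfE _ s0) (normal_pdfE _ s2)/=.
  rewrite /normal_fun.
  have sq2 : Num.sqrt (2 : R) ^+ 2 = 2 by rewrite sqr_sqrtr.
  set u := (x - a) ^+ 2 / (4 * s ^+ 2).
  have u0 : 0 <= u by rewrite divr_ge0 ?sqr_ge0// mulr_ge0// sqr_ge0.
  have -> : - (x - a) ^+ 2 / (s ^+ 2 *+ 2) = - u - u.
    by rewrite /u; field.
  have -> : - (x - a) ^+ 2 / ((Num.sqrt 2 * s) ^+ 2 *+ 2) = - u.
    by rewrite exprMn sq2 /u; field.
  have -> : (x - a) ^+ 4 = 16 * s ^+ 4 * u ^+ 2 by rewrite /u; field.
  have pk : normal_peak s <= 2 * normal_peak (Num.sqrt 2 * s).
    rewrite /normal_peak exprMn sq2.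
    set w := s ^+ 2 * pi *+ 2.
    have w0 : 0 < w by rewrite /w pmulrn_lgt0// mulr_gt0 ?exprn_gt0// pi_gt0.
    have -> : 2 * s ^+ 2 * pi *+ 2 = 2 * w :> R by rewrite /w mulrnAr mulrA.
    rewrite sqrtrM// invfM mulrA ler_peMl ?invr_ge0//.
    rewrite ler_pdivlMr ?sqrtr_gt0// mul1r.
    rewrite -[leRHS]ger0_norm// -sqrtr_sqr ler_wsqrtr//; lra.
  have u2 : u ^+ 2 <= 2 * expR u.
    have := @expR_ge1Dxn _ u 1 u0; rewrite (_ : 2`! = 2)%N//; lra.
  have e1 : 0 < expR (- u) by exact: expR_gt0.
  have p0 := normal_peak_ge0 (Num.sqrt 2 * s).
  rewrite expRD.
  have E : expR u * expR (- u) = 1 := expRxMexpNx_1 u.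
  have H : u ^+ 2 * expR (- u) <= 2.
    have : u ^+ 2 * expR (- u) <= 2 * expR u * expR (- u) by rewrite ler_wpM2r// ltW.
    by rewrite -mulrA E mulr1.
  have p1 := normal_peak_ge0 s.
  have -> : 16 * s ^+ 4 * u ^+ 2 * (normal_peak s * (expR (- u) * expR (- u))) =
     16 * s ^+ 4 * expR (- u) * (u ^+ 2 * expR (- u) * normal_peak s) by ring.
  have -> : 64 * s ^+ 4 * (normal_peak (Num.sqrt 2 * s) * expR (- u)) =
     16 * s ^+ 4 * expR (- u) * (2 * (2 * normal_peak (Num.sqrt 2 * s))) by ring.
  apply: ler_wpM2l.
    by rewrite !mulr_ge0 ?exprn_even_ge0// ltW.
  by apply: ler_pM => //; rewrite mulr_ge0 ?sqr_ge0// ltW.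
rewrite ge0_integralZl//=.
- by rewrite integral_normal_pdf mule1.
- by have /integrableP[] := integrable_normal_pdf a (Num.sqrt 2 * s).
- by move=> x _; rewrite lee_fin normal_pdf_ge0.
- by rewrite lee_fin mulr_ge0// exprn_even_ge0.
Qed.

Let refl (x : measurableTypeR R) : measurableTypeR R := (a + a - x : R).

Let mrefl : measurable_fun [set: measurableTypeR R] refl.
Proof. exact: (@measurable_funB _ (measurableTypeR R) R). Qed.

Let leb_refl A : measurable A -> leb (refl @^-1` A) = leb A.
Proof.
move=> mA; rewrite -[LHS]/(pushforward leb refl A).
apply/esym/lebesgue_measure_unique => //= _ [[p q]] _ <-.
rewrite /pushforward.
have -> : refl @^-1` `]p, q] = `[a + a - q, a + a - p[%classic.
  apply/seteqP; split => x /=; rewrite /refl !in_itv/=; lra.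
rewrite !lebesgue_measure_itv/= !lte_fin.
rewrite ltrD2l ltrN2; case: ifPn => // _; rewrite -!EFinB; congr EFin; ring.
Qed.

Let normal_refl A : measurable A -> normal_prob a s (refl @^-1` A) = normal_prob a s A.
Proof.
move=> mA; rewrite /normal_prob.
have E x : normal_pdf a s (refl x) = normal_pdf a s x.
  rewrite !normal_pdfE ?gt_eqF//= /normal_fun /refl.
  by rewrite (_ : a + a - x - a = - (x - a)) ?sqrrN// opprB addrAC addrK.
under eq_integral do rewrite -E.
rewrite -(@ge0_integral_pushforward _ _ _ _ R _ mrefl (@lebesgue_measure R) A
  (fun x => (normal_pdf a s x)%:E) mA); last 2 first.
- by apply: measurable_funTS; have /integrableP[] := integrable_normal_pdf a s.
- by move=> x _; rewrite lee_fin normal_pdf_ge0.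
apply: eq_measure_integral => B mB _; exact: leb_refl.
Qed.

(** The normal law is invariant under the reflection about its mean, which
    changes the sign of the integrand. *)
Lemma normal_mean0 : (\int[normal_prob a s]_x (x - a)%:E = 0)%E.
Proof.
have mid : measurable_fun [set: measurableTypeR R] (fun x : measurableTypeR R => (x - a : R)).
  by apply: (@measurable_funB _ (measurableTypeR R) R).
have mid' : measurable_fun [set: measurableTypeR R] (fun x : measurableTypeR R => (x - a)%:E).
  exact/measurable_EFinP.
have I : (normal_prob a s : probability (measurableTypeR R) R).-integrable setT
    (fun x : measurableTypeR R => (x - a)%:E).
  apply: sq_integrable => //.
  apply: (@le_lt_trans _ _ (1 + (64 * s ^+ 4)%:E)%E); last by rewrite -EFinD ltry.
  apply: (@int_le _ (measurableTypeR R) R (normal_prob a s) _ (fun x : measurableTypeR R => 1 + (x - a) ^+ 4 : R)).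
  - by move=> x; rewrite sqr_ge0.
  - move=> x; rewrite -[4%N]/(2 * 2)%N exprM.
    have := sqr_ge0 ((x - a) ^+ 2 - 1); have := sqr_ge0 (x - a); nra.
  - apply: (@int_add_le _ (measurableTypeR R) R (normal_prob a s) (fun=> 1)
      (fun x : measurableTypeR R => (x - a) ^+ 4 : R)) => //.
    + exact: measurable_funX.
    + by move=> x; rewrite exprn_even_ge0.
    + by rewrite (integral_cstP (normal_prob a s)).
    + exact: normal_moment4.
have H := integral_law (Q := normal_prob a s : probability (measurableTypeR R) R)
   (N := normal_prob a s) mrefl normal_refl mid'.
have E : (\int[normal_prob a s]_x (refl x - a)%:E = - \int[normal_prob a s]_x (x - a)%:E)%E.
  under eq_integral.
    move=> x _; rewrite (_ : refl x - a = - (x - a)); last by rewrite /refl; ring.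
    rewrite EFinN; over.
  by rewrite integralN//; exact: integrable_add_def.
rewrite E in H; have := integrable_fin_num measurableT I.
move: H; case: (\int[_]_x _)%E => //= r [] h _.
by congr EFin; lra.
Qed.

End normal_moments.

Section gaussian_variable.
Context {d} {T : measurableType d} {R : realType}.
Variables (Q : probability T R) (Y : T -> R) (a v : R).
Hypothesis mY : measurable_fun [set: T] Y.
Hypothesis YG : forall A : set R, measurable A -> Q (Y @^-1` A) = gauss a v A.
Hypothesis v_ge0 : 0 <= v.

Lemma gauss_moments :
  (\int[Q]_w (Y w - a)%:E = 0)%E /\
  (\int[Q]_w ((Y w - a) ^+ 4)%:E <= (64 * v ^+ 2)%:E)%E.
Proof.
have m1 : measurable_fun [set: R] (fun x : R => (x - a)%:E).
  by apply/measurable_EFinP; exact: measurable_funB.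
have m4 : measurable_fun [set: R] (fun x : R => ((x - a) ^+ 4)%:E).
  by apply/measurable_EFinP; apply: measurable_funX; exact: measurable_funB.
have [v0|v0] := eqVneq v 0.
  have YD A : measurable A -> Q (Y @^-1` A) = \d_a A.
    by move=> mA; rewrite YG// /gauss v0 eqxx.
  rewrite (integral_law mY YD m1) (integral_law mY YD m4).
  rewrite !integral_dirac//= !diracT !mul1e subrr v0 expr0n/= expr0n/= mulr0.
  by split.
have vgt : 0 < v by rewrite lt_def v0.
set s := Num.sqrt v; have s0 : 0 < s by rewrite sqrtr_gt0.
have YN A : measurable A -> Q (Y @^-1` A) = normalR a s A.
  by move=> mA; rewrite YG// /gauss (negbTE v0).
rewrite (integral_law mY YN m1) (integral_law mY YN m4).
have tr f : measurable_fun [set: R] f ->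
    (\int[normalR a s]_x f x = \int[normal_prob a s]_x f (toR x))%E.
  move=> mf; symmetry.
  by apply: (integral_law (Q := normal_prob a s : probability (measurableTypeR R) R)
    (@measurable_toR R)).
rewrite !tr//; split; first exact: normal_mean0.
have -> : v ^+ 2 = s ^+ 4 by rewrite -[4%N]/(2 * 2)%N exprM sqr_sqrtr.
exact: normal_moment4.
Qed.

(** Since [2 * y <= v + y^2 / v], the fourth moment suffices. *)
Lemma gauss_moment2 : (\int[Q]_w ((Y w - a) ^+ 2)%:E <= (64 * v)%:E)%E.
Proof.
have [_ H4] := gauss_moments.
have mYa : measurable_fun [set: T] (fun w => (Y w - a)) by exact: measurable_funB.
have [v0|v0] := eqVneq v 0.
  have : (\int[Q]_w ((Y w - a) ^+ 4)%:E = 0)%E.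
    apply/eqP; rewrite eq_le; apply/andP; split.
      by apply: le_trans H4 _; rewrite v0 expr0n/= mulr0.
    by apply: integral_ge0 => x _; rewrite lee_fin exprn_even_ge0.
  move=> I4; rewrite v0 mulr0 le_eqVlt; apply/orP; left; apply/eqP.
  have Z : ae_eq Q setT (fun w => ((Y w - a) ^+ 4)%:E) (cst 0%E).
    apply/ae_eq_integral_abs => //.
      exact/measurable_EFinP/measurable_funX.
    under eq_integral do rewrite gee0_abs ?lee_fin ?exprn_even_ge0//.
    exact: I4.
  rewrite (ae_eq_integral (cst 0%E))//; first by rewrite integral0.
    exact/measurable_EFinP/measurable_funX.
  apply: filterS Z => w /= + _ => /(_ I) [/eqP].
  by rewrite expf_eq0/= => /eqP ->; rewrite expr0n.
have vgt : 0 < v by rewrite lt_def v0.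
apply: (@int_le _ _ _ _ _ (fun w => 2^-1 * v + (2 * v)^-1 * (Y w - a) ^+ 4)).
- by move=> w; rewrite sqr_ge0.
- move=> w; rewrite -[4%N]/(2 * 2)%N exprM; set y := (Y w - a) ^+ 2.
  rewrite -subr_ge0.
  have -> : 2^-1 * v + (2 * v)^-1 * y ^+ 2 - y = (2 * v)^-1 * (y - v) ^+ 2 by field.
  by rewrite mulr_ge0 ?sqr_ge0// invr_ge0 mulr_ge0.
apply: (@le_trans _ _ ((2^-1 * v)%:E + (2 * v)^-1%:E * (64 * v ^+ 2)%:E)%E); last first.
  rewrite -EFinM -EFinD lee_fin.
  have -> : (2 * v)^-1 * (64 * v ^+ 2) = 32 * v by field.
  lra.
have i0 : 0 <= (2 * v)^-1 by rewrite invr_ge0 mulr_ge0.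
apply: int_add_le => //.
- by apply: measurable_funM => //; exact: measurable_funX.
- by move=> w; rewrite mulr_ge0.
- by move=> w; rewrite mulr_ge0// exprn_even_ge0.
- by rewrite integral_cstP.
- apply: int_scale_le => //; first exact: measurable_funX.
  by move=> w; rewrite exprn_even_ge0.
Qed.

End gaussian_variable.

(** The noise level is a standard deviation, so that the variance in
    [gauss_moments] is [s ^+ 2]. *)
Lemma normalR_moments {R : realType} (s : R) : 0 < s ->
  [/\ (\int[normalR 0 s]_e e%:E = 0)%E,
      (\int[normalR 0 s]_e (e ^+ 2)%:E <= (64 * s ^+ 2)%:E)%E &
      (\int[normalR 0 s]_e (e ^+ 4)%:E <= (64 * s ^+ 4)%:E)%E].
Proof.
move=> s0.
have mid : measurable_fun [set: R] (fun x : R => x) by exact: measurable_id.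
have G (A : set R) : measurable A -> normalR 0 s ((fun x : R => x) @^-1` A) = gauss 0 (s ^+ 2) A.
  move=> mA; rewrite /gauss sqrf_eq0 gt_eqF// sqrtr_sqr gtr0_norm//.
have [E0 E4] := gauss_moments mid G (sqr_ge0 s).
have E2 := gauss_moment2 mid G (sqr_ge0 s).
split.
- by rewrite -E0; apply: eq_integral => x _; rewrite subr0.
- by under eq_integral do rewrite -[X in X ^+ 2]subr0.
- by rewrite [s ^+ 4](exprM s 2 2); under eq_integral do rewrite -[X in X ^+ 4]subr0.
Qed.

Section cube_law.
Context {R : realType}.

Lemma uniform01_itv : (@uniform01 R) (~` [set x : R | 0 <= x <= 1]) = 0%E.
Proof.
rewrite -[LHS]/(uniform_prob (@ltr01 R) (~` [set x : R | 0 <= x <= 1])).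
rewrite /uniform_prob integral_uniform_pdf.
rewrite (_ : _ `&` _ = set0) ?integral_set0//.
by apply/seteqP; split => x //= [+] ; rewrite in_itv.
Qed.

Lemma measurable_unit_itv : measurable [set x : R | 0 <= x <= 1].
Proof.
have -> : [set x : R | 0 <= x <= 1] = `[0, 1]%classic.
  by apply/seteqP; split => x /=; rewrite in_itv.
exact: measurable_itv.
Qed.

Lemma measurable_cube d : measurable (@cube R d).
Proof.
by case: (prod_prob_forall (P := fun _ : 'I_d => @uniform01 R)
  (A := fun _ => [set x : R | 0 <= x <= 1]) (fun _ => measurable_unit_itv)
  (fun _ => uniform01_itv)).
Qed.

Lemma unif_cube d : unif R d (~` cube) = 0%E.
Proof.
by case: (prod_prob_forall (P := fun _ : 'I_d => @uniform01 R)
  (A := fun _ => [set x : R | 0 <= x <= 1]) (fun _ => measurable_unit_itv)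
  (fun _ => uniform01_itv)).
Qed.

End cube_law.

(** * The space of square-integrable functions *)

Section L2_space.
Context {d} {T : measurableType d} {R : realType}.
Variable mu : probability T R.
Local Notation L2 := (L2 mu).
Implicit Types f g h : L2.

Lemma L2_norm_sqr (u : T -> R) : (L2_norm mu u ^+ 2 = \int[mu]_x (u x ^+ 2)%:E)%E.
Proof.
have -> : (L2_norm mu u ^+ 2 = L2_norm mu u `^ 2)%E.
  have := Lnorm_ge0 mu 2%:E (EFin \o u); rewrite -/(L2_norm mu u).
  case: (L2_norm mu u) => [r|_|//].
    by rewrite lee_fin => r0; rewrite poweR_EFin powR_mulrn// EFin_expe.
  by rewrite poweRyr ?pnatr_eq0// expe2 mulyy.
rewrite /L2_norm poweR_Lnorm ?pnatr_eq0//; apply: eq_integral => x _ /=.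
by rewrite powR_mulrn// real_normK ?num_real.
Qed.

Lemma measurable_L2 f : measurable_fun [set: T] (f : T -> R).
Proof. exact: measurable_funP. Qed.

Lemma L2_finite f : (\int[mu]_x (f x ^+ 2)%:E < +oo)%E.
Proof.
rewrite -L2_norm_sqr.
have := @Lfunction_finite _ _ _ _ _ _ f; rewrite /finite_norm => H.
have : (0 <= L2_norm mu f)%E by exact: Lnorm_ge0.
rewrite /L2_norm; move: H; case: ('N[mu]_2[EFin \o f])%E => // r _ _.
by rewrite -EFin_expe ltry.
Qed.

(** The equality holds for functions and not only almost everywhere, so that the
    elements built in this way can be evaluated at points. *)
Definition mkL2 (u : T -> R) (mu_ : measurable_fun [set: T] u)
  (fin : (\int[mu]_x (u x ^+ 2)%:E < +oo)%E) : {f : L2 | f = u :> (T -> R)}.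
Proof.
have fn : finite_norm mu 2%:E u.
  rewrite /finite_norm.
  move: fin; rewrite -L2_norm_sqr /L2_norm.
  have := Lnorm_ge0 mu 2%:E (EFin \o u).
  by case: ('N[mu]_2[EFin \o u])%E => // r _ _; rewrite ltry.
have uP : u \in Lfun mu 2%:E.
  by rewrite inE; apply/andP; split; rewrite inE.
by exists (Lfun_Sub (lee1n 2) uP).
Qed.

Definition ip f g : R := (\int[mu]_x (f x * g x))%R.

Lemma integrable_sqr f : mu.-integrable [set: T] (fun x => (f x ^+ 2)%:E).
Proof.
apply/integrableP; split.
  exact/measurable_EFinP/measurable_funX/measurable_L2.
under eq_integral do rewrite gee0_abs ?lee_fin ?sqr_ge0//.
exact: L2_finite.
Qed.

Lemma integrable_mul f g : mu.-integrable [set: T] (fun x => (f x * g x)%:E).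
Proof.
apply: (@le_integrable _ _ _ _ _ _ _ (fun x => (f x ^+ 2)%:E + (g x ^+ 2)%:E)%E) => //.
- by apply/measurable_EFinP; apply: measurable_funM; exact: measurable_L2.
- move=> x _; rewrite -EFinD !abse_EFin lee_fin [leRHS]ger0_norm ?addr_ge0 ?sqr_ge0//.
  rewrite ler_norml; have := sqr_ge0 (f x - g x); have := sqr_ge0 (f x + g x).
  have := sqr_ge0 (f x); have := sqr_ge0 (g x); nra.
- by apply: integrableD => //; exact: integrable_sqr.
Qed.

Lemma ip_EFin f g : (\int[mu]_x (f x * g x)%:E = (ip f g)%:E)%E.
Proof.
by rewrite /ip /Rintegral fineK//; exact: integrable_fin_num (integrable_mul f g).
Qed.

Lemma ipC f g : ip f g = ip g f.
Proof. by apply: eq_Rintegral => x _; rewrite mulrC. Qed.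

Lemma ipDl f g h : ip (f + g) h = ip f h + ip g h.
Proof.
rewrite -RintegralD//; try exact: integrable_mul.
by apply: eq_Rintegral => x _; rewrite -mulrDl.
Qed.

Lemma ipZl (a : R) f h : ip (a *: f) h = a * ip f h.
Proof.
rewrite -RintegralZl//; last exact: integrable_mul.
by apply: eq_Rintegral => x _; rewrite mulrA.
Qed.

Lemma ipNl f h : ip (- f) h = - ip f h.
Proof. by rewrite -scaleN1r ipZl mulN1r. Qed.

Lemma ipBl f g h : ip (f - g) h = ip f h - ip g h.
Proof. by rewrite ipDl ipNl. Qed.

Lemma ipDr f g h : ip h (f + g) = ip h f + ip h g.
Proof. by rewrite ![ip h _]ipC ipDl. Qed.

Lemma ipNr f h : ip h (- f) = - ip h f.
Proof. by rewrite ![ip h _]ipC ipNl. Qed.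

Lemma ipZr (a : R) f h : ip h (a *: f) = a * ip h f.
Proof. by rewrite ![ip h _]ipC ipZl. Qed.

Lemma ip0l h : ip 0 h = 0.
Proof. by rewrite -(scale0r 0) ipZl mul0r. Qed.

Lemma ip_suml (I : Type) (r : seq I) (F : I -> L2) h :
  ip (\sum_(i <- r) F i) h = \sum_(i <- r) ip (F i) h.
Proof.
elim: r => [|i r IH]; first by rewrite !big_nil ip0l.
by rewrite !big_cons ipDl IH.
Qed.

Lemma ip_sumr (I : Type) (r : seq I) (F : I -> L2) h :
  ip h (\sum_(i <- r) F i) = \sum_(i <- r) ip h (F i).
Proof. by rewrite ipC ip_suml; apply: eq_bigr => i _; rewrite ipC. Qed.

Definition norm2 f := ip f f.

Lemma norm2_ge0 f : 0 <= norm2 f.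
Proof. by apply: Rintegral_ge0 => x _; rewrite -expr2 sqr_ge0. Qed.

Lemma norm2_EFin f : (\int[mu]_x (f x ^+ 2)%:E = (norm2 f)%:E)%E.
Proof. by rewrite /norm2 -ip_EFin; apply: eq_integral => x _; rewrite expr2. Qed.

Lemma norm2D f g : norm2 (f + g) = norm2 f + 2 * ip f g + norm2 g.
Proof. by rewrite /norm2 !ipDl !ipDr [ip g f]ipC; ring. Qed.

Lemma norm2N f : norm2 (- f) = norm2 f.
Proof. by rewrite /norm2 ipNl ipNr opprK. Qed.

Lemma norm2B f g : norm2 (f - g) = norm2 f - 2 * ip f g + norm2 g.
Proof. by rewrite norm2D ipNr norm2N; ring. Qed.

Lemma norm2Z (a : R) f : norm2 (a *: f) = a ^+ 2 * norm2 f.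
Proof. by rewrite /norm2 ipZl ipZr; ring. Qed.

Lemma norm2D_le f g : norm2 (f + g) <= 2 * norm2 f + 2 * norm2 g.
Proof. have := norm2_ge0 (f - g); rewrite norm2B norm2D; lra. Qed.

Lemma L2_dist_sqr f g : (L2_dist mu f g ^+ 2 = (norm2 (f - g))%:E)%E.
Proof. by rewrite /L2_dist L2_norm_sqr -norm2_EFin. Qed.

Lemma L2_dist_sqrt f g : L2_dist mu f g = (Num.sqrt (norm2 (f - g)))%:E.
Proof.
have := L2_dist_sqr f g.
have : (0 <= L2_dist mu f g)%E by exact: Lnorm_ge0.
case: (L2_dist mu f g) => [r|_|//].
  by rewrite lee_fin -EFin_expe => r0 [<-]; rewrite sqrtr_sqr ger0_norm.
by rewrite expe2 mulyy.
Qed.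

(** The triangle inequality makes the distance to a point continuous for the
    pseudometric that defines the open sets, hence measurable. *)
Lemma sqrt_norm2_triangle f g : Num.sqrt (norm2 (f + g)) <=
  Num.sqrt (norm2 f) + Num.sqrt (norm2 g).
Proof.
set a := Num.sqrt (norm2 f); set b := Num.sqrt (norm2 g).
have a0 : 0 <= a := sqrtr_ge0 _; have b0 : 0 <= b := sqrtr_ge0 _.
have aE : a ^+ 2 = norm2 f by rewrite sqr_sqrtr ?norm2_ge0.
have bE : b ^+ 2 = norm2 g by rewrite sqr_sqrtr ?norm2_ge0.
suff ab : ip f g <= a * b.
  rewrite -[leRHS]ger0_norm ?addr_ge0// -sqrtr_sqr ler_wsqrtr// norm2D -aE -bE.
  nra.
have [a1|a1] := eqVneq a 0.
  rewrite a1 mul0r leNgt; apply/negP => i0.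
  have := norm2_ge0 (((norm2 g + 1) / (ip f g)) *: f - g).
  rewrite norm2B norm2Z -aE a1 expr0n mulr0 ipZl mulfVK ?gt_eqF//.
  have := norm2_ge0 g; lra.
have a2 : 0 < a by rewrite lt_def a1.
have := norm2_ge0 ((b / a) *: f - g).
rewrite norm2B norm2Z -aE -bE ipZl => H.
have : 0 <= 2 * b ^+ 2 - 2 * (b / a * ip f g).
  apply: le_trans H _; rewrite le_eqVlt; apply/orP; left; apply/eqP; field.
  by [].
move=> {}H.
have [b1|b1] := eqVneq b 0; last first.
  have b2 : 0 < b by rewrite lt_def b1.
  have H2 : b / a * ip f g <= b ^+ 2 by lra.
  by move: H2; rewrite expr2 -mulrA ler_pM2l// ler_pdivrMl.
rewrite b1 mulr0 leNgt; apply/negP => i0.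
have := norm2_ge0 (((norm2 f + 1) / (ip f g)) *: g - f).
rewrite norm2B norm2Z -bE b1 expr0n mulr0 ipZl [ip g f]ipC mulfVK ?gt_eqF//.
have := norm2_ge0 f; lra.
Qed.

Lemma L2_open_dist_gt g (c : R) : @L2_open _ _ _ mu [set f : L2 | (c%:E < L2_dist mu f g)%E].
Proof.
move=> f /=; rewrite L2_dist_sqrt lte_fin => cf.
exists (Num.sqrt (norm2 (f - g)) - c); first by rewrite subr_gt0.
move=> h; rewrite !L2_dist_sqrt !lte_fin => hf.
have : f - g = (h - g) + (f - h) by rewrite [RHS]addrC addrA subrK.
move=> E; have := sqrt_norm2_triangle (h - g) (f - h); rewrite -E.
have -> : norm2 (f - h) = norm2 (h - f) by rewrite -norm2N opprB.
move: hf; move: (Num.sqrt (norm2 (h - f))) (Num.sqrt (norm2 (f - g)))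
  (Num.sqrt (norm2 (h - g))) => x y z; clear; lra.
Qed.

Lemma measurable_dist_gt g (c : R) :
  measurable [set f : L2 | (c%:E < L2_dist mu f g)%E].
Proof. by apply: sub_sigma_algebra; exact: L2_open_dist_gt. Qed.

Lemma measurable_norm2 g : measurable_fun [set: L2] (fun f : L2 => norm2 (f - g)).
Proof.
have ms : measurable_fun [set: L2] (fun f : L2 => Num.sqrt (norm2 (f - g))).
  apply: (measurability _ (RGenOInfty.measurableE R)) => //.
  move=> _ [_ [c ->] <-]; rewrite setTI.
  rewrite (_ : _ @^-1` _ = [set f : L2 | (c%:E < L2_dist mu f g)%E]).
    exact: measurable_dist_gt.
  by apply/seteqP; split => f /=; rewrite in_itv/= andbT L2_dist_sqrt lte_fin.
rewrite (_ : (fun f : L2 => _) = (fun f : L2 => Num.sqrt (norm2 (f - g)) ^+ 2)).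
  exact: measurable_funX.
by apply/funext => f; rewrite sqr_sqrtr ?norm2_ge0.
Qed.

(** By polarization, inner products inherit the measurability of norms. *)
Lemma measurable_ip g h : measurable_fun [set: L2] (fun f : L2 => ip (f - g) h).
Proof.
rewrite (_ : (fun f : L2 => _) =
    (fun f : L2 => 4^-1 * (norm2 (f - (g - h)) - norm2 (f - (g + h))))).
  by apply: measurable_funM => //; apply: measurable_funB; exact: measurable_norm2.
apply/funext => f.
have -> : f - (g - h) = (f - g) + h by rewrite opprB addrA addrAC.
have -> : f - (g + h) = (f - g) - h by rewrite opprD addrA.
by rewrite (norm2D (f - g) h) (norm2B (f - g) h); field.
Qed.

End L2_space.

(** * Gaussian process laws on the space of square-integrable functions *)

Section transfer.
Context {d1 d2} {T1 : measurableType d1} {T2 : measurableType d2} {R : realType}.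
Variables (Q : probability T1 R) (nu : probability T2 R) (G : T1 -> T2).
Hypothesis nuG : forall A, measurable A -> nu A = Q (G @^-1` A).

(** The path map of a Gaussian process is only known to preserve measures; its
    integrals are transferred by way of real functions of the path. *)
Lemma integral_transfer (phi : T2 -> R) :
  measurable_fun [set: T2] phi -> measurable_fun [set: T1] (phi \o G) ->
  (\int[nu]_x (phi x)%:E = \int[Q]_w (phi (G w))%:E)%E.
Proof.
move=> mphi mphiG.
pose X : {mfun T1 >-> R} := HB.pack (phi \o G) (isMeasurableFun.Build _ _ _ _ _ mphiG).
have mE : measurable_fun [set: R] (@EFin R) by exact/measurable_EFinP.
rewrite (integral_law (N := distribution Q X) mphi _ mE); last first.
  move=> B mB; rewrite nuG//.
  by rewrite -[X in measurable X]setTI; exact: mphi.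
by rewrite -(integral_law (Q := Q) (N := distribution Q X) mphiG _ mE).
Qed.

End transfer.

Section gp_law.
Context {d} {T : measurableType d} {R : realType}.
Variable mu : probability T R.
Local Notation L2 := (L2 mu).
Variables (D : set T) (mD : measurable D) (D1 : mu (~` D) = 0%E).
Variables (nu : probability L2 R) (a : T -> R) (C : T -> T -> R).
Hypothesis nuGP : @GP_law _ _ _ mu D nu a C.
Variable A : L2.
Hypothesis Aa : forall x, D x -> A x = a x.
Variable V : R.
Hypothesis C_ge0 : forall x, D x -> 0 <= C x x.
Variable c : T -> R.
Hypothesis mc : measurable_fun [set: T] c.
Hypothesis c_ge0 : forall x, 0 <= c x.
Hypothesis cC : forall x, D x -> c x = C x x.
Hypothesis cV : (\int[mu]_x (c x)%:E <= V%:E)%E.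

(** The value of the process at each point is a Gaussian variable, and joint
    measurability allows the integrals over the paths and over the points to be
    exchanged. The function [c] is a measurable version of the variance on
    [D]. *)
Lemma GP_law_moments :
  (\int[nu]_f (norm2 (f - A))%:E <= (64 * V)%:E)%E /\
  forall g : L2, (\int[nu]_f (ip (f - A) g)%:E = 0)%E.
Proof.
have [dW [W [Q [G [mG GP nuE]]]]] := nuGP.
have mGD : measurable_fun [set: W * T] ((fun p : W * T => (G p.1 : T -> R) p.2) \_ ([set: W] `*` D)).
  by apply/(measurable_restrictT _ _).1 => //; exact: measurableX.
pose H (p : W * T) : R := ((fun p : W * T => (G p.1 : T -> R) p.2) \_ ([set: W] `*` D)) p
   - (A \_ D) p.2.
have mA : measurable_fun [set: T] (A \_ D).
  by apply/(measurable_restrictT _ _).1 => //; apply: measurable_funTS; exact: measurable_L2.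
have mH : measurable_fun [set: W * T] H.
  apply: measurable_funB => //.
  by apply: measurableT_comp => //; exact: measurable_snd.
have HD w x : D x -> H (w, x) = (G w : T -> R) x - A x.
  move=> Dx; rewrite /H !patchE !mem_set//.
have HN w x : ~ D x -> H (w, x) = 0.
  move=> Dx; rewrite /H !patchE !memNset ?subrr//.
  by case.
have mHx x : measurable_fun [set: W] (fun w => H (w, x)).
  by apply: measurableT_comp => //; exact: pair2_measurable.
have H2x x : (\int[Q]_w (H (w, x) ^+ 2)%:E <= (64 * c x)%:E)%E.
  have [Dx|Dx] := pselect (D x); last first.
    under eq_integral do rewrite HN// expr0n/=.
    by rewrite integral0 lee_fin mulr_ge0.
  under eq_integral do rewrite HD// Aa//.
  rewrite cC//; apply: gauss_moment2 => //; last exact: C_ge0.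
  - have -> : (fun w => (G w : T -> R) x) = (fun w => H (w, x) + A x).
      by apply/funext => w; rewrite HD// subrK.
    exact: measurable_funD.
  - move=> B mB; have := GP 1%N (fun=> x) (fun=> 1) (fun _ => Dx) B mB.
    by rewrite !big_ord1 !mul1r; under eq_set do rewrite big_ord1 mul1r.
have H2 : (\int[mu]_x \int[Q]_w (H (w, x) ^+ 2)%:E <= (64 * V)%:E)%E.
  apply: (@le_trans _ _ (\int[mu]_x (64 * c x)%:E)%E); last first.
    by rewrite EFinM; apply: int_scale_le.
  apply: le_integral_nomeas => x //.
  by apply: integral_ge0 => w _; rewrite lee_fin sqr_ge0.
have H1 x : (\int[Q]_w (H (w, x))%:E = 0)%E.
  have [Dx|Dx] := pselect (D x); last first.
    under eq_integral do rewrite HN//.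
    by rewrite integral0.
  under eq_integral do rewrite HD// Aa//.
  apply: (proj1 (@gauss_moments _ _ _ Q (fun w => (G w : T -> R) x) (a x) (C x x) _ _ (C_ge0 Dx))).
  - have -> : (fun w => (G w : T -> R) x) = (fun w => H (w, x) + A x).
      by apply/funext => w; rewrite HD// subrK.
    exact: measurable_funD.
  - move=> B mB; have := GP 1%N (fun=> x) (fun=> 1) (fun _ => Dx) B mB.
    by rewrite !big_ord1 !mul1r; under eq_set do rewrite big_ord1 mul1r.
have aeD (u v : T -> R) : measurable_fun [set: T] u -> measurable_fun [set: T] v ->
    (forall x, D x -> u x = v x) -> (\int[mu]_x (u x)%:E = \int[mu]_x (v x)%:E)%E.
  move=> mu_ mv uv; apply: ae_eq_integral => //; try exact/measurable_EFinP.
  exists (~` D); split; [exact: measurableC|by []|].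
  by move=> x /= nuv Dx; apply: nuv => _; rewrite uv.
have mHw w : measurable_fun [set: T] (fun x => H (w, x)).
  by apply: measurableT_comp => //; exact: pair1_measurable.
have mH2 : measurable_fun [set: W * T] (fun p => (H p ^+ 2)%:E).
  exact/measurable_EFinP/measurable_funX.
have N2 w : ((norm2 (G w - A))%:E = \int[mu]_x (H (w, x) ^+ 2)%:E)%E.
  rewrite -norm2_EFin; apply: aeD.
  - exact/measurable_funX/(@measurable_L2 _ _ _ mu (G w - A)).
  - exact/measurable_funX.
  - by move=> x Dx; rewrite HD.
have mN2 : measurable_fun [set: W] (fun w => norm2 (G w - A)).
  apply/measurable_EFinP.
  rewrite (_ : _ \o _ = fun w => (\int[mu]_x (H (w, x) ^+ 2)%:E)%E); last first.
    by apply/funext => w /=; rewrite N2.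
  by apply: (measurable_fun_fubini_tonelli_F (fun p => (H p ^+ 2)%:E)) => // p;
    rewrite lee_fin sqr_ge0.
have HF : (\int[Q]_w \int[mu]_x (H (w, x) ^+ 2)%:E =
    \int[mu]_x \int[Q]_w (H (w, x) ^+ 2)%:E)%E.
  by rewrite (fubini_tonelli (fun p => (H p ^+ 2)%:E)) // => p; rewrite lee_fin sqr_ge0.
split.
  rewrite (integral_transfer nuE (phi := fun f : L2 => norm2 (f - A)))//.
  - by under eq_integral do rewrite N2; rewrite HF.
  - exact: measurable_norm2.
move=> g.
have Ig w : ((ip (G w - A) g)%:E = \int[mu]_x (H (w, x) * g x)%:E)%E.
  rewrite -ip_EFin; apply: aeD.
  - apply: measurable_funM; last exact: measurable_L2.
    exact: (@measurable_L2 _ _ _ mu (G w - A)).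
  - by apply: measurable_funM => //; exact: measurable_L2.
  - by move=> x Dx; rewrite HD.
have mHg : measurable_fun [set: W * T] (fun p => (H p * g p.2)%:E).
  apply/measurable_EFinP; apply: measurable_funM => //.
  by apply: measurableT_comp; [exact: measurable_L2|exact: measurable_snd].
have iHg : (Q \x mu)%E.-integrable [set: W * T] (fun p => (H p * g p.2)%:E).
  apply/(integrable12ltyP Q mu mHg).
  apply: (@le_lt_trans _ _ ((64 * V)%:E + (norm2 g)%:E)%E); last by rewrite -EFinD ltry.
  apply: (@le_trans _ _ (\int[Q]_w (\int[mu]_x (H (w, x) ^+ 2)%:E + (norm2 g)%:E))%E).
    apply: le_integral_nomeas => w; first exact: integral_ge0.
    rewrite -norm2_EFin.
    apply: (@le_trans _ _ (\int[mu]_x (H (w, x) ^+ 2 + g x ^+ 2)%:E)%E).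
      apply: le_integral_nomeas => x //; rewrite abse_EFin lee_fin.
      rewrite ler_norml; have := sqr_ge0 (H (w, x) - g x); have := sqr_ge0 (H (w, x) + g x).
      have := sqr_ge0 (H (w, x)); have := sqr_ge0 (g x).
      rewrite /=; move: (H (w, x)) (g x) => u v h1 h2 h3 h4.
      by apply/andP; split; nra.
    apply: int_add_le => //.
    - exact: measurable_funX.
    - exact/measurable_funX/measurable_L2.
    - by move=> x; exact: sqr_ge0.
    - by move=> x; exact: sqr_ge0.
  rewrite ge0_integralD//=.
  - by rewrite integral_cstP; apply: leeD => //; rewrite HF.
  - by move=> w _; apply: integral_ge0 => x _; rewrite lee_fin sqr_ge0.
  - by apply: (measurable_fun_fubini_tonelli_F (fun p => (H p ^+ 2)%:E)) => // p;
      rewrite lee_fin sqr_ge0.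
  - by move=> w _; rewrite lee_fin norm2_ge0.
have E0 : (\int[Q]_w (ip (G w - A) g)%:E = 0)%E.
  under eq_integral do rewrite Ig.
  rewrite (Fubini iHg)/=.
  under eq_integral.
    move=> x _.
    have -> : (\int[Q]_w (H (w, x) * g x)%:E = 0)%E.
      under eq_integral do rewrite EFinM.
      rewrite integralZr//; first by rewrite H1 mul0e.
      by apply: sq_integrable => //; apply: le_lt_trans (H2x x) (ltry _).
    over.
  by rewrite integral0.
rewrite (integral_transfer nuE (phi := fun f : L2 => ip (f - A) g))//.
  exact: measurable_ip.
apply/measurable_EFinP.
rewrite (_ : _ \o _ = fun w => (\int[mu]_x (H (w, x) * g x)%:E)%E); last first.
  by apply/funext => w /=; rewrite Ig.
exact: (measurable_fubini_F iHg).
Qed.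

End gp_law.

(** * Aggregation of the local posteriors *)

Lemma norm_le_of_squares {R : realFieldType} (x y z : R) : 0 <= x -> 0 <= y ->
  0 <= x - 2 * z + y -> 0 <= x + 2 * z + y -> `|z| <= x + y.
Proof. by move=> ? ? ? ?; rewrite ler_norml; apply/andP; split; lra. Qed.

Lemma int_affine {d} {T : measurableType d} {R : realType} (P : probability T R)
    (f g : T -> R) (a b c F G : R) :
  P.-integrable [set: T] (fun x => (f x)%:E) ->
  P.-integrable [set: T] (fun x => (g x)%:E) ->
  (\int[P]_x (f x)%:E = F%:E)%E -> (\int[P]_x (g x)%:E = G%:E)%E ->
  P.-integrable [set: T] (fun x => (a * f x + b * g x + c)%:E) /\
  (\int[P]_x (a * f x + b * g x + c)%:E = (a * F + b * G + c)%:E)%E.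
Proof.
move=> fI gI fF gG.
have aI := integrableZl measurableT a fI.
have bI := integrableZl measurableT b gI.
have cI : P.-integrable [set: T] (fun=> c%:E) by exact: finite_measure_integrable_cst.
have abI := integrableD measurableT aI bI.
have abcI := integrableD measurableT abI cI.
have E : (fun x => (a * f x + b * g x + c)%:E) =
  ((fun x => a%:E * (f x)%:E) \+ (fun x => b%:E * (g x)%:E) \+ cst c%:E)%E by [].
split; first by rewrite E; exact: abcI.
rewrite E (integralD measurableT abI cI) (integralD measurableT aI bI).
by rewrite (integralZl measurableT fI) (integralZl measurableT gI) fF gG integral_cstP.
Qed.

Lemma integrable_law {d d'} {T : measurableType d} {U : measurableType d'}
    {R : realType} (Q : probability T R) (N : probability U R) (Y : T -> U)
    (f : U -> \bar R) :
  measurable_fun [set: T] Y ->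
  (forall B, measurable B -> Q (Y @^-1` B) = N B) ->
  N.-integrable [set: U] f -> Q.-integrable [set: T] (fun x => f (Y x)).
Proof.
move=> mY YN fI; have mf := measurable_int _ fI.
apply/integrableP; split; first exact: (measurableT_comp mf mY).
have mfa : measurable_fun [set: U] (fun y => `|f y|%E).
  exact: (measurableT_comp (@abse_measurable _ _) mf).
rewrite (ge0_integral_law mY YN (f := fun y => `|f y|%E))//.
by have /integrableP[] := fI.
Qed.

(** This is [0 <= norm2 (X - 2 *: Y)]. The right-hand side couples [X] and [Y],
    whereas the left-hand side splits into a function of [X] and a function of
    [Y]: its integral over a coupling depends on the marginals only. *)
Lemma norm2_sub_lower {d} {T : measurableType d} {R : realType}
    (mu : probability T R) (X Y z : L2 mu) :
  2^-1 * norm2 X + norm2 z - 2 * ip X z + (2 * ip Y z - norm2 Y) <=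
  norm2 (X - Y - z).
Proof.
have := norm2_ge0 (X - 2 *: Y).
rewrite (norm2B X (2 *: Y)) norm2Z ipZr.
rewrite (norm2B (X - Y) z) (norm2B X Y) ipBl.
move: (norm2 X) (norm2 Y) (norm2 z) (ip X z) (ip Y z) (ip X Y) => x y w a b c.
lra.
Qed.

Lemma int_add {d} {T : measurableType d} {R : realType} (P : probability T R)
    (f g : T -> R) (F G : R) :
  P.-integrable [set: T] (fun x => (f x)%:E) ->
  P.-integrable [set: T] (fun x => (g x)%:E) ->
  (\int[P]_x (f x)%:E = F%:E)%E -> (\int[P]_x (g x)%:E = G%:E)%E ->
  (\int[P]_x (f x + g x)%:E = (F + G)%:E)%E.
Proof.
by move=> fI gI fF gG; rewrite EFinD -fF -gG -(integralD measurableT fI gI).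
Qed.

Lemma barycenter_lower_arith {R : realFieldType} (D i x V v : R) : V <= v ->
  2^-1 * D - v + x - 2 * i <= 2^-1 * D + (-2) * i + x + ((-1) * V + 2 * 0 + 0).
Proof. by move=> ?; lra. Qed.

Lemma barycenter_cost_arith {R : realFieldType} (D S U : R) :
  2^-1 * D - S + U <= S + U -> D <= 4 * S.
Proof. by move=> ?; lra. Qed.

Lemma barycenter_final_arith {R : realFieldType} (D S N : R) :
  D <= 4 * S -> 2 * D + 2 * N <= 2 * N + 8 * S.
Proof. by move=> ?; lra. Qed.

Section aggregation.
Context {d} {T : measurableType d} {R : realType}.
Variable mu : probability T R.
Local Notation L2 := (L2 mu).
Variables (m : nat) (m_gt0 : (0 < m)%N).
Variables (L : 'I_m -> probability L2 R) (A : 'I_m -> L2) (v : 'I_m -> R).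
Hypothesis L_second : forall k, (\int[L k]_f (norm2 (f - A k))%:E <= (v k)%:E)%E.
Hypothesis L_mean : forall k (g : L2), (\int[L k]_f (ip (f - A k) g)%:E = 0)%E.
Variable nu : probability L2 R.

Definition mean_center : L2 := m%:R^-1 *: \sum_k A k.

Let m0 : m%:R != 0 :> R. Proof. by rewrite pnatr_eq0 -lt0n. Qed.

Section average.
Hypothesis nu_avg : average_law L nu.
Variables (J : nat -> finType) (b : forall q, J q -> L2).
Hypothesis bessel : forall q (g : L2), \sum_(j : J q) ip g (b j) ^+ 2 <= norm2 g.
Hypothesis parseval : forall g : L2,
  \sum_(j : J q) ip g (b j) ^+ 2 @[q --> \oo] --> norm2 g.

Let avg (t : m.-tuple L2) : L2 := m%:R^-1 *: \sum_(k < m) tnth t k.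

(** In each coordinate, the draws of the machines are independent and centred
    about their means, so that the variances add up and the factor [m ^- 2] is
    gained. The finite systems [b] exhaust the space, so that norms are limits of
    sums of squared coordinates. *)
Lemma average_law_second_moment (f0 : L2) :
  (\int[nu]_f (norm2 (f - f0))%:E <=
    (norm2 (mean_center - f0) + m%:R ^- 2 * \sum_k v k)%:E)%E.
Proof.
have coord (t : m.-tuple L2) g : ip (avg t - f0) g =
    ip (mean_center - f0) g + \sum_(k < m) m%:R^-1 * ip (tnth t k - A k) g.
  rewrite -mulr_sumr -ip_suml sumrB.
  rewrite /avg /mean_center !ipBl !ipZl; ring.
have mlin g : measurable_fun [set: m.-tuple L2]
    (fun t => \sum_(k < m) m%:R^-1 * ip (tnth t k - A k) g).
  apply: measurable_sum => k; apply: measurable_funM => //.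
  apply: (@measurableT_comp _ _ _ _ _ _ (fun f : L2 => ip (f - A k) g)).
    exact: measurable_ip.
  exact: measurable_tnth.
have mS q : measurable_fun [set: m.-tuple L2]
    (fun t => \sum_(j : J q) ip (avg t - f0) (b j) ^+ 2).
  apply: measurable_sum => j; apply: measurable_funX.
  under eq_fun do rewrite coord.
  by apply: measurable_funD.
have cvS t : \sum_(j : J q) ip (avg t - f0) (b j) ^+ 2 @[q --> \oo] --> norm2 (avg t - f0).
  exact: parseval.
have mN : measurable_fun [set: m.-tuple L2] (fun t => norm2 (avg t - f0)).
  by apply: (measurable_fun_cvg (h := fun q t => \sum_(j : J q) ip (avg t - f0) (b j) ^+ 2)) => // t _; exact: cvS.
rewrite (integral_transfer (Q := prod_prob L) (G := avg) nu_avg (phi := fun f : L2 => norm2 (f - f0)))//; last first.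
  exact: measurable_norm2.
rewrite -(cvg_limn_einf (cvg_cst (norm2 (mean_center - f0) + m%:R ^- 2 * \sum_k v k))).
apply: (fatou_le (A := setT) (f_ := fun q t => \sum_(j : J q) ip (avg t - f0) (b j) ^+ 2)).
- exact: measurableT.
- by rewrite setCT measure0.
- exact: mS.
- by move=> q t; apply: sumr_ge0 => j _; exact: sqr_ge0.
- by move=> t; rewrite lee_fin norm2_ge0.
- by move=> t _; rewrite (cvg_limn_einf (cvS t)).
- move=> q.
  pose w k j := fine (\int[L k]_f (ip (f - A k) (b (j : J q)) ^+ 2)%:E)%E.
  have mip k g : measurable_fun [set: L2] (fun f : L2 => ip (f - A k) g).
    exact: measurable_ip.
  have bes k (f : L2) : \sum_(j : J q) ip (f - A k) (b j) ^+ 2 <= norm2 (f - A k).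
    exact: bessel.
  have le1 k (j : J q) (f : L2) : ip (f - A k) (b j) ^+ 2 <= norm2 (f - A k).
    apply: le_trans (bes k f); rewrite (bigD1 j)//= lerDl.
    by apply: sumr_ge0 => i _; exact: sqr_ge0.
  have wE k (j : J q) : ((w k j)%:E = \int[L k]_f (ip (f - A k) (b j) ^+ 2)%:E)%E.
    rewrite /w fineK// ge0_fin_numE.
      by apply: le_lt_trans (ltry (v k)); apply: int_le (L_second k) => f //; exact: sqr_ge0.
    by apply: integral_ge0 => f _; rewrite lee_fin sqr_ge0.
  have ws k : \sum_j w k j <= v k.
    rewrite -lee_fin -sumEFin.
    under eq_bigr do rewrite wE.
    rewrite -ge0_integral_sum//.
    + under eq_integral do rewrite sumEFin.
      apply: int_le (L_second k) => f //.
      by apply: sumr_ge0 => j _; exact: sqr_ge0.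
    + by move=> j; apply/measurable_EFinP; exact: measurable_funX.
    + by move=> j f _; rewrite lee_fin sqr_ge0.
  apply: (@le_trans _ _ (\sum_(j : J q) (ip (mean_center - f0) (b j) ^+ 2
      + \sum_(k < m) m%:R ^- 2 * w k j))%:E).
    apply: int_sum_le.
    + move=> j; apply: measurable_funX.
      under eq_fun do rewrite coord.
      by apply: measurable_funD.
    + by move=> j t; exact: sqr_ge0.
    + move=> j; under eq_integral do rewrite coord.
      apply: (proj2 (@integral_sum_sqr _ _ _ m L (fun k f => m%:R^-1 * ip (f - A k) (b j)) _ _ _ _ _)).
      * by move=> k; apply: measurable_funM.
      * move=> k; under eq_integral do rewrite EFinM.
        rewrite integralZl//; first by rewrite L_mean mule0.
        by apply: sq_integrable => //; rewrite -wE ltry.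
      * move=> k; under eq_integral do rewrite exprMn exprVn.
        rewrite EFinM wE; apply: int_scale_le => //.
        - exact: measurable_funX.
        - by move=> f; exact: sqr_ge0.
  rewrite lee_fin big_split/=; apply: lerD; first exact: bessel.
  rewrite exchange_big/= mulr_sumr; apply: ler_sum => k _.
  by rewrite -mulr_sumr ler_wpM2l// invr_ge0 exprn_ge0.
Qed.

End average.

Section barycenter.
Hypothesis nu_bar : W2_barycenter L nu.

Let Ab := mean_center.
Let c k := A k - Ab.

Let sum_c : \sum_k c k = 0.
Proof.
rewrite /c sumrB sumr_const card_ord /Ab /mean_center -scaler_nat scalerA.
by rewrite mulfV// scale1r subrr.
Qed.

Let iN k : (L k).-integrable [set: L2] (fun f => (norm2 (f - A k))%:E).
Proof.
apply/integrableP; split; first by apply/measurable_EFinP; exact: measurable_norm2.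
under eq_integral do rewrite gee0_abs ?lee_fin ?norm2_ge0//.
exact: le_lt_trans (L_second k) (ltry _).
Qed.

Let int_ip_of (M : probability L2 R) (B g : L2) :
  M.-integrable [set: L2] (fun f => (norm2 (f - B))%:E) ->
  M.-integrable [set: L2] (fun f => (ip (f - B) g)%:E).
Proof.
move=> H; apply: (@le_integrable _ _ _ _ _ _ _ (fun f : L2 => (norm2 (f - B))%:E + (norm2 g)%:E)%E) => //.
- by apply/measurable_EFinP; exact: measurable_ip.
- move=> f _; rewrite -EFinD !abse_EFin lee_fin [leRHS]ger0_norm ?addr_ge0 ?norm2_ge0//.
  apply: norm_le_of_squares; [exact: norm2_ge0|exact: norm2_ge0| |].
    by rewrite -norm2B norm2_ge0.
  by rewrite -norm2D norm2_ge0.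
- apply: integrableD => //; exact: finite_measure_integrable_cst.
Qed.

(* The product of the two laws is a coupling. The squared distance to [Ab] is
   expanded about [A k], and the cross term integrates to zero. *)
Let cost_dirac k : (W2_sq (\d_Ab : probability L2 R) (L k) <= (v k + norm2 (c k))%:E)%E.
Proof.
apply: (@le_trans _ _ (\int[((\d_Ab : probability L2 R) \x L k)%E]_p
  (L2_dist mu p.1 p.2 ^+ 2))%E).
  apply: ereal_inf_lbound.
  exists ((\d_Ab : probability L2 R) \x L k)%E => //.
  move=> B mB; split.
    apply: etrans (product_measure1E _ _ _ _) _ => //.
    by rewrite [X in (_ * X)%E](_ : _ = 1%E) ?mule1//; exact: (probability_setT (L k)).
  apply: etrans (product_measure1E _ _ _ _) _ => //.
  by rewrite [X in (X * _)%E](_ : _ = 1%E) ?mul1e//; exact: diracT.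
pose D0 := [set f : L2 | (0%:E < L2_dist mu f Ab)%E].
have mD0 : measurable D0 by exact: measurable_dist_gt.
have mF : measurable_fun [set: L2 * L2] (fun p : L2 * L2 => norm2 (p.2 - Ab)).
  exact: (@measurableT_comp _ _ _ _ _ _ (fun g : L2 => norm2 (g - Ab)) _ snd
    (measurable_norm2 Ab) measurable_snd).
pose F (p : L2 * L2) : \bar R := (norm2 (p.2 - Ab))%:E.
apply: (@le_trans _ _ (\int[((\d_Ab : probability L2 R) \x L k)%E]_p F p)%E).
  apply: (@integral_le_ae _ _ _ _ ((~` D0) `*` setT)).
  - by apply: measurableX => //; exact: measurableC.
  - rewrite (_ : ~` _ = D0 `*` setT); last first.
      apply/seteqP; split => [[f g] /= H|[f g] /= [H _] [H2 _]//].
      by split=> //; apply: contrapT => H2; apply: H.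
    apply: etrans (product_measure1E _ _ _ _) _ => //.
    rewrite [X in (X * _)%E](_ : _ = 0%E) ?mul0e//.
    rewrite /= diracE memNset//.
    have nD0 : ~ (0%:E < L2_dist mu Ab Ab)%E.
      by rewrite (L2_dist_sqrt Ab Ab) subrr /norm2 ip0l sqrtr0 ltxx.
    exact: nD0.
  - by move=> p; rewrite L2_dist_sqr lee_fin norm2_ge0.
  - by move=> p; rewrite lee_fin norm2_ge0.
  - exact/measurable_EFinP.
  - move=> [f g] [/= H _]; apply: (@le_trans _ _ (norm2 (f - g))%:E); first by rewrite -L2_dist_sqr.
    rewrite /F/= lee_fin.
    have z : norm2 (f - Ab) = 0.
      have : ~ (0%:E < L2_dist mu f Ab)%E := H.
      rewrite (L2_dist_sqrt f Ab) lte_fin => /negP; rewrite -leNgt => H0.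
      have : Num.sqrt (norm2 (f - Ab)) = 0 by apply/eqP; rewrite eq_le H0 sqrtr_ge0.
      by move/eqP; rewrite sqrtr_eq0 => H1; apply/eqP; rewrite eq_le H1 norm2_ge0.
    have tri := sqrt_norm2_triangle (f - Ab) (Ab - g).
    move: tri; rewrite z sqrtr0 add0r -[norm2 (Ab - g)]norm2N opprB.
    rewrite (_ : f - Ab + (Ab - g) = f - g); last by rewrite addrA subrK.
    by rewrite ler_sqrt// norm2_ge0.
rewrite fubini_tonelli1//=; last 2 first.
- exact/measurable_EFinP.
- by move=> p; rewrite lee_fin norm2_ge0.
have [V VE] : exists V, (\int[L k]_f (norm2 (f - A k))%:E = V%:E)%E.
  exists (fine (\int[L k]_f (norm2 (f - A k))%:E)%E).
  by rewrite fineK//; exact: integrable_fin_num (iN k).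
have E (f : L2) : norm2 (f - Ab) = 1 * norm2 (f - A k) + 2 * ip (f - A k) (c k) + norm2 (c k).
  rewrite (_ : f - Ab = (f - A k) + c k); last by rewrite /c addrA subrK.
  by rewrite (norm2D (f - A k) (c k)) mul1r.
have [_ I] := int_affine 1 2 (norm2 (c k)) (iN k) (int_ip_of (c k) (iN k)) VE (L_mean k (c k)).
have FE : fubini_F (L k) F = cst (V + norm2 (c k))%:E.
  apply/funext => f; rewrite /fubini_F /F/=; under eq_integral do rewrite E.
  by rewrite I mul1r mulr0 addr0.
rewrite FE integral_cstP lee_fin lerD2r -lee_fin -VE; exact: L_second.
Qed.

(** With [c k = A k - Ab], every coupling of [nu] with [L k] costs at least
    [D / 2 - v k + norm2 (c k)] up to a term that is linear in [c k], where [D] is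
    the spread of [nu] about [Ab]. The linear terms cancel in the sum over [k],
    and the Dirac mass at [Ab] costs at most [v k + norm2 (c k)]. The minimality
    of [nu] thus yields that [D] is at most four times the average of the
    [v k]. *)
Lemma barycenter_second_moment (f0 : L2) :
  (\int[nu]_f (norm2 (f - f0))%:E <=
    (2 * norm2 (mean_center - f0) + 8 * (m%:R^-1 * \sum_k v k))%:E)%E.
Proof.
have [fin2 min] := nu_bar.
have mn : measurable_fun [set: L2] (fun f : L2 => norm2 f).
  have := measurable_norm2 (0 : L2).
  by rewrite (_ : (fun f : L2 => norm2 (f - 0)) = fun f => norm2 f)//; apply/funext => f; rewrite subr0.
have nuI : nu.-integrable [set: L2] (fun f => (norm2 (f - Ab))%:E).
  apply/integrableP; split; first by apply/measurable_EFinP; exact: measurable_norm2.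
  under eq_integral do rewrite gee0_abs ?lee_fin ?norm2_ge0//.
  apply: (@le_lt_trans _ _ (2%:E * (\int[nu]_f (norm2 f)%:E) + (2 * norm2 Ab)%:E)%E).
    apply: (@int_le _ _ _ _ _ (fun f : L2 => 2 * norm2 f + 2 * norm2 Ab)).
    - by move=> f; exact: norm2_ge0.
    - by move=> f; rewrite -[norm2 Ab]norm2N; exact: norm2D_le.
    apply: int_add_le.
    - exact: measurable_funM.
    - exact: measurable_cst.
    - by move=> f; rewrite mulr_ge0 ?norm2_ge0.
    - by move=> f; rewrite mulr_ge0 ?norm2_ge0.
    - by apply: int_scale_le => // f; exact: norm2_ge0.
    - by rewrite integral_cstP.
  have : (\int[nu]_f (norm2 f)%:E < +oo)%E.
    move: fin2; rewrite /finite_second_moment.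
    by under eq_integral do rewrite L2_norm_sqr norm2_EFin.
  have : (0 <= \int[nu]_f (norm2 f)%:E)%E.
    by apply: integral_ge0 => f _; rewrite lee_fin norm2_ge0.
  by case: (\int[nu]_f _)%E => // r _ _; rewrite -EFinM -EFinD ltry.
have fD : finite_second_moment (\d_Ab : probability L2 R).
  rewrite /finite_second_moment.
  under eq_integral do rewrite L2_norm_sqr norm2_EFin.
  rewrite integral_dirac//=; first by rewrite diracT mul1e ltry.
  exact/measurable_EFinP.
have [D DE] : exists D, (\int[nu]_f (norm2 (f - Ab))%:E = D%:E)%E.
  exists (fine (\int[nu]_f (norm2 (f - Ab))%:E)%E).
  by rewrite fineK//; exact: integrable_fin_num nuI.
have /cid2[i _ iE] : exists2 i : 'I_m -> R, True & forall k, (\int[nu]_f (ip (f - Ab) (c k))%:E = (i k)%:E)%E.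
  exists (fun k => fine (\int[nu]_f (ip (f - Ab) (c k))%:E)%E) => // k.
  by rewrite fineK//; exact: (integrable_fin_num measurableT (int_ip_of (c k) nuI)).
have sum_i : \sum_k i k = 0.
  have S (r : seq 'I_m) :
      (\int[nu]_f (ip (f - Ab) (\sum_(k <- r) c k))%:E = (\sum_(k <- r) i k)%:E)%E.
    elim: r => [|k r IH].
      rewrite !big_nil; under eq_integral do rewrite ipC ip0l.
      by rewrite integral0.
    rewrite !big_cons; under eq_integral do rewrite ipDr.
    exact: (int_add (int_ip_of (c k) nuI) (int_ip_of _ nuI) (iE k) IH).
  have [] : ((\sum_k i k)%:E = 0%:E :> \bar R)%E; last by [].
  rewrite -S sum_c; under eq_integral do rewrite ipC ip0l.
  by rewrite integral0.
have lower k : ((2^-1 * D - v k + norm2 (c k) - 2 * i k)%:E <= W2_sq nu (L k))%E.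
  apply: le_ereal_inf_tmp => _ [g gc <-].
  pose u (f : L2) := 2^-1 * norm2 (f - Ab) + norm2 (c k) - 2 * ip (f - Ab) (c k).
  pose w (f : L2) := 2 * ip (f - A k) (c k) - norm2 (f - A k).
  pose h (p : L2 * L2) := u p.1 + w p.2.
  have hle p : h p <= norm2 (p.1 - p.2).
    have -> : p.1 - p.2 = (p.1 - Ab) - (p.2 - A k) - c k.
      by rewrite /c !opprB addrAC [p.1 - Ab + _]addrA subrK addrA subrK.
    exact: norm2_sub_lower.
  have [V VE] : exists V, (\int[L k]_f (norm2 (f - A k))%:E = V%:E)%E.
    exists (fine (\int[L k]_f (norm2 (f - A k))%:E)%E).
    by rewrite fineK//; exact: integrable_fin_num (iN k).
  have VL : V <= v k by rewrite -lee_fin -VE; exact: L_second.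
  have uE : u = fun f => 2^-1 * norm2 (f - Ab) + (-2) * ip (f - Ab) (c k) + norm2 (c k).
    by apply/funext => f; rewrite /u mulNr; exact: addrAC.
  have wE : w = fun f => (-1) * norm2 (f - A k) + 2 * ip (f - A k) (c k) + 0.
    by apply/funext => f; rewrite /w mulN1r addr0 addrC.
  have [iu Iu] : nu.-integrable [set: L2] (fun f => (u f)%:E) /\
      (\int[nu]_f (u f)%:E = (2^-1 * D + (-2) * i k + norm2 (c k))%:E)%E.
    rewrite uE; exact: (int_affine (2^-1) (-2) (norm2 (c k)) nuI (int_ip_of (c k) nuI) DE (iE k)).
  have [iw Iw] : (L k).-integrable [set: L2] (fun f => (w f)%:E) /\
      (\int[L k]_f (w f)%:E = ((-1) * V + 2 * 0 + 0)%:E)%E.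
    rewrite wE; exact: (int_affine (-1) 2 0 (iN k) (int_ip_of (c k) (iN k)) VE (L_mean k (c k))).
  have mEu : measurable_fun [set: L2] (fun f => (u f)%:E) by exact: measurable_int iu.
  have mEw : measurable_fun [set: L2] (fun f => (w f)%:E) by exact: measurable_int iw.
  have g1 B : measurable B -> g (fst @^-1` B) = nu B.
    move=> mB; have [<- _] := gc _ mB; congr (g _).
    by apply/seteqP; split => [[p q]//=|[p q] []].
  have g2 B : measurable B -> g (snd @^-1` B) = L k B.
    move=> mB; have [_ <-] := gc _ mB; congr (g _).
    by apply/seteqP; split => [[p q]//=|[p q] []].
  have ig1 : g.-integrable [set: L2 * L2] (fun p => (u p.1)%:E).
    exact: (integrable_law (f := fun f => (u f)%:E) measurable_fst g1 iu).
  have ig2 : g.-integrable [set: L2 * L2] (fun p => (w p.2)%:E).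
    exact: (integrable_law (f := fun f => (w f)%:E) measurable_snd g2 iw).
  have Eh : (\int[g]_p (h p)%:E = \int[nu]_f (u f)%:E + \int[L k]_f (w f)%:E)%E.
    under eq_integral do rewrite EFinD.
    rewrite integralD//=; congr (_ + _)%E.
      by rewrite (integral_law (N := nu) (@measurable_fst _ _ _ _) g1 mEu).
    by rewrite (integral_law (N := L k) (@measurable_snd _ _ _ _) g2 mEw).
  apply: (@le_trans _ _ (\int[g]_p (h p)%:E)%E).
    rewrite Eh Iu Iw -EFinD lee_fin.
    exact: barycenter_lower_arith.
  rewrite integralE.
  apply: (@le_trans _ _ (\int[g]_p ((fun p => (h p)%:E)^\+ p))%E).
    apply: geeDl; rewrite oppe_le0; apply: integral_ge0 => p _; exact: funeneg_ge0.
  apply: le_integral_nomeas => p; first exact: funepos_ge0.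
  rewrite funeposE L2_dist_sqr ge_max !lee_fin norm2_ge0 andbT; exact: hle.
have cost := min _ fD.
have key : D <= 4 * (m%:R^-1 * \sum_k v k).
  have c1 : ((m%:R^-1 * \sum_k (2^-1 * D - v k + norm2 (c k) - 2 * i k))%:E <=
             (m%:R^-1 * \sum_k (v k + norm2 (c k)))%:E)%E.
    apply: le_trans (le_trans _ cost) _.
      rewrite /barycenter_cost EFinM; apply: lee_wpmul2l.
        by rewrite lee_fin invr_ge0.
      by rewrite -sumEFin; apply: lee_sum.
    rewrite /barycenter_cost EFinM; apply: lee_wpmul2l.
      by rewrite lee_fin invr_ge0.
    by rewrite -sumEFin; apply: lee_sum.
  have s2 : \sum_k 2 * i k = 0 by rewrite -mulr_sumr sum_i mulr0.
  move: c1; rewrite lee_fin !big_split/= !sumrN s2 sumr_const card_ord.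
  have mi (X : R) : m%:R^-1 * (X *+ m) = X by rewrite -[X *+ m]mulr_natl mulrA mulVf// mul1r.
  rewrite subr0 !mulrDr mulrN mi.
  exact: barycenter_cost_arith.
apply: (@int_le _ _ _ _ _ (fun f : L2 => 2 * norm2 (f - Ab) + 2 * norm2 (Ab - f0))).
- by move=> f; exact: norm2_ge0.
- move=> f; rewrite (_ : f - f0 = (f - Ab) + (Ab - f0)); first exact: norm2D_le.
  by rewrite addrA subrK.
apply: (@le_trans _ _ ((2 * D)%:E + (2 * norm2 (Ab - f0))%:E)%E).
  apply: int_add_le.
  - by apply: measurable_funM => //; exact: measurable_norm2.
  - exact: measurable_cst.
  - by move=> f; rewrite mulr_ge0 ?norm2_ge0.
  - by move=> f; rewrite mulr_ge0 ?norm2_ge0.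
  - rewrite EFinM; apply: int_scale_le => //.
    + exact: measurable_norm2.
    + by move=> f; exact: norm2_ge0.
    + by rewrite DE.
  - by rewrite integral_cstP.
rewrite -EFinD lee_fin /Ab; exact: barycenter_final_arith.
Qed.

End barycenter.

End aggregation.

(** * Risk of the averaged ridge estimators in a finite box *)

Lemma sqr_add2_le {R : realFieldType} (x y : R) : (x + y) ^+ 2 <= 2 * x ^+ 2 + 2 * y ^+ 2.
Proof. by have := sqr_ge0 (x - y); nra. Qed.

Lemma sqr_add3_le {R : realFieldType} (x y z : R) :
  (x + y + z) ^+ 2 <= 3 * (x ^+ 2 + y ^+ 2 + z ^+ 2).
Proof. by have := sqr_ge0 (x - y); have := sqr_ge0 (x - z); have := sqr_ge0 (y - z); nra. Qed.

Lemma sum_lin2 {R : pzRingType} {I : finType} (c e : R) (x y : I -> R) :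
  \sum_i (c * x i + e * y i) = c * (\sum_i x i) + e * (\sum_i y i).
Proof. by rewrite big_split/= !mulr_sumr. Qed.

Lemma sum_add3 {R : pzRingType} {I : finType} (c : R) (x y z : I -> R) :
  \sum_i c * (x i + y i + z i) = c * (\sum_i x i + \sum_i y i + \sum_i z i).
Proof. by rewrite -mulr_sumr !big_split. Qed.

Section box_risk.
Context {R : realType} {d} {T : measurableType d} {J : finType}.
Variables (F : J -> T -> R) (M : R) (mu : J -> R) (t : R) (n m : nat).
Variables (f0 : T -> R) (fc : J -> R).
Hypothesis n_gt0 : (0 < n)%N.
Hypothesis m_gt0 : (0 < m)%N.
Hypothesis t_gt0 : 0 < t.
Hypothesis mu_gt0 : forall j, 0 < mu j.
Hypothesis F_le : forall j x, `|F j x| <= M.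

Let lam := t / n%:R.
Let a := shrink mu lam.
Let D := \sum_j a j.

Let lam_gt0 : 0 < lam. Proof. by rewrite divr_gt0// ltr0n. Qed.
Let a_gt0 j : 0 < a j. Proof. exact: shrink_gt0. Qed.
Let a_le1 j : a j <= 1. Proof. exact: shrink_le1. Qed.
Let D_ge0 : 0 <= D. Proof. by apply: sumr_ge0 => j _; exact: ltW. Qed.

Local Notation pair := (T * R)%type.
Local Notation sample := (n.-tuple pair).

Definition feature (j : J) (p : pair) : R := F j p.1.

(** The constant of [ridge_coef_bound], valid for every design. *)
Definition coef_weight : R := (\sum_j mu j ^+ 2) * (M ^+ 2 * n%:R / t ^+ 2).

(** The threshold is proportional to [1 / m] because the noise of a machine
    leaves a remainder of relative size [hs_sample], which averaging over the
    machines does not reduce. *)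
Definition bad_gram (s : sample) : R :=
  \1_[set s : sample | (4 * m%:R)^-1 < hs_sample feature a s] s.

Definition resid (x : T) : R := f0 x - \sum_k a k * fc k * F k x.

Definition resid_mean (j : J) (s : sample) : R :=
  n%:R^-1 * (\sum_i feature j (tnth s i) * resid (tnth s i).1) - (fc j - a j * fc j).

Definition noise_mean (j : J) (s : sample) : R :=
  n%:R^-1 * (\sum_i feature j (tnth s i) * (tnth s i).2).

(** The first line bounds the error on the good event, the rest on the bad
    event. *)
Definition bias_bound (s : sample) : R :=
  8 * (\sum_j a j * resid_mean j s ^+ 2) + 2 * (\sum_j (fc j - a j * fc j) ^+ 2)
  + (2 * coef_weight * (\sum_i bad_gram s * f0 (tnth s i).1 ^+ 2)
     + 2 * (\sum_j fc j ^+ 2) * bad_gram s).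

(** This concerns the part of the noise that is left when the linear term
    [a j * noise_mean j] has been removed. The linear term is kept apart, since
    its average over the machines profits from independence. *)
Definition noise_bound (s : sample) : R :=
  m%:R^-1 * (\sum_j a j * noise_mean j s ^+ 2)
  + (2 * coef_weight + 2 * (M ^+ 2 * D / n%:R)) *
     (\sum_i bad_gram s * (tnth s i).2 ^+ 2).

Definition risk_bound (w : m.-tuple sample) : R :=
  3 * (m%:R^-1 * (\sum_k bias_bound (tnth w k)) + m%:R^-1 * (\sum_k noise_bound (tnth w k))
       + \sum_j a j ^+ 2 * (m%:R^-1 * \sum_k noise_mean j (tnth w k)) ^+ 2).

Section deterministic.
Variable s : sample.
Let feat (j : J) (i : 'I_n) : R := feature j (tnth s i).
Variables (cf ce : 'I_n -> R).
Hypothesis cf_sol : forall i, \sum_i' emp_kernel mu feat i i' * cf i' + t * cf i = f0 (tnth s i).1.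
Hypothesis ce_sol : forall i, \sum_i' emp_kernel mu feat i i' * ce i' + t * ce i = (tnth s i).2.

Let bad_or : (bad_gram s = 0 /\ hs_dev mu feat t <= (4 * m%:R)^-1) \/ bad_gram s = 1.
Proof.
have [H|H] := leP (hs_sample feature a s) (4 * m%:R)^-1; [left|right].
  by split=> //; rewrite /bad_gram indicE memNset//= => /(le_lt_trans H); rewrite ltxx.
by rewrite /bad_gram indicE mem_set.
Qed.

Let eta_le : (4 * m%:R)^-1 <= 4^-1 :> R.
Proof. by rewrite lef_pV2 ?posrE ?mulr_gt0 ?ltr0n// ler_peMr// ler1n. Qed.

Let bad_ge0 : 0 <= bad_gram s. Proof. by case: bad_or => [[-> _]|->]. Qed.

Let w_ge0 : 0 <= coef_weight.
Proof.
apply: mulr_ge0; first by apply: sumr_ge0 => j _; exact: sqr_ge0.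
by apply: divr_ge0; [apply: mulr_ge0; [exact: sqr_ge0|exact: ler0n]|exact: sqr_ge0].
Qed.

Let coef_le c (y : 'I_n -> R) :
  (forall i, \sum_i' emp_kernel mu feat i i' * c i' + t * c i = y i) ->
  \sum_j ridge_coef mu feat c j ^+ 2 <= coef_weight * \sum_i y i ^+ 2.
Proof.
move=> H; apply: le_trans (ridge_coef_bound t_gt0 mu_gt0 (M := M) _ H) _.
  by move=> j i; exact: F_le.
by rewrite /coef_weight -!mulrA [_ * (t ^+ 2)^-1]mulrC.
Qed.

Lemma bias_bound_ge : \sum_j (ridge_coef mu feat cf j - fc j) ^+ 2 <= bias_bound s.
Proof.
rewrite /bias_bound.
have Z0 : 0 <= \sum_j a j * resid_mean j s ^+ 2.
  by apply: sumr_ge0 => j _; rewrite mulr_ge0 ?sqr_ge0// ltW.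
have S0 : 0 <= \sum_j (fc j - a j * fc j) ^+ 2 by apply: sumr_ge0 => j _; exact: sqr_ge0.
case: bad_or => [[b0 Q]|b1].
  have H := ridge_bias n_gt0 t_gt0 mu_gt0 fc (le_trans Q eta_le) cf_sol.
  rewrite b0 mulr0 addr0 [X in _ <= _ + _ * X]big1 ?mulr0 ?addr0; last first.
    by move=> i _; rewrite mul0r.
  apply: (@le_trans _ _ (\sum_j (2 * (ridge_coef mu feat cf j - a j * fc j) ^+ 2
     + 2 * (fc j - a j * fc j) ^+ 2))).
    apply: ler_sum => j _.
    rewrite (_ : _ - fc j = (ridge_coef mu feat cf j - a j * fc j) + - (fc j - a j * fc j)); last by ring.
    by apply: le_trans (sqr_add2_le _ _) _; rewrite sqrrN.
  rewrite sum_lin2 lerD2r.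
  have -> : 8 = 2 * 4 :> R by ring.
  rewrite -mulrA ler_wpM2l//; apply: le_trans H _; rewrite ler_wpM2l//.
rewrite b1 mulr1.
apply: (@le_trans _ _ (2 * coef_weight * (\sum_i 1 * f0 (tnth s i).1 ^+ 2) + 2 * \sum_j fc j ^+ 2)); last first.
  by rewrite lerDr addr_ge0// mulr_ge0.
apply: (@le_trans _ _ (\sum_j (2 * ridge_coef mu feat cf j ^+ 2 + 2 * fc j ^+ 2))).
  apply: ler_sum => j _; apply: le_trans (sqr_add2_le _ _) _; by rewrite sqrrN.
rewrite sum_lin2 lerD2r -mulrA; apply: ler_wpM2l => //.
apply: le_trans (coef_le cf_sol) _; apply: ler_wpM2l => //.
by under [leRHS]eq_bigr do rewrite mul1r.
Qed.

Lemma noise_bound_ge :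
  \sum_j (ridge_coef mu feat ce j - a j * noise_mean j s) ^+ 2 <= noise_bound s.
Proof.
rewrite /noise_bound.
have U0 : 0 <= \sum_j a j * noise_mean j s ^+ 2.
  by apply: sumr_ge0 => j _; rewrite mulr_ge0 ?sqr_ge0// ltW.
have m0 : 0 < m%:R :> R by rewrite ltr0n.
case: bad_or => [[b0 Q]|b1].
  have H := ridge_noise n_gt0 t_gt0 mu_gt0 (le_trans Q eta_le) ce_sol.
  rewrite b0 [X in _ + X](_ : _ = 0) ?addr0; last first.
    by rewrite big1 ?mulr0// => i _; rewrite mul0r.
  apply: le_trans H _; rewrite ler_wpM2r//.
  apply: le_trans (_ : 4 * (4 * m%:R)^-1 <= _); first by rewrite ler_wpM2l.
  by rewrite invfM mulrA mulfV ?mul1r// pnatr_eq0.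
rewrite b1; pose E := \sum_i (tnth s i).2 ^+ 2.
rewrite [X in _ <= _ + _ * X](_ : _ = E); last by apply: eq_bigr => i _; rewrite mul1r.
have E0 : 0 <= E by apply: sumr_ge0 => i _; exact: sqr_ge0.
have Uj j : noise_mean j s ^+ 2 <= M ^+ 2 / n%:R * E.
  rewrite /noise_mean exprMn.
  apply: (@le_trans _ _ (n%:R^-1 ^+ 2 * ((\sum_i feat j i ^+ 2) * E))).
    by apply: ler_wpM2l; [exact: sqr_ge0|exact: Cauchy_Schwarz_sum].
  have : \sum_i feat j i ^+ 2 <= n%:R * M ^+ 2.
    rewrite mulr_natl -[n in _ *+ n]card_ord -sumr_const; apply: ler_sum => i _.
    rewrite -[feat j i ^+ 2]real_normK ?num_real//.
    by rewrite lerXn2r ?nnegrE// ?F_le// (le_trans _ (F_le j (tnth s i).1)).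
  move=> H; apply: le_trans (_ : _ <= n%:R^-1 ^+ 2 * ((n%:R * M ^+ 2) * E)) _.
    by apply: ler_wpM2l; [exact: sqr_ge0|exact: ler_wpM2r].
  rewrite le_eqVlt; apply/orP; left; apply/eqP; field.
  by rewrite pnatr_eq0 -lt0n.
apply: le_trans (_ : _ <= (2 * coef_weight + 2 * (M ^+ 2 * D / n%:R)) * E) _; last first.
  by rewrite lerDr mulr_ge0// invr_ge0 ltW.
apply: (@le_trans _ _ (\sum_j (2 * ridge_coef mu feat ce j ^+ 2 + 2 * (a j * (M ^+ 2 / n%:R * E))))).
  apply: ler_sum => j _; apply: le_trans (sqr_add2_le _ _) _; rewrite sqrrN lerD2l.
  apply: ler_wpM2l => //; rewrite exprMn; apply: ler_pM; rewrite ?sqr_ge0//.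
  by rewrite expr2 ler_piMl// ltW.
rewrite sum_lin2 [leRHS]mulrDl; apply: lerD.
  rewrite -mulrA; apply: ler_wpM2l => //; exact: coef_le ce_sol.
rewrite -mulr_suml -/D le_eqVlt; apply/orP; left; apply/eqP; ring.
Qed.

End deterministic.

Lemma mean_sqr_le (x : 'I_m -> R) : (m%:R^-1 * \sum_k x k) ^+ 2 <= m%:R^-1 * \sum_k x k ^+ 2.
Proof.
have m0 : 0 < m%:R :> R by rewrite ltr0n.
have := Cauchy_Schwarz_sum (fun=> 1) x.
under eq_bigr do rewrite mul1r.
under [X in _ <= X * _]eq_bigr do rewrite expr1n.
rewrite sumr_const card_ord => H.
rewrite exprMn expr2 -mulrA; apply: ler_wpM2l; first by rewrite invr_ge0 ltW.
by rewrite ler_pdivrMl.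
Qed.

Lemma risk_bound_ge (w : m.-tuple sample) (cf ce : 'I_m -> 'I_n -> R) :
  (forall k i, \sum_i' emp_kernel mu (fun j i => feature j (tnth (tnth w k) i)) i i' * cf k i'
     + t * cf k i = f0 (tnth (tnth w k) i).1) ->
  (forall k i, \sum_i' emp_kernel mu (fun j i => feature j (tnth (tnth w k) i)) i i' * ce k i'
     + t * ce k i = (tnth (tnth w k) i).2) ->
  \sum_j (m%:R^-1 * (\sum_k ridge_coef mu (fun j i => feature j (tnth (tnth w k) i))
             (fun i => cf k i + ce k i) j) - fc j) ^+ 2 <= risk_bound w.
Proof.
move=> Hf He.
have m0 : m%:R != 0 :> R by rewrite pnatr_eq0 -lt0n.
pose th c k := ridge_coef mu (fun j i => feature j (tnth (tnth w k) i)) (c k).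
have addE k j : ridge_coef mu (fun j i => feature j (tnth (tnth w k) i))
    (fun i => cf k i + ce k i) j = th cf k j + th ce k j.
  rewrite /th /ridge_coef -mulrDr; congr (_ * _); rewrite -big_split/=.
  by apply: eq_bigr => i _; rewrite mulrDl.
pose A j := m%:R^-1 * \sum_k (th cf k j - fc j).
pose B j := m%:R^-1 * \sum_k (th ce k j - a j * noise_mean j (tnth w k)).
pose C j := a j * (m%:R^-1 * \sum_k noise_mean j (tnth w k)).
apply: (@le_trans _ _ (\sum_j 3 * (A j ^+ 2 + B j ^+ 2 + C j ^+ 2))).
  apply: ler_sum => j _.
  rewrite (_ : _ - fc j = A j + B j + C j); first exact: sqr_add3_le.
  rewrite /A /B /C; under eq_bigr do rewrite addE.
  rewrite big_split/= sumrB sumrB sumr_const card_ord -[fc j *+ m]mulr_natl.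
  rewrite -(mulr_sumr _ _ (fun k => noise_mean j (tnth w k)) (a j)).
  set x := \sum_k th cf k j; set y := \sum_k th ce k j; set z := \sum_k noise_mean _ _.
  by field.
rewrite sum_add3; apply: ler_wpM2l => //; apply: lerD; first apply: lerD.
- apply: (@le_trans _ _ (\sum_j m%:R^-1 * \sum_k (th cf k j - fc j) ^+ 2)).
    by apply: ler_sum => j _; exact: mean_sqr_le.
  rewrite -mulr_sumr; apply: ler_wpM2l; first by rewrite invr_ge0.
  rewrite exchange_big/=; apply: ler_sum => k _.
  exact: bias_bound_ge (Hf k).
- apply: (@le_trans _ _ (\sum_j m%:R^-1 * \sum_k (th ce k j - a j * noise_mean j (tnth w k)) ^+ 2)).
    by apply: ler_sum => j _; exact: mean_sqr_le.
  rewrite -mulr_sumr; apply: ler_wpM2l; first by rewrite invr_ge0.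
  rewrite exchange_big/=; apply: ler_sum => k _.
  exact: noise_bound_ge (He k).
- by apply: ler_sum => j _; rewrite /C exprMn.
Qed.

End box_risk.

(** A variance is at most a second moment. *)
Lemma centered_second_moment {d} {T : measurableType d} {R : realType}
    (P : probability T R) (g : T -> R) (c v : R) :
  measurable_fun [set: T] g -> (\int[P]_x (g x - c)%:E = 0)%E ->
  (\int[P]_x (g x ^+ 2)%:E <= v%:E)%E -> (\int[P]_x ((g x - c) ^+ 2)%:E <= v%:E)%E.
Proof.
move=> mg g0 g2.
have g2fin : (\int[P]_x (g x ^+ 2)%:E < +oo)%E by exact: le_lt_trans g2 (ltry v).
have gI : P.-integrable [set: T] (fun x => (g x)%:E) by exact: sq_integrable.
have cI : P.-integrable [set: T] (fun=> (1 : R)%:E) by exact: finite_measure_integrable_cst.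
have [V VE] : exists V, (\int[P]_x (g x ^+ 2)%:E = V%:E)%E.
  exists (fine (\int[P]_x (g x ^+ 2)%:E)%E); rewrite fineK// ge0_fin_numE//.
  by apply: integral_ge0 => x _; rewrite lee_fin sqr_ge0.
have gcI : P.-integrable [set: T] (fun x => (g x - c)%:E).
  have := integrableB measurableT gI (integrableZl measurableT c cI).
  by apply: eq_integrable => // x _; rewrite /= mulr1.
have g2I : P.-integrable [set: T] (fun x => (g x ^+ 2)%:E).
  apply/integrableP; split; first exact/measurable_EFinP/measurable_funX.
  by under eq_integral do rewrite gee0_abs ?lee_fin ?sqr_ge0//.
have [_ H] := int_affine 1 (- (2 * c)) (- c ^+ 2) g2I gcI VE g0.
rewrite (_ : (fun x => _) = fun x => (1 * g x ^+ 2 + - (2 * c) * (g x - c) + - c ^+ 2)%:E); last first.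
  by apply/funext => x; congr EFin; ring.
rewrite H lee_fin; move: g2; rewrite VE lee_fin => Vv.
by rewrite mul1r mulr0 addr0; apply: le_trans Vv; rewrite gerDl oppr_le0 sqr_ge0.
Qed.

Lemma mean_second_moment {d} {T : measurableType d} {R : realType}
    (Q : probability T R) (g : T -> R) (v : R) n : (0 < n)%N ->
  measurable_fun [set: T] g -> (\int[Q]_x (g x)%:E = 0)%E ->
  (\int[Q]_x (g x ^+ 2)%:E <= v%:E)%E ->
  (\int[prod_prob (fun _ : 'I_n => Q)]_s (n%:R^-1 * \sum_(i < n) g (tnth s i))%:E = 0)%E /\
  (\int[prod_prob (fun _ : 'I_n => Q)]_s ((n%:R^-1 * \sum_(i < n) g (tnth s i)) ^+ 2)%:E
    <= (v / n%:R)%:E)%E.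
Proof.
move=> n0 mg g0 g2.
have gI : Q.-integrable [set: T] (fun x => (g x)%:E).
  by apply: sq_integrable => //; exact: le_lt_trans g2 (ltry v).
have [] := @integral_sum_sqr _ _ _ n (fun=> Q) (fun _ x => n%:R^-1 * g x)
   (fun=> n%:R^-1 ^+ 2 * v) 0.
- by move=> i; exact: measurable_funM.
- move=> i; under eq_integral do rewrite EFinM.
  by rewrite (integralZl measurableT gI) g0 mule0.
- move=> i; under eq_integral do rewrite exprMn.
  by rewrite EFinM; apply: int_scale_le; [exact: measurable_funX|move=> x; exact: sqr_ge0|exact: sqr_ge0|].
move=> E1 E2; split; first by under eq_integral do rewrite mulr_sumr.
under eq_integral do rewrite mulr_sumr -[\sum_(i < n) _]add0r.
apply: le_trans E2 _; rewrite lee_fin expr0n/= add0r sumr_const card_ord.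
rewrite -[_ *+ n]mulr_natl le_eqVlt; apply/orP; left; apply/eqP; field.
by rewrite pnatr_eq0 -lt0n.
Qed.

Section box_risk_integral.
Context {R : realType} {d} {T : measurableType d} {J : finType}.
Variables (P : probability T R) (Nz : probability R R).
Variables (F : J -> T -> R) (M : R) (mu : J -> R) (t : R) (n m : nat).
Variables (f0 : T -> R) (fc : J -> R).
Hypothesis n_gt0 : (0 < n)%N.
Hypothesis m_gt0 : (0 < m)%N.
Hypothesis t_gt0 : 0 < t.
Hypothesis mu_gt0 : forall j, 0 < mu j.
Hypothesis mF : forall j, measurable_fun [set: T] (F j).
Hypothesis F_le : forall j x, `|F j x| <= M.
Hypothesis mf0 : measurable_fun [set: T] f0.
Hypothesis F_on : forall j k, (\int[P]_x (F j x * F k x)%:E = ((j == k)%:R)%:E)%E.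
Variables (v2 v4 R2 tail F1 : R).
Hypothesis noise0 : (\int[Nz]_e e%:E = 0)%E.
Hypothesis noise2 : (\int[Nz]_e (e ^+ 2)%:E <= v2%:E)%E.
Hypothesis noise4 : (\int[Nz]_e (e ^+ 4)%:E <= v4%:E)%E.

Let lam := t / n%:R.
Let a := shrink mu lam.
Let D := \sum_j a j.
Hypothesis D_gt0 : 0 < D.
Let S0 := \sum_j (fc j - a j * fc j) ^+ 2.

Hypothesis resid0 : forall j,
  (\int[P]_x (F j x * resid F mu t n f0 fc x - (fc j - a j * fc j))%:E = 0)%E.
Hypothesis resid2 : (\int[P]_x (resid F mu t n f0 fc x ^+ 2)%:E <= R2%:E)%E.
Hypothesis tail2 : (\int[P]_x ((f0 x - \sum_j fc j * F j x) ^+ 2)%:E <= tail%:E)%E.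
Hypothesis sumF : forall x, `|\sum_j fc j * F j x| <= F1.

Let lam_gt0 : 0 < lam. Proof. by rewrite divr_gt0// ltr0n. Qed.
Let a_gt0 j : 0 < a j. Proof. exact: shrink_gt0. Qed.
Let a_le1 j : a j <= 1. Proof. exact: shrink_le1. Qed.

Local Notation pair := (T * R)%type.
Local Notation sample := (n.-tuple pair).

Definition pair_law : probability pair R := (P \x Nz)%E.

Lemma pair_law_fst B : measurable B -> pair_law (fst @^-1` B) = P B.
Proof.
move=> mB; have -> : fst @^-1` B = B `*` [set: R] :> set pair.
  by apply/seteqP; split => [[x y]//=|[x y] []].
apply: etrans (product_measure1E _ _ _ _) _ => //.
by rewrite [X in (_ * X)%E](_ : _ = 1%E) ?mule1//; exact: (probability_setT Nz).
Qed.

Lemma pair_law_snd B : measurable B -> pair_law (snd @^-1` B) = Nz B.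
Proof.
move=> mB; have -> : snd @^-1` B = [set: T] `*` B :> set pair.
  by apply/seteqP; split => [[x y]//=|[x y] []].
apply: etrans (product_measure1E _ _ _ _) _ => //.
by rewrite [X in (X * _)%E](_ : _ = 1%E) ?mul1e//; exact: (probability_setT P).
Qed.

Let Pn : probability sample R := prod_prob (fun _ : 'I_n => pair_law).

Let mfst : measurable_fun [set: pair] (fst : pair -> T). Proof. exact: measurable_fst. Qed.
Let msnd : measurable_fun [set: pair] (snd : pair -> R). Proof. exact: measurable_snd. Qed.

Let mfeat j : measurable_fun [set: pair] (feature F j).
Proof. exact: (measurableT_comp (mF j) mfst). Qed.

Let feat_sqr j p : feature F j p ^+ 2 <= M ^+ 2.
Proof.
rewrite -[feature F j p ^+ 2]real_normK ?num_real//.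
by rewrite lerXn2r ?nnegrE// ?F_le// (le_trans _ (F_le j p.1)).
Qed.

Let mresid : measurable_fun [set: T] (resid F mu t n f0 fc).
Proof.
by apply: measurable_funB => //; apply: measurable_sum => k; apply: measurable_funM.
Qed.

Lemma resid_mean_second j :
  (\int[Pn]_s (resid_mean F mu t f0 fc j s ^+ 2)%:E <= (M ^+ 2 * R2 / n%:R)%:E)%E.
Proof.
pose g (p : pair) := F j p.1 * resid F mu t n f0 fc p.1 - (fc j - a j * fc j).
have mG : measurable_fun [set: T] (fun x => F j x * resid F mu t n f0 fc x) by exact: measurable_funM.
have mg1 : measurable_fun [set: T] (fun x => F j x * resid F mu t n f0 fc x - (fc j - a j * fc j)).
  exact: measurable_funB.
have mg : measurable_fun [set: pair] g by exact: (measurableT_comp mg1 mfst).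
have E (s : sample) : resid_mean F mu t f0 fc j s = n%:R^-1 * \sum_i g (tnth s i).
  have -> : \sum_i g (tnth s i) = \sum_i F j (tnth s i).1 * resid F mu t n f0 fc (tnth s i).1
     - n%:R * (fc j - a j * fc j).
    by rewrite /g sumrB; congr (_ - _); rewrite [LHS]sumr_const card_ord [in RHS]mulr_natl.
  by rewrite mulrBr [X in _ = _ - X]mulrA mulVf ?mul1r// pnatr_eq0 -lt0n.
under eq_integral do rewrite E.
suff [g0 g2] : (\int[pair_law]_x (g x)%:E = 0)%E /\
    (\int[pair_law]_x (g x ^+ 2)%:E <= (M ^+ 2 * R2)%:E)%E.
  by have [_] := mean_second_moment n_gt0 mg g0 g2.
split.
  rewrite (integral_law (N := P) mfst pair_law_fst (f := fun x => (F j x * resid F mu t n f0 fc x - (fc j - a j * fc j))%:E))//.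
  exact/measurable_EFinP.
rewrite (ge0_integral_law (N := P) mfst pair_law_fst (f := fun x => ((F j x * resid F mu t n f0 fc x - (fc j - a j * fc j)) ^+ 2)%:E)); last 2 first.
- exact/measurable_EFinP/measurable_funX.
- by move=> x; rewrite lee_fin sqr_ge0.
apply: centered_second_moment => //.
apply: (@int_le _ _ _ _ _ (fun x => M ^+ 2 * resid F mu t n f0 fc x ^+ 2)).
- by move=> x; exact: sqr_ge0.
- by move=> x; rewrite exprMn; apply: ler_wpM2r; [exact: sqr_ge0|exact: (feat_sqr j (x, 0))].
rewrite EFinM; apply: int_scale_le => //; [exact: measurable_funX|move=> x; exact: sqr_ge0|exact: sqr_ge0].
Qed.

Lemma noise_mean_second j :
  (\int[Pn]_s (noise_mean F j s)%:E = 0)%E /\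
  (\int[Pn]_s (noise_mean F j s ^+ 2)%:E <= (M ^+ 2 * v2 / n%:R)%:E)%E.
Proof.
pose g (p : pair) := feature F j p * p.2.
have mg : measurable_fun [set: pair] g by apply: measurable_funM.
have g2 : (\int[pair_law]_p (g p ^+ 2)%:E <= (M ^+ 2 * v2)%:E)%E.
  apply: (@int_le _ _ _ _ _ (fun p : pair => M ^+ 2 * p.2 ^+ 2)).
  - by move=> x; exact: sqr_ge0.
  - by move=> p; rewrite exprMn; apply: ler_wpM2r; [exact: sqr_ge0|exact: feat_sqr].
  rewrite EFinM; apply: int_scale_le => //; [exact: measurable_funX|move=> x; exact: sqr_ge0|exact: sqr_ge0|].
  rewrite (ge0_integral_law (N := Nz) msnd pair_law_snd (f := fun e => (e ^+ 2)%:E))//.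
  - exact/measurable_EFinP/measurable_funX.
  - by move=> x; rewrite lee_fin sqr_ge0.
have gI : pair_law.-integrable [set: pair] (fun p => (g p)%:E).
  by apply: sq_integrable => //; exact: le_lt_trans g2 (ltry _).
suff g0 : (\int[pair_law]_p (g p)%:E = 0)%E by exact: (mean_second_moment n_gt0 mg g0 g2).
have eI : Nz.-integrable [set: R] (fun e : R => e%:E).
  apply: sq_integrable => //; exact: le_lt_trans noise2 (ltry _).
rewrite /pair_law -(integral12_prod_meas1 gI)/fubini_F/=.
rewrite (_ : (fun x : T => _) = fun=> 0%E) ?integral0//.
apply/funext => x; rewrite /g/feature/=.
under eq_integral do rewrite EFinM.
by rewrite (integralZl measurableT eI) noise0 mule0.
Qed.

Local Notation bad := (bad_gram F mu t m : sample -> R).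

Let mhs : measurable_fun [set: sample] (@hs_sample R _ pair J (feature F) a n).
Proof. exact: measurable_hs_sample. Qed.

Lemma measurable_bad : measurable_fun [set: sample] bad.
Proof.
apply: measurable_indic.
have := mhs measurableT (measurable_itv `](4 * m%:R)^-1 : R, +oo[).
rewrite setTI; congr measurable; apply/seteqP; split => s /=; rewrite in_itv/= andbT//.
Qed.

Lemma bad_ge0 s : 0 <= bad s.
Proof. by rewrite /bad_gram indicE. Qed.

Lemma bad_sqr s : bad s ^+ 2 = bad s.
Proof. by rewrite /bad_gram indicE; case: (_ \in _); rewrite ?expr1n ?expr0n. Qed.

Definition bad_prob p := (4 * m%:R) ^+ p * (gram_cst M p * (D ^+ 2 / n%:R) ^+ p).

(** The inequality of Markov for the power [p] of the Hilbert-Schmidt norm. *)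
Lemma bad_le p : (\int[Pn]_s (bad s)%:E <= (bad_prob p)%:E)%E.
Proof.
have m4 : 0 < 4 * m%:R :> R by rewrite mulr_gt0 ?ltr0n.
have hs0 (s : sample) : 0 <= hs_sample (feature F) a s by exact: hs_sample_ge0.
apply: (@int_le _ _ _ _ _ (fun s => (4 * m%:R) ^+ p * hs_sample (feature F) a s ^+ p)).
- exact: bad_ge0.
- move=> s; rewrite -exprMn /bad_gram indicE.
  have [|_] := boolP (s \in _); last by rewrite exprn_ge0// mulr_ge0// ltW.
  rewrite inE/= => H; apply: exprn_ege1; rewrite -ler_pdivrMl//.
  by rewrite mulr1 ltW.
rewrite EFinM; apply: int_scale_le.
- exact: measurable_funX.
- by move=> s; exact: exprn_ge0.
- by rewrite exprn_ge0// ltW.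
apply: hs_moment_le => //.
- by move=> j x; exact: F_le.
- move=> j k; rewrite -F_on.
  rewrite (integral_law (N := P) mfst pair_law_fst (f := fun x => (F j x * F k x)%:E))//.
  by apply/measurable_EFinP; exact: measurable_funM.
Qed.

Let mcoord2 (i : 'I_n) k : measurable_fun [set: sample] (fun s => (tnth s i).2 ^+ k).
Proof.
by apply: measurable_funX; exact: (measurableT_comp msnd (measurable_tnth i)).
Qed.

(** The indicator and the squared error are separated by
    [2 * b * e^2 <= tau * b + e^4 / tau], where [b^2 = b]. *)
Lemma bad_noise p (tau : R) i : 0 < tau ->
  (\int[Pn]_s (bad s * (tnth s i).2 ^+ 2)%:E <=
     (2^-1 * (tau * bad_prob p + tau^-1 * v4))%:E)%E.
Proof.
move=> tau0.
apply: (@int_le _ _ _ _ _ (fun s : sample => 2^-1 * (tau * bad s + tau^-1 * (tnth s i).2 ^+ 4))).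
- by move=> s; rewrite mulr_ge0 ?bad_ge0 ?sqr_ge0.
- move=> s; rewrite -[X in tau * X]bad_sqr.
  set b := bad s; set e := (tnth s i).2.
  rewrite -subr_ge0 (_ : _ - _ = (2 * tau)^-1 * ((tau * b - e ^+ 2) ^+ 2)).
    by rewrite mulr_ge0 ?sqr_ge0// invr_ge0 mulr_ge0// ltW.
  by field; rewrite gt_eqF.
have e40 (s : sample) : 0 <= (tnth s i).2 ^+ 4 by rewrite (exprM _ 2 2) sqr_ge0.
have mb := measurable_bad.
rewrite EFinM; apply: int_scale_le => //.
- apply: measurable_funD; apply: measurable_funM => //; exact: mcoord2.
- by move=> s; rewrite addr_ge0// mulr_ge0 ?bad_ge0 ?invr_ge0// ltW.
rewrite EFinD; apply: int_add_le.
- exact: measurable_funM.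
- by apply: measurable_funM => //; exact: mcoord2.
- by move=> s; rewrite mulr_ge0 ?bad_ge0// ltW.
- by move=> s; rewrite mulr_ge0// invr_ge0 ltW.
- by rewrite EFinM; apply: int_scale_le => //; [exact: ltW|exact: bad_le].
rewrite EFinM; apply: int_scale_le => //.
  by rewrite invr_ge0 ltW.
have e4 (p0 : pair) : (0 <= (p0.2 ^+ 4)%:E)%E by rewrite lee_fin (exprM _ 2 2) sqr_ge0.
rewrite (ge0_integral_tnth (fun _ : 'I_n => pair_law) i (G := fun p => (p.2 ^+ 4)%:E))//; last first.
  by apply/measurable_EFinP; exact: measurable_funX.
rewrite (ge0_integral_law (N := Nz) msnd pair_law_snd (f := fun e => (e ^+ 4)%:E))//.
- exact/measurable_EFinP/measurable_funX.
- by move=> e; rewrite lee_fin (exprM _ 2 2) sqr_ge0.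
Qed.

(** The signal is only square-integrable. Its part in the box is bounded by the
    absolute sum of the coefficients, and the rest is small in mean square,
    without regard to the event. *)
Lemma bad_signal p i :
  (\int[Pn]_s (bad s * f0 (tnth s i).1 ^+ 2)%:E <=
     (2 * F1 ^+ 2 * bad_prob p + 2 * tail)%:E)%E.
Proof.
pose r x := f0 x - \sum_j fc j * F j x.
have mr : measurable_fun [set: T] r.
  by apply: measurable_funB => //; apply: measurable_sum => k; apply: measurable_funM.
have mb := measurable_bad.
have mri : measurable_fun [set: sample] (fun s => r (tnth s i).1).
  exact: (measurableT_comp mr (measurableT_comp mfst (measurable_tnth i))).
apply: (@int_le _ _ _ _ _ (fun s : sample => 2 * F1 ^+ 2 * bad s + 2 * r (tnth s i).1 ^+ 2)).
- by move=> s; rewrite mulr_ge0 ?bad_ge0 ?sqr_ge0.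
- move=> s; set x := (tnth s i).1.
  have H : f0 x ^+ 2 <= 2 * F1 ^+ 2 + 2 * r x ^+ 2.
    rewrite (_ : f0 x = (\sum_j fc j * F j x) + r x); last by rewrite /r addrC subrK.
    apply: le_trans (sqr_add2_le _ _) _; rewrite lerD2r ler_wpM2l//.
    rewrite -[leLHS]real_normK ?num_real// lerXn2r ?nnegrE//.
    exact: le_trans (sumF x).
  apply: le_trans (_ : bad s * (2 * F1 ^+ 2 + 2 * r x ^+ 2) <= _).
    by apply: ler_wpM2l => //; exact: bad_ge0.
  rewrite mulrDr [bad s * _]mulrC lerD2l.
  rewrite -[leRHS]mul1r; apply: ler_wpM2r; first by rewrite mulr_ge0 ?sqr_ge0.
  by rewrite /bad_gram indicE; case: (_ \in _).
have F10 : 0 <= 2 * F1 ^+ 2 by rewrite mulr_ge0 ?sqr_ge0.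
rewrite EFinD; apply: int_add_le.
- exact: measurable_funM.
- by apply: measurable_funM => //; exact: measurable_funX.
- by move=> s; rewrite mulr_ge0 ?bad_ge0.
- by move=> s; rewrite mulr_ge0 ?sqr_ge0.
- by rewrite EFinM; apply: int_scale_le => //; exact: bad_le.
rewrite EFinM; apply: int_scale_le => //; [exact: measurable_funX|by move=> s; exact: sqr_ge0|].
have r2 (p0 : pair) : (0 <= (r p0.1 ^+ 2)%:E)%E by rewrite lee_fin sqr_ge0.
rewrite (ge0_integral_tnth (fun _ : 'I_n => pair_law) i (G := fun p => (r p.1 ^+ 2)%:E))//; last first.
  by apply/measurable_EFinP; apply: measurable_funX; exact: (measurableT_comp mr mfst).
rewrite (ge0_integral_law (N := P) mfst pair_law_fst (f := fun x => (r x ^+ 2)%:E))//.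
- exact/measurable_EFinP/measurable_funX.
- by move=> e; rewrite lee_fin sqr_ge0.
Qed.

Let W := coef_weight M mu t n.
Let SF := \sum_j fc j ^+ 2.

Definition bias_val p :=
  8 * (\sum_j a j * (M ^+ 2 * R2 / n%:R)) + 2 * S0 +
  (2 * W * (\sum_(i < n) (2 * F1 ^+ 2 * bad_prob p + 2 * tail)) + 2 * SF * bad_prob p).

Definition noise_val p tau :=
  m%:R^-1 * (\sum_j a j * (M ^+ 2 * v2 / n%:R)) +
  (2 * W + 2 * (M ^+ 2 * D / n%:R)) *
    (\sum_(i < n) 2^-1 * (tau * bad_prob p + tau^-1 * v4)).

Definition risk_val p tau :=
  3 * (m%:R^-1 * (\sum_(k < m) bias_val p) + m%:R^-1 * (\sum_(k < m) noise_val p tau)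
       + \sum_j a j ^+ 2 * (M ^+ 2 * v2 / n%:R / m%:R)).

Let W_ge0 : 0 <= W.
Proof.
apply: mulr_ge0; first by apply: sumr_ge0 => j _; exact: sqr_ge0.
by apply: divr_ge0; [apply: mulr_ge0; [exact: sqr_ge0|exact: ler0n]|exact: sqr_ge0].
Qed.

Let SF_ge0 : 0 <= SF. Proof. by apply: sumr_ge0 => j _; exact: sqr_ge0. Qed.
Let S0_ge0 : 0 <= S0. Proof. by apply: sumr_ge0 => j _; exact: sqr_ge0. Qed.

Let mresid_mean j : measurable_fun [set: sample] (resid_mean F mu t f0 fc j : sample -> R).
Proof.
apply: measurable_funB => //; apply: measurable_funM => //; apply: measurable_sum => i.
apply: measurable_funM; first exact: (measurableT_comp (mfeat j) (measurable_tnth i)).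
exact: (measurableT_comp mresid (measurableT_comp mfst (measurable_tnth i))).
Qed.

Let mnoise_mean j : measurable_fun [set: sample] (noise_mean F j : sample -> R).
Proof.
apply: measurable_funM => //; apply: measurable_sum => i.
apply: measurable_funM; first exact: (measurableT_comp (mfeat j) (measurable_tnth i)).
exact: (measurableT_comp msnd (measurable_tnth i)).
Qed.

Let mbad_signal (i : 'I_n) : measurable_fun [set: sample] (fun s => bad s * f0 (tnth s i).1 ^+ 2).
Proof.
apply: measurable_funM; first exact: measurable_bad.
by apply: measurable_funX; exact: (measurableT_comp mf0 (measurableT_comp mfst (measurable_tnth i))).
Qed.

Let mbad_noise (i : 'I_n) : measurable_fun [set: sample] (fun s => bad s * (tnth s i).2 ^+ 2).
Proof. by apply: measurable_funM; [exact: measurable_bad|exact: mcoord2]. Qed.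

Let weighted_ge0 (z : J -> sample -> R) s : 0 <= \sum_j a j * z j s ^+ 2.
Proof. by apply: sumr_ge0 => j _; rewrite mulr_ge0 ?sqr_ge0// ltW. Qed.

Let mweighted (z : J -> sample -> R) : (forall j, measurable_fun [set: sample] (z j)) ->
  measurable_fun [set: sample] (fun s => \sum_j a j * z j s ^+ 2).
Proof.
move=> mz; apply: measurable_sum => j; apply: measurable_funM => //.
exact: measurable_funX.
Qed.

Let bad_sum_ge0 (y : 'I_n -> sample -> R) s : 0 <= \sum_i bad s * y i s ^+ 2.
Proof. by apply: sumr_ge0 => i _; rewrite mulr_ge0 ?sqr_ge0 ?bad_ge0. Qed.

Lemma measurable_bias_bound :
  measurable_fun [set: sample] (bias_bound F M mu t m f0 fc : sample -> R).
Proof.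
apply: measurable_funD; first apply: measurable_funD => //.
  by apply: measurable_funM => //; exact: mweighted.
apply: measurable_funD; apply: measurable_funM => //; last exact: measurable_bad.
by apply: measurable_sum => i; exact: mbad_signal.
Qed.

Lemma measurable_noise_bound :
  measurable_fun [set: sample] (noise_bound F M mu t m : sample -> R).
Proof.
apply: measurable_funD; apply: measurable_funM => //; first exact: mweighted.
by apply: measurable_sum => i; exact: mbad_noise.
Qed.

Lemma bias_bound_ge0 (s : sample) : 0 <= bias_bound F M mu t m f0 fc s.
Proof.
apply: addr_ge0; first apply: addr_ge0.
- by apply: mulr_ge0 => //; exact: (weighted_ge0 (fun j => resid_mean F mu t f0 fc j)).
- exact: mulr_ge0.
apply: addr_ge0.
- apply: mulr_ge0; first exact: mulr_ge0.
  exact: (bad_sum_ge0 (fun i s => f0 (tnth s i).1)).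
- by apply: mulr_ge0; [exact: mulr_ge0|exact: bad_ge0].
Qed.

Lemma noise_bound_ge0 (s : sample) : 0 <= noise_bound F M mu t m s.
Proof.
have MD : 0 <= 2 * W + 2 * (M ^+ 2 * D / n%:R).
  apply: addr_ge0; first exact: mulr_ge0.
  apply: mulr_ge0 => //; apply: divr_ge0 => //.
  by apply: mulr_ge0; [exact: sqr_ge0|exact: ltW].
apply: addr_ge0.
- apply: mulr_ge0; first by rewrite invr_ge0.
  exact: (weighted_ge0 (fun j => noise_mean F j)).
- by apply: mulr_ge0 => //; exact: (bad_sum_ge0 (fun i s => (tnth s i).2)).
Qed.

Lemma bias_bound_int p :
  (\int[Pn]_s (bias_bound F M mu t m f0 fc s)%:E <= (bias_val p)%:E)%E.
Proof.
rewrite /bias_bound /bias_val EFinD; apply: int_add_le.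
- apply: measurable_funD => //; apply: measurable_funM => //; exact: mweighted.
- apply: measurable_funD; apply: measurable_funM => //; last exact: measurable_bad.
  by apply: measurable_sum => i; exact: mbad_signal.
- move=> s; apply: addr_ge0; last exact: mulr_ge0.
  by apply: mulr_ge0 => //; exact: (weighted_ge0 (fun j => resid_mean F mu t f0 fc j)).
- move=> s; apply: addr_ge0.
    apply: mulr_ge0; first exact: mulr_ge0.
    exact: (bad_sum_ge0 (fun i s => f0 (tnth s i).1)).
  by apply: mulr_ge0; [exact: mulr_ge0|exact: bad_ge0].
- rewrite EFinD; apply: int_add_le.
  + by apply: measurable_funM => //; exact: mweighted.
  + exact: measurable_cst.
  + by move=> s; apply: mulr_ge0 => //; exact: (weighted_ge0 (fun j => resid_mean F mu t f0 fc j)).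
  + by move=> s; exact: mulr_ge0.
  + rewrite EFinM; apply: int_scale_le => //.
    * exact: mweighted.
    apply: int_sum_le => j.
    * by apply: measurable_funM => //; exact: measurable_funX.
    * by move=> s; rewrite mulr_ge0 ?sqr_ge0// ltW.
    rewrite EFinM; apply: int_scale_le => //.
    * exact: measurable_funX.
    * by move=> s; exact: sqr_ge0.
    * exact: ltW.
    * exact: resid_mean_second.
  + by rewrite integral_cstP.
rewrite EFinD; apply: int_add_le.
- by apply: measurable_funM => //; apply: measurable_sum => i; exact: mbad_signal.
- by apply: measurable_funM => //; exact: measurable_bad.
- move=> s; apply: mulr_ge0; first exact: mulr_ge0.
  exact: (bad_sum_ge0 (fun i s => f0 (tnth s i).1)).
- by move=> s; apply: mulr_ge0; [exact: mulr_ge0|exact: bad_ge0].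
- rewrite EFinM; apply: int_scale_le.
  + by apply: measurable_sum => i; exact: mbad_signal.
  + exact: (bad_sum_ge0 (fun i s => f0 (tnth s i).1)).
  + exact: mulr_ge0.
  apply: int_sum_le => i; first exact: mbad_signal.
    by move=> s; rewrite mulr_ge0 ?sqr_ge0 ?bad_ge0.
  exact: bad_signal.
- rewrite EFinM; apply: int_scale_le.
  + exact: measurable_bad.
  + exact: bad_ge0.
  + exact: mulr_ge0.
  + exact: bad_le.
Qed.

Lemma noise_bound_int p tau : 0 < tau ->
  (\int[Pn]_s (noise_bound F M mu t m s)%:E <= (noise_val p tau)%:E)%E.
Proof.
move=> tau0.
have MD : 0 <= 2 * W + 2 * (M ^+ 2 * D / n%:R).
  apply: addr_ge0; first exact: mulr_ge0.
  apply: mulr_ge0 => //; apply: divr_ge0 => //.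
  by apply: mulr_ge0; [exact: sqr_ge0|exact: ltW].
have m1 : 0 <= m%:R^-1 :> R by rewrite invr_ge0.
rewrite /noise_bound /noise_val EFinD; apply: int_add_le.
- by apply: measurable_funM => //; exact: mweighted.
- by apply: measurable_funM => //; apply: measurable_sum => i; exact: mbad_noise.
- by move=> s; apply: mulr_ge0 => //; exact: (weighted_ge0 (fun j => noise_mean F j)).
- by move=> s; apply: mulr_ge0 => //; exact: (bad_sum_ge0 (fun i s => (tnth s i).2)).
- rewrite EFinM; apply: int_scale_le => //.
  + exact: mweighted.
  apply: int_sum_le => j.
  + by apply: measurable_funM => //; exact: measurable_funX.
  + by move=> s; rewrite mulr_ge0 ?sqr_ge0// ltW.
  rewrite EFinM; apply: int_scale_le => //.
  + exact: measurable_funX.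
  + by move=> s; exact: sqr_ge0.
  + exact: ltW.
  + by case: (noise_mean_second j).
- rewrite EFinM; apply: int_scale_le => //.
  + by apply: measurable_sum => i; exact: mbad_noise.
  + exact: (bad_sum_ge0 (fun i s => (tnth s i).2)).
  apply: int_sum_le => i; first exact: mbad_noise.
    by move=> s; rewrite mulr_ge0 ?sqr_ge0 ?bad_ge0.
  exact: bad_noise.
Qed.

Let sample_prob : probability (m.-tuple sample) R := prod_prob (fun _ : 'I_m => Pn).

Let mean_ge0 (g : sample -> R) : (forall s, 0 <= g s) ->
  forall w : m.-tuple sample, 0 <= m%:R^-1 * \sum_k g (tnth w k).
Proof.
by move=> g0 w; apply: mulr_ge0; [rewrite invr_ge0|apply: sumr_ge0].
Qed.

Let mmean (g : sample -> R) : measurable_fun [set: sample] g ->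
  measurable_fun [set: m.-tuple sample] (fun w => m%:R^-1 * \sum_k g (tnth w k)).
Proof.
move=> mg; apply: measurable_funM => //; apply: measurable_sum => k.
exact: (measurableT_comp mg (measurable_tnth k)).
Qed.

Let int_mean (g : sample -> R) v : measurable_fun [set: sample] g -> (forall s, 0 <= g s) ->
  (\int[Pn]_s (g s)%:E <= v%:E)%E ->
  (\int[sample_prob]_w (m%:R^-1 * \sum_k g (tnth w k))%:E <= (m%:R^-1 * \sum_(k < m) v)%:E)%E.
Proof.
move=> mg g0 gv; rewrite EFinM; apply: int_scale_le.
- by apply: measurable_sum => k; exact: (measurableT_comp mg (measurable_tnth k)).
- by move=> w; exact: sumr_ge0.
- by rewrite invr_ge0.
apply: int_sum_le => k.
- exact: (measurableT_comp mg (measurable_tnth k)).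
- by move=> w.
rewrite (ge0_integral_tnth (fun _ : 'I_m => Pn) k (G := fun s => (g s)%:E))//.
exact/measurable_EFinP.
Qed.

Lemma measurable_risk_bound :
  measurable_fun [set: m.-tuple sample] (risk_bound F M mu t f0 fc : m.-tuple sample -> R).
Proof.
apply: measurable_funM => //; apply: measurable_funD; first apply: measurable_funD.
- by apply: mmean; exact: measurable_bias_bound.
- by apply: mmean; exact: measurable_noise_bound.
apply: measurable_sum => j; apply: measurable_funM => //; apply: measurable_funX.
exact: mmean.
Qed.

Lemma risk_bound_ge0 (w : m.-tuple sample) : 0 <= risk_bound F M mu t f0 fc w.
Proof.
apply: mulr_ge0 => //; apply: addr_ge0; first apply: addr_ge0.
- by apply: mean_ge0; exact: bias_bound_ge0.
- by apply: mean_ge0; exact: noise_bound_ge0.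
- by apply: sumr_ge0 => j _; apply: mulr_ge0; exact: sqr_ge0.
Qed.

Lemma risk_bound_int p tau : 0 < tau ->
  (\int[sample_prob]_w (risk_bound F M mu t f0 fc w)%:E <= (risk_val p tau)%:E)%E.
Proof.
move=> tau0.
have mlast j : measurable_fun [set: m.-tuple sample]
    (fun w => a j ^+ 2 * (m%:R^-1 * \sum_k noise_mean F j (tnth w k)) ^+ 2).
  by apply: measurable_funM => //; apply: measurable_funX; exact: mmean.
have last0 j (w : m.-tuple sample) :
    0 <= a j ^+ 2 * (m%:R^-1 * \sum_k noise_mean F j (tnth w k)) ^+ 2.
  by apply: mulr_ge0; exact: sqr_ge0.
rewrite /risk_bound /risk_val EFinM; apply: int_scale_le => //.
- apply: measurable_funD; first apply: measurable_funD.
  + by apply: mmean; exact: measurable_bias_bound.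
  + by apply: mmean; exact: measurable_noise_bound.
  + exact: measurable_sum.
- move=> w; apply: addr_ge0; first apply: addr_ge0.
  + by apply: mean_ge0; exact: bias_bound_ge0.
  + by apply: mean_ge0; exact: noise_bound_ge0.
  + by apply: sumr_ge0 => j _; exact: last0.
rewrite EFinD; apply: int_add_le.
- apply: measurable_funD.
  + by apply: mmean; exact: measurable_bias_bound.
  + by apply: mmean; exact: measurable_noise_bound.
- exact: measurable_sum.
- move=> w; apply: addr_ge0.
  + by apply: mean_ge0; exact: bias_bound_ge0.
  + by apply: mean_ge0; exact: noise_bound_ge0.
- by move=> w; apply: sumr_ge0 => j _; exact: last0.
- rewrite EFinD; apply: int_add_le.
  + by apply: mmean; exact: measurable_bias_bound.
  + by apply: mmean; exact: measurable_noise_bound.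
  + by apply: mean_ge0; exact: bias_bound_ge0.
  + by apply: mean_ge0; exact: noise_bound_ge0.
  + by apply: int_mean; [exact: measurable_bias_bound|exact: bias_bound_ge0|exact: bias_bound_int].
  + by apply: int_mean; [exact: measurable_noise_bound|exact: noise_bound_ge0|exact: noise_bound_int].
apply: int_sum_le => j; [exact: mlast|exact: last0|].
rewrite EFinM; apply: int_scale_le.
- by apply: measurable_funX; exact: mmean.
- by move=> w; exact: sqr_ge0.
- exact: sqr_ge0.
have [E0 E2] := noise_mean_second j.
by have [_] := mean_second_moment m_gt0 (mnoise_mean j) E0 E2.
Qed.

Definition bad_mean (w : m.-tuple sample) : R := m%:R^-1 * \sum_k bad (tnth w k).

Lemma measurable_bad_mean : measurable_fun [set: m.-tuple sample] bad_mean.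
Proof. by apply: mmean; exact: measurable_bad. Qed.

Lemma bad_mean_ge0 w : 0 <= bad_mean w.
Proof. by apply: mean_ge0; exact: bad_ge0. Qed.

Lemma bad_mean_int p : (\int[sample_prob]_w (bad_mean w)%:E <= (bad_prob p)%:E)%E.
Proof.
apply: le_trans (int_mean measurable_bad bad_ge0 (bad_le p)) _.
by rewrite sumr_const card_ord -[bad_prob p *+ m]mulr_natl mulrA mulVf ?mul1r// pnatr_eq0 -lt0n.
Qed.

End box_risk_integral.

(** * The regularised inverse and the limit of truncated kernels *)

Section regularized_inverse.
Context {R : realType} {n : nat}.
Implicit Types (G : 'I_n -> 'I_n -> R) (t : R) (y : 'I_n -> R).

Definition psd G := forall c : 'I_n -> R, 0 <= \sum_i \sum_j c i * c j * G i j.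

Definition reg_matrix G t : 'M[R]_n := \matrix_(i, j) G i j + t%:M.

Definition reg_sol G t y (i : 'I_n) : R :=
  (invmx (reg_matrix G t) *m (\col_i y i)) i 0.

(** A vector of the kernel would satisfy [0 = v G v^T + t |v|^2]. *)
Lemma reg_matrix_unit G t : 0 < t -> psd G -> reg_matrix G t \in unitmx.
Proof.
move=> t0 Gpsd; rewrite unitmxE unitfE; apply/det0P => -[v v0 vG].
have E : (v *m reg_matrix G t *m v^T) 0 0 =
    (\sum_i \sum_j v 0 i * v 0 j * G i j) + t * \sum_i v 0 i ^+ 2.
  rewrite /reg_matrix mulmxDr mulmxDl mxE; congr (_ + _).
    rewrite mxE exchange_big/=; apply: eq_bigr => j _.
    rewrite !mxE mulr_suml; apply: eq_bigr => i _; rewrite !mxE; ring.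
  rewrite mul_mx_scalar -scalemxAl mxE; congr (_ * _).
  by rewrite mxE; apply: eq_bigr => i _; rewrite mxE expr2.
move: E; rewrite vG mul0mx mxE => E.
have S0 : 0 <= \sum_i v 0 i ^+ 2 by apply: sumr_ge0 => i _; exact: sqr_ge0.
have tS : t * \sum_i v 0 i ^+ 2 = 0.
  have := Gpsd (v 0); have : 0 <= t * \sum_i v 0 i ^+ 2 by rewrite mulr_ge0 ?(ltW t0).
  move: E; move: (t * _) (\sum_i \sum_j _) => A B; lra.
have {tS} /eqP : \sum_i v 0 i ^+ 2 = 0 by move/eqP: tS; rewrite mulf_eq0 gt_eqF//= => /eqP.
rewrite psumr_eq0 => [/allP H|i _]; last exact: sqr_ge0.
move/eqP: v0; apply; apply/rowP => i; rewrite mxE.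
by have := H i (mem_index_enum _); rewrite /= sqrf_eq0 => /eqP.
Qed.

Lemma reg_solP G t y : 0 < t -> psd G ->
  forall i, \sum_j G i j * reg_sol G t y j + t * reg_sol G t y i = y i.
Proof.
move=> t0 Gpsd i.
have U := reg_matrix_unit t0 Gpsd.
have : (reg_matrix G t *m (invmx (reg_matrix G t) *m (\col_i y i))) i 0 = y i.
  by rewrite mulmxA mulmxV// mul1mx mxE.
rewrite {1}/reg_matrix mulmxDl mxE => <-; congr (_ + _).
  by rewrite mxE; apply: eq_bigr => j _; rewrite mxE.
by rewrite mul_scalar_mx mxE.
Qed.

Lemma reg_sol_unique G t y c : 0 < t -> psd G ->
  (forall i, \sum_j G i j * c j + t * c i = y i) -> forall i, c i = reg_sol G t y i.
Proof.
move=> t0 Gpsd cy i.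
have H := regularized_bound (y := fun=> 0) (c := fun i => c i - reg_sol G t y i) t0 Gpsd.
have {H} : t ^+ 2 * \sum_i (c i - reg_sol G t y i) ^+ 2 <= \sum_(i < n) (0 : R) ^+ 2.
  apply: H => k; under eq_bigr do rewrite mulrBr.
  rewrite sumrB mulrBr.
  have := cy k; have := reg_solP y t0 Gpsd k; lra.
rewrite [leRHS]big1; last by move=> k _; rewrite expr0n.
rewrite pmulr_rle0 ?exprn_gt0// => H.
have /eqP : \sum_i (c i - reg_sol G t y i) ^+ 2 = 0.
  by apply/eqP; rewrite eq_le H sumr_ge0// => k _; exact: sqr_ge0.
rewrite psumr_eq0 => [/allP/(_ i (mem_index_enum _))/=|k _]; last exact: sqr_ge0.
by rewrite sqrf_eq0 subr_eq0 => /eqP.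
Qed.

Lemma reg_sol_add G t y z : 0 < t -> psd G -> forall i,
  reg_sol G t (fun i => y i + z i) i = reg_sol G t y i + reg_sol G t z i.
Proof.
move=> t0 Gpsd i; apply/esym.
apply: (reg_sol_unique (c := fun i => reg_sol G t y i + reg_sol G t z i)) => // k.
under eq_bigr do rewrite mulrDr.
by rewrite big_split/= mulrDr addrACA !reg_solP.
Qed.

(** The limit solves the equation of index [q] up to a residual [r q] that tends
    to zero, and the regularised inverses have norm at most [1 / t]. *)
Lemma reg_sol_cvg (G_ : nat -> 'I_n -> 'I_n -> R) (y_ : nat -> 'I_n -> R) G t y :
  0 < t -> psd G -> (forall q, psd (G_ q)) ->
  (forall i j, G_ q i j @[q --> \oo] --> G i j) ->
  (forall i, y_ q i @[q --> \oo] --> y i) ->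
  forall i, reg_sol (G_ q) t (y_ q) i @[q --> \oo] --> reg_sol G t y i.
Proof.
move=> t0 Gpsd G_psd cG cy i.
set c := reg_sol G t y.
pose r q k := y_ q k - \sum_j G_ q k j * c j - t * c k.
have bound q : (reg_sol (G_ q) t (y_ q) i - c i) ^+ 2 <= t ^- 2 * \sum_k r q k ^+ 2.
  apply: (@le_trans _ _ (\sum_k (reg_sol (G_ q) t (y_ q) k - c k) ^+ 2)).
    by rewrite (bigD1 i)//= lerDl sumr_ge0// => k _; exact: sqr_ge0.
  rewrite ler_pdivlMl ?exprn_gt0//.
  apply: (regularized_bound t0 (G_psd q)) => k.
  under eq_bigr do rewrite mulrBr.
  rewrite sumrB mulrBr /r -(reg_solP (y_ q) t0 (G_psd q) k); ring.
have r0 : t ^- 2 * \sum_k r q k ^+ 2 @[q --> \oo] --> (0 : R).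
  have e0 : t ^- 2 * \sum_(k < n) (0 : R) ^+ 2 = 0.
    by rewrite big1 ?mulr0// => k _; rewrite expr0n.
  rewrite -[X in _ --> X]e0.
  suff s0 : \sum_k r q k ^+ 2 @[q --> \oo] --> \sum_(k < n) (0 : R) ^+ 2.
    exact: (cvgM (f := fun=> t ^- 2) (cvg_cst (t ^- 2)) s0).
  apply: cvg_big => [|k _]; first exact: add_continuous.
  have e1 : y k - \sum_j G k j * c j - t * c k = 0.
    by rewrite -(reg_solP y t0 Gpsd k) -/c; ring.
  suff r1 : r q k @[q --> \oo] --> (0 : R).
    by rewrite expr2; under eq_cvg do rewrite expr2; exact: (cvgM r1 r1).
  rewrite -[X in _ --> X]e1.
  have H : r q k @[q --> \oo] --> y k - \sum_j G k j * c j - t * c k.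
    apply: cvgB; last exact: cvg_cst.
    apply: cvgB; first exact: cy.
    apply: cvg_big => [|j _]; first exact: add_continuous.
    by apply: cvgMl; exact: cG.
  exact: H.
have sq : (reg_sol (G_ q) t (y_ q) i - c i) ^+ 2 @[q --> \oo] --> (0 : R).
  apply: (squeeze_cvgr (f := fun=> 0) (h := fun q => t ^- 2 * \sum_k r q k ^+ 2)) => //.
    by apply: nearW => q; rewrite sqr_ge0 bound.
  exact: cvg_cst.
apply/cvgrPdist_lt => e e0.
have /cvgrPdist_lt/(_ (e ^+ 2)) := sq; rewrite exprn_gt0// => /(_ isT).
apply: filterS => q; rewrite sub0r normrN normrX distrC.
by rewrite ltr_pXn2r ?nnegrE// ltW.
Qed.

End regularized_inverse.

Section kernel_limit.
Context {R : realType} {T : Type} {n : nat}.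
Variables (D0 : set T) (J : nat -> finType) (F : forall q, J q -> T -> R).
Variables (mu : forall q, J q -> R) (K : T -> T -> R) (t M kappa : R).
Hypothesis n_gt0 : (0 < n)%N.
Hypothesis t_gt0 : 0 < t.
Hypothesis mu_gt0 : forall q (j : J q), 0 < mu j.
Hypothesis F_le : forall q (j : J q) x, `|F j x| <= M.
Hypothesis mu_sum : forall q, \sum_(j : J q) mu j <= kappa.
Hypothesis K_lim : forall x x', D0 x -> D0 x' ->
  \sum_(j : J q) mu j * F j x * F j x' @[q --> \oo] --> K x x'.
Hypothesis K_psd : forall (r : nat) (x : 'I_r -> T) (c : 'I_r -> R),
  0 <= \sum_(i < r) \sum_(j < r) c i * c j * K (x i) (x j).
Variable X : 'I_n -> T.
Hypothesis X_D0 : forall i, D0 (X i).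

Let G i j := K (X i) (X j).
Definition feat q (j : J q) (i : 'I_n) := F j (X i).

Let Gpsd : psd G. Proof. by move=> c; exact: K_psd. Qed.

Let Gq q : 'I_n -> 'I_n -> R := emp_kernel (@mu q) (@feat q).

Let Gq_psd q : psd (Gq q). Proof. by move=> c; exact: emp_kernel_psd. Qed.

Let Gq_lim i j : Gq q i j @[q --> \oo] --> G i j.
Proof. by apply: K_lim. Qed.

(** Kernel ridge regression: this is the local posterior mean, as a function of
    the responses [y] and of the point [x]. *)
Definition krr y x := \sum_i K x (X i) * reg_sol G t y i.

(** The same with the kernel truncated to the box [q], in coordinates. *)
Definition krr_box q y x : R :=
  \sum_(j : J q) ridge_coef (@mu q) (@feat q) (reg_sol (Gq q) t y) j * F j x.

Lemma krr_box_eq q y x : krr_box q y x =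
  \sum_i (\sum_(j : J q) mu j * F j x * F j (X i)) * reg_sol (Gq q) t y i.
Proof.
rewrite /krr_box /ridge_coef.
transitivity (\sum_(j : J q) \sum_i mu j * F j x * F j (X i) * reg_sol (Gq q) t y i).
  apply: eq_bigr => j _; rewrite mulr_sumr mulr_suml; apply: eq_bigr => i _.
  by rewrite /feat; ring.
by rewrite exchange_big/=; apply: eq_bigr => i _; rewrite mulr_suml.
Qed.

Lemma krr_cvg y x : D0 x -> krr_box q y x @[q --> \oo] --> krr y x.
Proof.
move=> Dx; under eq_cvg do rewrite krr_box_eq.
apply: cvg_big => [|i _]; first exact: add_continuous.
apply: cvgM; first exact: K_lim.
by apply: reg_sol_cvg => // i'; exact: cvg_cst.
Qed.

Definition krr_var x := K x x - \sum_i K x (X i) * reg_sol G t (fun i => K (X i) x) i.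

Definition krr_var_box q x :=
  let y i := \sum_(j : J q) mu j * feat j i * F j x in
  \sum_(j : J q) mu j * F j x ^+ 2 - \sum_i reg_sol (Gq q) t y i * y i.

Lemma krr_var_cvg x : D0 x -> krr_var_box q x @[q --> \oo] --> krr_var x.
Proof.
move=> Dx; apply: cvgB.
  have := K_lim Dx Dx; under [in X in _ -> X]eq_cvg do under eq_bigr do rewrite expr2 mulrA.
  by [].
apply: cvg_big => [|i _]; first exact: add_continuous.
rewrite mulrC; apply: cvgM.
  by apply: reg_sol_cvg => // k; exact: K_lim.
have := K_lim Dx (X_D0 i); under eq_cvg do under eq_bigr do rewrite mulrAC.
by [].
Qed.

(** The variance does not exceed that of the prior. *)
Lemma krr_var_box_le q x : krr_var_box q x <= M ^+ 2 * kappa.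
Proof.
pose y i := \sum_(j : J q) mu j * feat j i * F j x; pose c := reg_sol (Gq q) t y.
rewrite /krr_var_box -/y -/c.
have cy : 0 <= \sum_i c i * y i.
  under eq_bigr => i _ do rewrite -(reg_solP y t_gt0 (Gq_psd q) i) -/c mulrDr.
  rewrite big_split/=; apply: addr_ge0.
    rewrite (eq_bigr (fun i => \sum_j c i * c j * Gq q i j)); first exact: (Gq_psd q c).
    by move=> i _; rewrite mulr_sumr; apply: eq_bigr => j _; ring.
  apply: sumr_ge0 => i _; rewrite mulrCA mulr_ge0 ?(ltW t_gt0)//.
  by rewrite -expr2 sqr_ge0.
apply: (@le_trans _ _ (\sum_(j : J q) mu j * F j x ^+ 2)); first by rewrite gerBl.
apply: (@le_trans _ _ (\sum_(j : J q) M ^+ 2 * mu j)); last first.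
  by rewrite -mulr_sumr; apply: ler_wpM2l; [exact: sqr_ge0|exact: mu_sum].
apply: ler_sum => j _; rewrite mulrC; apply: ler_wpM2r; first exact: ltW.
rewrite -[F j x ^+ 2]real_normK ?num_real//.
by rewrite lerXn2r ?nnegrE// (le_trans _ (F_le j x)).
Qed.

Lemma krr_var_box_good q x : hs_dev (@mu q) (@feat q) t <= 4^-1 ->
  krr_var_box q x <= 2 * (t / n%:R) * (M ^+ 2 * \sum_(j : J q) shrink (@mu q) (t / n%:R) j).
Proof.
move=> Q4; pose y i := \sum_(j : J q) mu j * feat j i * F j x.
rewrite /krr_var_box -/y.
have H := ridge_variance n_gt0 t_gt0 (@mu_gt0 q) (px := fun j => F j x) Q4
  (reg_solP y t_gt0 (Gq_psd q)).
apply: le_trans H _; apply: ler_wpM2l.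
  by rewrite mulr_ge0// divr_ge0// ltW.
rewrite mulr_sumr; apply: ler_sum => j _; rewrite mulrC; apply: ler_wpM2r.
  by rewrite ltW// shrink_gt0// divr_gt0// ltr0n.
rewrite -[F j x ^+ 2]real_normK ?num_real//.
by rewrite lerXn2r ?nnegrE// (le_trans _ (F_le j x)).
Qed.

(** Positivity of the kernel on the design points and the point [x], with
    coefficients [- c] and [1]. *)
Lemma krr_var_ge0 x : 0 <= krr_var x.
Proof.
set c := reg_sol G t (fun i => K (X i) x).
pose x' (i : 'I_n.+1) := if unlift ord0 i is Some k then X k else x.
pose c' (i : 'I_n.+1) := if unlift ord0 i is Some k then - c k else 1.
have := K_psd x' c'.
rewrite big_ord_recl big_ord_recl {1 2}/c' {1 2}/x' unlift_none !mul1r.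
under eq_bigr do rewrite /c' /x' unlift_none liftK mul1r.
under [X in _ + X]eq_bigr => i _.
  rewrite big_ord_recl {1 2}/c' {1 2}/x' unlift_none liftK mulr1.
  under eq_bigr do rewrite /c' /x' !liftK.
  over.
rewrite big_split/= /krr_var -/c.
have E1 : \sum_i - c i * K (X i) x = - \sum_i c i * (\sum_j G i j * c j) - t * \sum_i c i ^+ 2.
  rewrite mulr_sumr -!sumrN -big_split/=; apply: eq_bigr => i _.
  by rewrite -(reg_solP (fun i => K (X i) x) t_gt0 Gpsd i) -/c; ring.
have E2 : \sum_i \sum_j - c i * - c j * K (X i) (X j) = \sum_i c i * (\sum_j G i j * c j).
  apply: eq_bigr => i _; rewrite mulr_sumr; apply: eq_bigr => j _; rewrite /G; ring.
rewrite E1 E2.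
have : \sum_j - c j * K x (X j) = - \sum_i K x (X i) * c i.
  by rewrite -sumrN; apply: eq_bigr => i _; ring.
move=> -> H; apply: le_trans H _.
have : 0 <= t * \sum_i c i ^+ 2.
  by rewrite mulr_ge0 ?(ltW t_gt0)// sumr_ge0// => i _; exact: sqr_ge0.
set u := \sum_i K x (X i) * c i; set v := \sum_i c i * _; set z := t * _; lra.
Qed.

End kernel_limit.

(** * Boxes of multi-indices *)

Section boxes.
Variable d : nat.
Local Notation index := (@multi_index d).

(** One-dimensional indices run up to [q], so that every box contains the
    multi-index zero: sums of positive terms over a box are positive. *)
Definition box q : finType := {ffun 'I_d -> 'I_q.+1}.

Definition of_box q (j : box q) : index := [ffun k => j k : nat].

Lemma of_box_inj q : injective (@of_box q).
Proof.
move=> j j' /ffunP E; apply/ffunP => k; apply: val_inj.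
by have := E k; rewrite !ffunE.
Qed.

Definition box_set q : {fset index} := [fset of_box j | j in enum (box q)]%fset.

Lemma mem_box_set q (j : index) : (j \in box_set q) = [forall k, (j k < q.+1)%N].
Proof.
apply/imfsetP/forallP => [[i _ ->] k|H]; first by rewrite ffunE.
exists [ffun k => Ordinal (H k)]; first by rewrite /= mem_enum.
by apply/ffunP => k; rewrite !ffunE.
Qed.

Lemma box_cofinal (A : {fset index}) :
  \forall q \near \oo, (A `<=` box_set q)%fset.
Proof.
pose b := \max_(j <- A) \max_(k < d) j k.
near=> q; apply/fsubsetP => j jA; rewrite mem_box_set; apply/forallP => k.
rewrite ltnS; apply: (@leq_trans b); last by near: q; exact: nbhs_infty_ge.
apply: (@leq_trans (\max_(k < d) j k)); first exact: leq_bigmax.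
by rewrite /b (big_rem j)//= leq_maxl.
Unshelve. all: by end_near. Qed.

(** The boxes are cofinal among the finite sets of indices, so that limits along
    all finite sets are limits along the boxes. *)
Lemma totally_box {V : Type} (g : {fset index} -> V) (F : set_system V) :
  g @ totally `=>` F -> g (box_set q) @[q --> \oo] `=>` F.
Proof.
move=> gF A /gF [/= B _ BA]; have := box_cofinal B.
by apply: filterS => q Bq; exact: BA.
Qed.

Lemma partial_sum_box {V : zmodType} (x : index -> V) q :
  partial_sum x (box_set q) = \sum_(j : box q) x (of_box j).
Proof.
rewrite /partial_sum -(big_seq_fsetE _ _ xpredT x)/= big_imfset/=.
  by rewrite undup_id ?enum_uniq// big_enum.
by move=> i j _ _; exact: of_box_inj.
Qed.

End boxes.

Section basis.
Context {R : realType} {d : nat}.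
Variables (psi : nat -> R -> R) (Cpsi : R).
Hypothesis psi_basis : orthonormal_basis (prod_fun (d := d) psi).
Hypothesis psi_bound : forall (j : multi_index (d := d)) (t : d.-tuple R),
  cube t -> `|prod_fun psi j t| <= Cpsi.
Local Notation T := (d.-tuple R).
Local Notation P := (unif R d).
Local Notation L2 := (L2 P).

(** Extended by zero outside the cube, the basis functions are measurable and
    bounded everywhere. The law of the design does not charge the complement of
    the cube. *)
Definition basis_fun (j : @multi_index d) : T -> R := prod_fun psi j \_ cube.

Lemma measurable_basis_fun j : measurable_fun [set: T] (basis_fun j).
Proof.
have [[mj _] _ _] := (let: And3 H1 H2 H3 := psi_basis in And3 (H1 j) H2 H3).
by apply/(measurable_restrictT _ _).1 => //; exact: measurable_cube.
Qed.

Lemma basis_fun_le j x : 0 <= Cpsi -> `|basis_fun j x| <= Cpsi.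
Proof.
move=> C0; rewrite /basis_fun patchE; case: ifPn => [/set_mem|_]; last by rewrite normr0.
exact: psi_bound.
Qed.

Lemma Cpsi_ge0 : 0 <= Cpsi.
Proof.
have t0 : cube ([tuple of nseq d 0] : T) by move=> i; rewrite tnth_nseq lexx ler01.
exact: le_trans (normr_ge0 _) (psi_bound [ffun=> 0%N] t0).
Qed.

Lemma integral_cube (f : T -> \bar R) : measurable_fun [set: T] f ->
  (forall x, 0 <= f x)%E -> (\int[P]_(x in cube) f x = \int[P]_x f x)%E.
Proof.
move=> mf f0; rewrite integral_mkcond; apply/eqP; rewrite eq_le; apply/andP; split.
  apply: le_integral_nomeas => x; first by apply: erestrict_ge0.
  by rewrite patchE; case: ifPn.
apply: (@integral_le_ae _ _ _ _ cube) => //.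
- exact: measurable_cube.
- exact: unif_cube.
- by move=> x; apply: erestrict_ge0.
- apply/(measurable_restrictT _ _).1; first exact: measurable_cube.
  exact: measurable_funTS mf.
- by move=> x cx; rewrite patchE mem_set.
Qed.

Lemma basis_L2_fin j : (\int[P]_x (basis_fun j x ^+ 2)%:E < +oo)%E.
Proof.
apply: (@le_lt_trans _ _ (Cpsi ^+ 2)%:E); last exact: ltry.
apply: (@int_le _ _ _ _ _ (fun=> Cpsi ^+ 2)).
- by move=> x; exact: sqr_ge0.
- move=> x; rewrite -[leLHS]real_normK ?num_real//.
  by rewrite lerXn2r ?nnegrE ?basis_fun_le ?Cpsi_ge0.
- by rewrite integral_cstP.
Qed.

Definition basis_L2 j : L2 := sval (mkL2 (measurable_basis_fun j) (basis_L2_fin j)).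

Lemma basis_L2E j : basis_L2 j = basis_fun j :> (T -> R).
Proof. exact: svalP (mkL2 (measurable_basis_fun j) (basis_L2_fin j)). Qed.

Lemma inner_ip (f : T -> R) (g : L2) j : (forall x, cube x -> f x = (g : T -> R) x) ->
  inner f (prod_fun psi j) = ip g (basis_L2 j).
Proof.
move=> fg; rewrite /inner /ip /Rintegral; congr fine.
rewrite integral_mkcond; apply: eq_integral => x _.
rewrite patchE basis_L2E /basis_fun patchE; case: ifPn => [/set_mem cx|_].
  by rewrite fg.
by rewrite mulr0.
Qed.

Lemma basis_orthonormal j j' : ip (basis_L2 j) (basis_L2 j') = (j == j')%:R.
Proof.
have [_ H _] := psi_basis; rewrite -H; apply/esym/inner_ip => x cx.
by rewrite basis_L2E /basis_fun patchE mem_set.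
Qed.

Definition box_comb q (c : box d q -> R) : L2 := \sum_j c j *: basis_L2 (of_box j).

Lemma ip_box_comb q (c : box d q -> R) j : ip (box_comb c) (basis_L2 (of_box j)) = c j.
Proof.
rewrite /box_comb ip_suml (bigD1 j)//= ipZl basis_orthonormal eqxx mulr1.
rewrite big1 ?addr0// => k kj; rewrite ipZl basis_orthonormal.
by rewrite (inj_eq (@of_box_inj d q)) (negbTE kj) mulr0.
Qed.

Lemma norm2_box_comb q (c : box d q -> R) : norm2 (box_comb c) = \sum_j c j ^+ 2.
Proof.
rewrite /norm2 {2}/box_comb ip_sumr; apply: eq_bigr => j _.
by rewrite ipZr ip_box_comb expr2.
Qed.

Lemma norm2_sub_box_comb q (f : L2) (c : box d q -> R) :
  norm2 (f - box_comb c) = norm2 f - \sum_(j : box d q) ip f (basis_L2 (of_box j)) ^+ 2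
    + \sum_j (c j - ip f (basis_L2 (of_box j))) ^+ 2.
Proof.
rewrite norm2B norm2_box_comb /box_comb ip_sumr.
under eq_bigr do rewrite ipZr.
rewrite -!addrA; congr (_ + _); rewrite mulr_sumr -!sumrN -!big_split/=.
by apply: eq_bigr => j _; ring.
Qed.

(** The squared distance to the span of the box, by [box_tailE]. *)
Definition box_tail q (f : L2) := norm2 f - \sum_(j : box d q) ip f (basis_L2 (of_box j)) ^+ 2.

Lemma box_tailE q (f : L2) :
  box_tail q f = norm2 (f - box_comb (fun j : box d q => ip f (basis_L2 (of_box j)))).
Proof.
rewrite norm2_sub_box_comb [X in _ + X]big1 ?addr0// => j _.
by rewrite subrr expr0n.
Qed.

Lemma box_tail_ge0 q f : 0 <= box_tail q f.
Proof. by rewrite box_tailE norm2_ge0. Qed.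

Lemma basis_bessel q (f : L2) : \sum_(j : box d q) ip f (basis_L2 (of_box j)) ^+ 2 <= norm2 f.
Proof. by rewrite -subr_ge0 box_tail_ge0. Qed.

Lemma box_combE q (c : box d q -> R) x :
  (box_comb c : T -> R) x = \sum_j c j * basis_fun (of_box j) x.
Proof.
rewrite /box_comb; elim/big_ind2: _ => //.
  by move=> f u g v fu gv; rewrite -fu -gv.
by move=> j _; rewrite -basis_L2E.
Qed.

Lemma cube_norm_L2 (u : T -> R) (f : L2) : (forall x, cube x -> u x = (f : T -> R) x) ->
  (cube_norm u ^+ 2 = (norm2 f)%:E)%E.
Proof.
move=> uf; rewrite /cube_norm L2_norm_sqr -norm2_EFin.
rewrite -[RHS]integral_cube.
- rewrite [RHS]integral_mkcond; apply: eq_integral => x _.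
  rewrite !patchE; case: ifPn => [/set_mem cx|_]; first by rewrite uf.
  by rewrite expr0n.
- by apply/measurable_EFinP; apply: measurable_funX; exact: measurable_L2.
- by move=> x; rewrite lee_fin sqr_ge0.
Qed.

(** The expansion in the basis is assumed to converge along the finite sets of
    indices in norm, and box tails are the squares of the remaining norms. *)
Lemma box_tail_cvg (f : L2) : box_tail q f @[q --> \oo] --> (0 : R).
Proof.
have [_ _ /(_ f) H] := psi_basis.
pose N q := cube_norm (fun x => ((f : T -> R) x -
    partial_sum (fun j => inner f (prod_fun psi j) * prod_fun psi j x) (box_set d q))%R).
have {}H : N q @[q --> \oo] --> (0%:E : \bar R) := totally_box H.
have E q : (N q * N q = (box_tail q f)%:E)%E.
  rewrite box_tailE -expe2; apply: cube_norm_L2 => x cx.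
  rewrite partial_sum_box.
  rewrite (_ : ((f - box_comb _ : L2) : T -> R) x = (f : T -> R) x - (box_comb (fun j : box d q => ip f (basis_L2 (of_box j))) : T -> R) x)//.
  rewrite box_combE; congr (_ - _); apply: eq_bigr => j _.
  by rewrite (inner_ip (g := f))// /basis_fun patchE mem_set.
have H2 : (box_tail q f)%:E @[q --> \oo] --> (0%:E : \bar R).
  have -> : (fun q => (box_tail q f)%:E) = (fun q => N q * N q)%E.
    by apply/funext => q; rewrite E.
  have H3 : (N q * N q)%E @[q --> \oo] --> (0%:E * 0%:E : \bar R)%E by exact: cvgeM.
  by rewrite mule0 in H3.
by move/fine_cvgP : H2 => [].
Qed.

Lemma basis_parseval (f : L2) :
  \sum_(j : box d q) ip f (basis_L2 (of_box j)) ^+ 2 @[q --> \oo] --> norm2 f.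
Proof.
have H : norm2 f - box_tail q f @[q --> \oo] --> norm2 f - 0.
  by apply: cvgB; [exact: cvg_cst|exact: box_tail_cvg].
rewrite subr0 in H.
by under eq_cvg => q do rewrite -[\sum_(j : box d q) _](subKr (norm2 f)).
Qed.

Lemma basis_fun_on j k :
  (\int[P]_x (basis_fun j x * basis_fun k x)%:E = ((j == k)%:R)%:E)%E.
Proof. by rewrite -basis_orthonormal -ip_EFin; under [in RHS]eq_integral do rewrite !basis_L2E. Qed.

End basis.

(** * The aggregated posterior for given data *)

Section posterior_bounds.
Context {R : realType} {d : nat}.
Local Notation T := (d.-tuple R).
Local Notation P := (unif R d).
Local Notation L2 := (L2 P).
Variables (K : T -> T -> R) (psi : nat -> R -> R) (lam : nat -> R) (Cpsi kappa sigma : R).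
Hypothesis K_pd : positive_definite K.
Hypothesis psi_basis : orthonormal_basis (prod_fun (d := d) psi).
Hypothesis K_exp : expansion K (prod_val lam) (prod_fun psi).
Hypothesis psi_bound : forall (j : multi_index (d := d)) (t : d.-tuple R),
  cube t -> `|prod_fun psi j t| <= Cpsi.
Hypothesis lam_gt0 : forall i, 0 < lam i.
Hypothesis sigma_gt0 : 0 < sigma.

Definition box_val q (j : box d q) : R := prod_val lam (of_box j).
Definition box_fun q (j : box d q) : T -> R := basis_fun psi (of_box j).

Hypothesis lam_sum : forall q, \sum_(j : box d q) box_val j <= kappa.

Variables (n m : nat).
Hypothesis n_gt0 : (0 < n)%N.
Hypothesis m_gt0 : (0 < m)%N.

Definition ridge_reg : R := m%:R^-1 * sigma ^+ 2.
Local Notation t := ridge_reg.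

Definition box_dim q : R := \sum_(j : box d q) shrink (@box_val q) (t / n%:R) j.

Let t_gt0 : 0 < t.
Proof. by rewrite mulr_gt0 ?invr_gt0 ?ltr0n// exprn_gt0. Qed.

Lemma box_val_gt0 q (j : box d q) : 0 < box_val j.
Proof. by apply: prodr_gt0 => k _; exact: lam_gt0. Qed.

Lemma box_fun_le q (j : box d q) x : `|box_fun j x| <= Cpsi.
Proof. by apply: (basis_fun_le psi_bound); exact: (Cpsi_ge0 psi_bound). Qed.

Lemma measurable_box_fun q (j : box d q) : measurable_fun [set: T] (box_fun j).
Proof. exact: measurable_basis_fun psi_basis _. Qed.

Lemma box_kernel_cvg x x' : cube x -> cube x' ->
  \sum_(j : box d q) box_val j * box_fun j x * box_fun j x' @[q --> \oo] --> K x x'.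
Proof.
move=> cx cx'; have H := totally_box (K_exp cx cx').
apply: cvg_trans H; apply: near_eq_cvg; apply: nearW => q.
rewrite partial_sum_box; apply: eq_bigr => j _.
by rewrite /box_fun /basis_fun !patchE !mem_set.
Qed.

Section given_data.
Variable D : data (R := R) (d := d) n m.
Hypothesis D_cube : forall k i, cube (design D k i).

Lemma local_mean_krr k x : local_mean K sigma D k x =
  krr K t (design D k) (response D k) x.
Proof.
rewrite /local_mean /krr -mulmxA mxE; apply: eq_bigr => i _.
by rewrite mxE.
Qed.

Lemma local_cov_krr k x : local_cov K sigma D k x x = krr_var K t (design D k) x.
Proof.
rewrite /local_cov /krr_var -mulmxA mxE; congr (_ - _); apply: eq_bigr => i _.
by rewrite mxE.
Qed.

Let krr_lim k (y : 'I_n -> R) x : cube x ->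
  krr_box (@box_fun) (@box_val) t (design D k) q y x @[q --> \oo] --> krr K t (design D k) y x.
Proof.
move=> cx; apply: (krr_cvg (D0 := cube)) => //.
- exact: box_val_gt0.
- exact: box_kernel_cvg.
- by case: K_pd.
Qed.

Let var_lim k x : cube x ->
  krr_var_box (@box_fun) (@box_val) t (design D k) q x @[q --> \oo] --> krr_var K t (design D k) x.
Proof.
move=> cx; apply: (krr_var_cvg (D0 := cube)) => //.
- exact: box_val_gt0.
- exact: box_kernel_cvg.
- by case: K_pd.
Qed.

Let M2 := Cpsi ^+ 2 * kappa.

Lemma cvg_le_bound (u : nat -> R) (l b : R) : u q @[q --> \oo] --> l ->
  (forall q, u q <= b) -> l <= b.
Proof.
move=> ul ub; rewrite -(cvg_lim _ ul)//; apply: limr_le; last exact: nearW.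
by apply/cvg_ex; exists l.
Qed.

Let var_le k x : cube x -> krr_var K t (design D k) x <= M2.
Proof.
move=> cx; apply: cvg_le_bound (var_lim cx) _ => q.
apply: krr_var_box_le => //; [exact: box_val_gt0|exact: box_fun_le].
Qed.

Let var_ge0 k x : 0 <= krr_var K t (design D k) x.
Proof. by apply: krr_var_ge0 => //; case: K_pd. Qed.

Let kernel_le x x' : cube x -> cube x' -> `|K x x'| <= M2.
Proof.
move=> cx cx'; apply: (cvg_le_bound (cvg_norm (box_kernel_cvg cx cx'))) => q.
apply: le_trans (ler_norm_sum _ _ _) _.
apply: (@le_trans _ _ (\sum_(j : box d q) Cpsi ^+ 2 * box_val j)); last first.
  by rewrite -mulr_sumr; apply: ler_wpM2l; [exact: sqr_ge0|exact: lam_sum].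
apply: ler_sum => j _; rewrite !normrM ger0_norm ?(ltW (box_val_gt0 j))//.
rewrite -mulrA mulrC; apply: ler_wpM2r; first exact/ltW/box_val_gt0.
by rewrite expr2; apply: ler_pM => //; exact: box_fun_le.
Qed.

(** The expansion describes the kernel on the cube only, where local means and
    variances are limits of measurable functions. *)
Lemma measurable_cube_limit (u : nat -> T -> R) (v : T -> R) :
  (forall q, measurable_fun [set: T] (u q)) ->
  (forall x, cube x -> u q x @[q --> \oo] --> v x) ->
  measurable_fun [set: T] (v \_ cube).
Proof.
move=> mu_ uv; apply/(measurable_restrictT _ _).1; first exact: measurable_cube.
apply: (measurable_fun_cvg (h := u)) => [q|x cx]; last exact: uv.
exact: measurable_funTS.
Qed.

Let mkrr_box q k y : measurable_fun [set: T] (krr_box (@box_fun) (@box_val) t (design D k) q y).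
Proof.
by apply: measurable_sum => j; apply: measurable_funM => //; exact: measurable_box_fun.
Qed.

Let mkrr_var_box q k : measurable_fun [set: T] (krr_var_box (@box_fun) (@box_val) t (design D k) q).
Proof.
have mb (j : box d q) := measurable_box_fun j.
have my i : measurable_fun [set: T] (fun x => \sum_(j : box d q) box_val j * feat (@box_fun) (design D k) j i * box_fun j x).
  by apply: measurable_sum => j; apply: measurable_funM.
apply: measurable_funB.
  by apply: measurable_sum => j; apply: measurable_funM => //; exact: measurable_funX.
apply: measurable_sum => i; apply: measurable_funM => //.
rewrite /reg_sol; under eq_fun do rewrite mxE.
apply: measurable_sum => i'; apply: measurable_funM => //.
by under eq_fun do rewrite mxE; exact: my.
Qed.

Let mmean k : measurable_fun [set: T] (local_mean K sigma D k \_ cube).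
Proof.
apply: (measurable_cube_limit (u := fun q => krr_box (@box_fun) (@box_val) t (design D k) q (response D k))).
  by move=> q; exact: mkrr_box.
by move=> x cx; rewrite local_mean_krr; exact: krr_lim.
Qed.

Let mean_fin k : (\int[P]_x ((local_mean K sigma D k \_ cube) x ^+ 2)%:E < +oo)%E.
Proof.
pose B := \sum_i M2 * `|reg_sol (fun i j => K (design D k i) (design D k j)) t (response D k) i|.
apply: (@le_lt_trans _ _ (B ^+ 2)%:E); last exact: ltry.
apply: (@int_le _ _ _ _ _ (fun=> B ^+ 2)).
- by move=> x; exact: sqr_ge0.
- move=> x; rewrite -[leLHS]real_normK ?num_real//.
  have B0 : 0 <= B.
    apply: sumr_ge0 => i _; rewrite mulr_ge0//.
    by apply: le_trans (kernel_le (D_cube k i) (D_cube k i)).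
  rewrite lerXn2r ?nnegrE// patchE; case: ifPn => [/set_mem cx|_]; last by rewrite normr0.
  rewrite local_mean_krr /krr; apply: le_trans (ler_norm_sum _ _ _) _.
  by apply: ler_sum => i _; rewrite normrM ler_wpM2r// kernel_le.
- by rewrite integral_cstP.
Qed.

Definition local_mean_L2 k : L2 := sval (mkL2 (mmean k) (mean_fin k)).

Lemma local_mean_L2E k x : cube x -> (local_mean_L2 k : T -> R) x = local_mean K sigma D k x.
Proof.
by move=> cx; rewrite /local_mean_L2 (svalP (mkL2 (mmean k) (mean_fin k))) patchE mem_set.
Qed.

Lemma cube_dist_mean (f0 : L2) :
  (cube_dist (global_mean K sigma D) f0 ^+ 2 =
   (norm2 (mean_center local_mean_L2 - f0))%:E)%E.
Proof.
apply: cube_norm_L2 => x cx.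
rewrite (_ : ((mean_center local_mean_L2 - f0 : L2) : T -> R) x = (mean_center local_mean_L2 : T -> R) x - (f0 : T -> R) x)//.
congr (_ - _); rewrite /global_mean /mean_center.
rewrite (_ : ((_ *: _ : L2) : T -> R) x = m%:R^-1 * ((\sum_k local_mean_L2 k : L2) : T -> R) x)//.
congr (_ * _).
have -> : ((\sum_k local_mean_L2 k : L2) : T -> R) x = \sum_k (local_mean_L2 k : T -> R) x.
  by elim/big_ind2: _ => // f u g v <- <-.
by apply: eq_bigr => k _; rewrite local_mean_L2E.
Qed.

Lemma cube_dist_L2 (f g : L2) : cube_dist f g = L2_dist P f g.
Proof.
have E : (cube_dist f g ^+ 2 = (norm2 (f - g))%:E)%E by exact: cube_norm_L2.
rewrite L2_dist_sqrt; have : (0 <= cube_dist f g)%E by exact: Lnorm_ge0.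
move: E; case: (cube_dist f g) => [r|//|//].
rewrite -EFin_expe => -[<-]; rewrite lee_fin => r0.
by rewrite sqrtr_sqr ger0_norm.
Qed.

Definition mean_var x := m%:R^-1 * \sum_k krr_var K t (design D k) x.

Let mvar k : measurable_fun [set: T] (krr_var K t (design D k) \_ cube).
Proof.
apply: (measurable_cube_limit (u := fun q => krr_var_box (@box_fun) (@box_val) t (design D k) q)).
  by move=> q; exact: mkrr_var_box.
by move=> x cx; exact: var_lim.
Qed.

(** For both methods the spread is at most a multiple of the averaged local
    variance: averaging divides the variance [m C] of a draw by [m], and the
    barycenter is no more spread than the local posteriors. The constant is
    [512 = 8 * 64], from [barycenter_second_moment] and [GP_law_moments]. *)
Lemma posterior_second_moment a (Pi : probability L2 R) (f0 : L2) (V : \bar R) :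
  global_posterior a K sigma D Pi ->
  (\int[P]_x ((mean_var \_ cube) x)%:E <= V)%E ->
  (\int[Pi]_f (norm2 (f - f0))%:E <=
   2%:E * cube_dist (global_mean K sigma D) f0 ^+ 2 + 512%:E * V)%E.
Proof.
pose v k := fine (\int[P]_x ((krr_var K t (design D k) \_ cube) x)%:E)%E.
have v0 k x : 0 <= (krr_var K t (design D k) \_ cube) x.
  by rewrite patchE; case: ifPn.
have vE k : (\int[P]_x ((krr_var K t (design D k) \_ cube) x)%:E = (v k)%:E)%E.
  rewrite /v fineK// ge0_fin_numE; last by apply: integral_ge0 => x _; rewrite lee_fin.
  apply: (@le_lt_trans _ _ M2%:E); last exact: ltry.
  apply: (@int_le _ _ _ _ _ (fun=> M2)) => //; last by rewrite integral_cstP.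
  move=> x; rewrite patchE; case: ifPn => [/set_mem cx|_]; first exact: var_le.
  have t0 : cube ([tuple of nseq d 0] : T) by move=> i; rewrite tnth_nseq lexx ler01.
  exact: (le_trans (normr_ge0 _) (kernel_le t0 t0)).
have avg : (\int[P]_x ((mean_var \_ cube) x)%:E = (m%:R^-1 * \sum_k v k)%:E)%E.
  transitivity (\int[P]_x (m%:R^-1%:E * (\sum_k (krr_var K t (design D k) \_ cube) x)%R%:E))%E.
    apply: eq_integral => x _; rewrite -EFinM; congr EFin.
    rewrite patchE; case: ifPn => [xc|xc].
      by rewrite /mean_var; congr (_ * _); apply: eq_bigr => k _; rewrite patchE xc.
    by rewrite big1 ?mulr0// => k _; rewrite patchE (negbTE xc).
  rewrite ge0_integralZl//; last 2 first.
  - by apply/measurable_EFinP; exact: measurable_sum.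
  - by move=> x _; rewrite lee_fin; apply: sumr_ge0.
  under eq_integral do rewrite -sumEFin.
  rewrite ge0_integral_sum//; last 2 first.
  - by move=> k; apply/measurable_EFinP.
  - by move=> k x _; rewrite lee_fin.
  by under eq_bigr do rewrite vE; rewrite sumEFin.
move=> Pia VV; rewrite avg in VV.
have m1 : 0 < m%:R :> R by rewrite ltr0n.
have s0 : 0 <= m%:R^-1 * \sum_k v k.
  by rewrite mulr_ge0 ?invr_ge0// sumr_ge0// => k _; rewrite fine_ge0// integral_ge0// => x _; rewrite lee_fin.
apply: (@le_trans _ _ (2 * norm2 (mean_center local_mean_L2 - f0) + 512 * (m%:R^-1 * \sum_k v k))%:E); last first.
  rewrite cube_dist_mean EFinD !EFinM; apply: leeD => //.
  by apply: lee_wpmul2l => //; rewrite lee_fin.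
have H (r : R) (nu : probability L2 R) k (C : T -> T -> R) : 0 <= r ->
    (forall x, C x x = r * krr_var K t (design D k) x) ->
    GP_law cube nu (local_mean K sigma D k) C ->
    (\int[nu]_f (norm2 (f - local_mean_L2 k))%:E <= (64 * (r * v k))%:E)%E /\
    forall g : L2, (\int[nu]_f (ip (f - local_mean_L2 k) g)%:E = 0)%E.
  move=> r0 Cx GP.
  have Aa x : cube x -> (local_mean_L2 k : T -> R) x = local_mean K sigma D k x.
    exact: local_mean_L2E.
  have C0 x : cube x -> 0 <= C x x by move=> _; rewrite Cx mulr_ge0.
  have mc : measurable_fun [set: T] (fun x => r * (krr_var K t (design D k) \_ cube) x).
    exact: measurable_funM.
  have c0 x : 0 <= r * (krr_var K t (design D k) \_ cube) x by rewrite mulr_ge0.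
  have cC x : cube x -> r * (krr_var K t (design D k) \_ cube) x = C x x.
    by move=> cx; rewrite Cx patchE mem_set.
  have cV : (\int[P]_x (r * (krr_var K t (design D k) \_ cube) x)%:E <= (r * v k)%:E)%E.
    by rewrite EFinM; apply: int_scale_le => //; rewrite vE.
  exact (GP_law_moments (@measurable_cube R d) (@unif_cube R d) GP Aa C0 mc c0 cC cV).
case: a Pia => [[L LGP avgL]|[L LGP bar]].
- have Hk k := H m%:R (L k) k (fun x x' => m%:R * local_cov K sigma D k x x') (ler0n R m)
    (fun x => congr1 ( *%R m%:R) (local_cov_krr k x)) (LGP k).
  have L2nd k : (\int[L k]_f (norm2 (f - local_mean_L2 k))%:E <= (64 * (m%:R * v k))%:E)%E := (Hk k).1.
  have Lmean k (g : L2) : (\int[L k]_f (ip (f - local_mean_L2 k) g)%:E = 0)%E := (Hk k).2 g.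
  have := average_law_second_moment L2nd Lmean avgL
    (fun q => @basis_bessel R d psi Cpsi psi_basis psi_bound q)
    (@basis_parseval R d psi Cpsi psi_basis psi_bound) f0.
  move=> /le_trans; apply.
  rewrite lee_fin; apply: lerD.
    by rewrite ler_peMl ?norm2_ge0// ler1n.
  rewrite (_ : m%:R ^- 2 * _ = 64 * (m%:R^-1 * \sum_k v k)).
    by apply: ler_wpM2r => //; rewrite ler_nat.
  rewrite -mulr_sumr -mulr_sumr; field; by rewrite gt_eqF.
- have Hk k := H 1 (L k) k (local_cov K sigma D k) ler01 (fun x => etrans (local_cov_krr k x) (esym (mul1r _))) (LGP k).
  have L2nd k : (\int[L k]_f (norm2 (f - local_mean_L2 k))%:E <= (64 * (1 * v k))%:E)%E := (Hk k).1.
  have Lmean k (g : L2) : (\int[L k]_f (ip (f - local_mean_L2 k) g)%:E = 0)%E := (Hk k).2 g.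
  have := barycenter_second_moment m_gt0 L2nd Lmean bar f0.
  move=> /le_trans; apply.
  rewrite lee_fin lerD2l; under eq_bigr do rewrite mul1r.
  rewrite -mulr_sumr le_eqVlt; apply/orP; left; apply/eqP; ring.
Qed.

End given_data.

Section sample.
Variable f0 : L2.
Local Notation sample := (m.-tuple (n.-tuple (T * R))).
Variable F1 : R.

Definition box_coef q (j : box d q) : R := ip f0 (basis_L2 psi_basis psi_bound (of_box j)).

Hypothesis coef_sum : forall q, \sum_(j : box d q) `|box_coef j| <= F1.

Definition box_bias q : R :=
  \sum_(j : box d q) (box_coef j - shrink (@box_val q) (t / n%:R) j * box_coef j) ^+ 2.

Let tail q := box_tail psi_basis psi_bound q f0.

Let risk q (w : sample) : R := risk_bound (@box_fun q) Cpsi (@box_val q) t f0 (@box_coef q) w.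

Let bad q (w : sample) : R := bad_mean (@box_fun q) (@box_val q) t w.

Lemma design_observe (w : sample) k : design (observe f0 w) k = fun i => (tnth (tnth w k) i).1.
Proof. by apply/funext => i; rewrite /design /observe !tnth_mktuple. Qed.

Lemma response_observe (w : sample) k :
  response (observe f0 w) k = fun i => (f0 : T -> R) (tnth (tnth w k) i).1 + (tnth (tnth w k) i).2.
Proof. by apply/funext => i; rewrite /response /observe !tnth_mktuple. Qed.

Let design_cube (w : sample) := forall k i, cube (tnth (tnth w k) i).1.

(** Along the boxes, the truncated estimators converge at every point of the
    cube, and their error splits into the error in the box and the tail of
    [f0]. *)
Lemma mean_risk_le w : design_cube w ->
  (cube_dist (global_mean K sigma (observe f0 w)) f0 ^+ 2 <=
   limn_einf (fun q => (risk q w + tail q)%:E))%E.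
Proof.
move=> wc.
have dc k i : cube (design (observe f0 w) k i) by rewrite design_observe.
pose X k i := (tnth (tnth w k) i).1.
pose G q k := emp_kernel (@box_val q) (feat (@box_fun) (X k) (q := q)).
have Gpsd q k : psd (G q k) by move=> c; apply: emp_kernel_psd; exact: box_val_gt0.
pose cf q k := reg_sol (G q k) t (fun i => (f0 : T -> R) (X k i)).
pose ce q k := reg_sol (G q k) t (fun i => (tnth (tnth w k) i).2).
pose th q (j : box d q) := m%:R^-1 * \sum_k ridge_coef (@box_val q) (feat (@box_fun) (X k) (q := q))
   (fun i => cf q k i + ce q k i) j.
rewrite /cube_dist /cube_norm L2_norm_sqr.
apply: (fatou_le (A := cube) (f_ := fun q x =>
  ((box_comb psi_basis psi_bound (@th q) - f0 : L2) : T -> R) x ^+ 2)).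
- exact: measurable_cube.
- exact: unif_cube.
- by move=> q; apply: measurable_funX; exact: measurable_L2.
- by move=> q x; exact: sqr_ge0.
- by move=> x; rewrite lee_fin sqr_ge0.
- move=> x cx; rewrite patchE mem_set//.
  suff H : ((box_comb psi_basis psi_bound (@th q) - f0 : L2) : T -> R) x @[q --> \oo] -->
      global_mean K sigma (observe f0 w) x - (f0 : T -> R) x.
    rewrite (cvg_limn_einf (l := (global_mean K sigma (observe f0 w) x - (f0 : T -> R) x) ^+ 2))//.
    rewrite expr2; under eq_cvg do rewrite expr2; exact: (cvgM H H).
  rewrite (_ : (fun q => _) = fun q => (box_comb psi_basis psi_bound (@th q) : T -> R) x - (f0 : T -> R) x)//.
  apply: cvgB; last exact: cvg_cst.
  have E q : (box_comb psi_basis psi_bound (@th q) : T -> R) x =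
      m%:R^-1 * \sum_k krr_box (@box_fun) (@box_val) t (X k) q (response (observe f0 w) k) x.
    rewrite box_combE /th.
    under eq_bigr do rewrite -mulrA mulr_suml.
    rewrite -mulr_sumr; congr (_ * _); rewrite exchange_big/=; apply: eq_bigr => k _.
    rewrite /krr_box; apply: eq_bigr => j _; congr (ridge_coef _ _ _ _ * _).
    apply/funext => i; rewrite response_observe /cf /ce -reg_sol_add//.
  rewrite (_ : (fun q => _) = fun q => m%:R^-1 * \sum_k krr_box (@box_fun) (@box_val) t (X k) q (response (observe f0 w) k) x); last first.
    by apply/funext => q; rewrite E.
  have L : \sum_k krr_box (@box_fun) (@box_val) t (X k) q (response (observe f0 w) k) x @[q --> \oo] -->
      \sum_k local_mean K sigma (observe f0 w) k x.
    apply: cvg_big => [|k _]; first exact: add_continuous.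
    rewrite local_mean_krr design_observe; apply: (krr_cvg (D0 := cube)) => //.
    + exact: box_val_gt0.
    + exact: box_kernel_cvg.
    + by case: K_pd.
    + by move=> i; exact: wc.
  exact: (cvgM (cvg_cst _) L).
- move=> q.
  rewrite norm2_EFin lee_fin -opprB norm2N norm2_sub_box_comb addrC lerD2r.
  apply: (risk_bound_ge (@box_coef q) n_gt0 m_gt0 t_gt0 (@box_val_gt0 q) (@box_fun_le q)
    (cf := cf q) (ce := ce q)).
  + by move=> k i; exact: (reg_solP (fun i => (f0 : T -> R) (X k i)) t_gt0 (Gpsd q k)).
  + by move=> k i; exact: (reg_solP (fun i => (tnth (tnth w k) i).2) t_gt0 (Gpsd q k)).
Qed.

Let var_bound q (w : sample) : R :=
  2 * (t / n%:R) * (Cpsi ^+ 2 * box_dim q) + Cpsi ^+ 2 * kappa * bad q w.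

Let box_dim_ge0 q : 0 <= box_dim q.
Proof.
by apply: sumr_ge0 => j _; apply/ltW/(shrink_gt0 n_gt0 t_gt0 (@box_val_gt0 q)).
Qed.

Let kappa_ge0 : 0 <= kappa.
Proof.
apply: le_trans (lam_sum 0); apply: sumr_ge0 => j _; exact/ltW/box_val_gt0.
Qed.

Lemma mean_var_le w : design_cube w ->
  (\int[P]_x ((mean_var (observe f0 w) \_ cube) x)%:E <=
   limn_einf (fun q => (var_bound q w)%:E))%E.
Proof.
move=> wc.
have m0 : 0 < m%:R :> R by rewrite ltr0n.
have main : 0 <= 2 * (t / n%:R).
  by rewrite mulr_ge0// divr_ge0// ltW.
have vb0 q : 0 <= var_bound q w.
  apply: addr_ge0.
    by apply: mulr_ge0 => //; apply: mulr_ge0 => //; exact: sqr_ge0.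
  apply: mulr_ge0; last exact: bad_mean_ge0.
  by apply: mulr_ge0 => //; exact: sqr_ge0.
have L0 : (0 <= limn_einf (fun q => (var_bound q w)%:E))%E.
  by apply: (le_limn_einf (u := fun=> 0)) => //; exact: cvg_cst.
rewrite -[leRHS](integral_cstP P); apply: le_integral_nomeas => x.
  rewrite lee_fin patchE; case: ifPn => // _.
  rewrite mulr_ge0 ?invr_ge0 ?(ltW m0)// sumr_ge0// => k _.
  by apply: krr_var_ge0 => //; case: K_pd.
rewrite patchE; case: ifPn => [/set_mem cx|_]; last exact: L0.
apply: (le_limn_einf (u := fun q => m%:R^-1 * \sum_k krr_var_box (@box_fun) (@box_val) t (design (observe f0 w) k) q x)).
  have L : \sum_k krr_var_box (@box_fun) (@box_val) t (design (observe f0 w) k) q x @[q --> \oo] -->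
      \sum_k krr_var K t (design (observe f0 w) k) x.
    apply: cvg_big => [|k _]; first exact: add_continuous.
    apply: (krr_var_cvg (D0 := cube)) => //.
    + exact: box_val_gt0.
    + exact: box_kernel_cvg.
    + by case: K_pd.
    + by move=> i; rewrite design_observe.
  exact: (cvgM (cvg_cst _) L).
move=> q.
have -> : var_bound q w = m%:R^-1 * \sum_(k < m)
    (2 * (t / n%:R) * (Cpsi ^+ 2 * box_dim q) + Cpsi ^+ 2 * kappa * bad_gram (@box_fun q) (@box_val q) t m (tnth w k)).
  rewrite big_split/= sumr_const card_ord -mulr_sumr mulrDr; congr (_ + _).
    set Z := _ * _; rewrite -[Z *+ m]mulr_natl mulrA mulVf ?mul1r// gt_eqF//.
  by rewrite /bad /bad_mean mulrCA.
apply: ler_wpM2l; first by rewrite invr_ge0 ltW.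
apply: ler_sum => k _; rewrite design_observe /bad_gram indicE.
have Mk : 0 <= Cpsi ^+ 2 * kappa by rewrite mulr_ge0 ?sqr_ge0.
case: (boolP (_ \in _)) => [_|/negP H].
  rewrite mulr1; apply: le_trans (_ : Cpsi ^+ 2 * kappa <= _); last first.
    by rewrite lerDr; apply: mulr_ge0 => //; apply: mulr_ge0 => //; exact: sqr_ge0.
  by apply: krr_var_box_le => //; [exact: box_val_gt0|exact: box_fun_le].
rewrite mulr0 addr0; apply: krr_var_box_good => //; [exact: box_val_gt0|exact: box_fun_le|].
have {}H : hs_dev (@box_val q) (feat (@box_fun) (fun i => (tnth (tnth w k) i).1) (q := q)) t <= (4 * m%:R)^-1.
  by rewrite leNgt; apply/negP => H2; apply: H; rewrite inE.
apply: le_trans H _.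
by rewrite lef_pV2 ?posrE ?mulr_gt0 ?ltr0n// ler_peMr// ler1n.
Qed.

Lemma design_cube_full :
  measurable [set w | design_cube w] /\ sample_law (d := d) n m sigma (~` [set w | design_cube w]) = 0%E.
Proof.
have null : (P \x normalR 0 sigma)%E (~` (cube `*` [set: R])) = 0%E.
  rewrite (_ : ~` _ = (~` cube) `*` [set: R]); last first.
    by apply/seteqP; split => -[x e] /=; [move=> H; split => // cx; exact: H|move=> [H _] []].
  apply: etrans (product_measure1E _ _ _ _) _ => //.
    by apply: measurableC; exact: measurable_cube.
  by rewrite [X in (X * _)%E](_ : _ = 0%E) ?mul0e//; exact: (@unif_cube R d).
have [mc1 c1] := prod_prob_forall (P := fun _ : 'I_n => (P \x normalR 0 sigma)%E : probability (T * R)%type R)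
  (A := fun _ => cube `*` [set: R]) (fun _ => measurableX (@measurable_cube R d) measurableT) (fun _ => null).
have [mc2 c2] := prod_prob_forall (P := fun _ : 'I_m => prod_prob (fun _ : 'I_n => (P \x normalR 0 sigma)%E : probability (T * R)%type R))
  (A := fun _ => [set s : n.-tuple (T * R) | forall i, (cube `*` [set: R]) (tnth s i)]) (fun _ => mc1) (fun _ => c1).
have E : [set w | design_cube w] = [set w : sample | forall k, [set s : n.-tuple (T * R) | forall i, (cube `*` [set: R]) (tnth s i)] (tnth w k)].
  by apply/seteqP; split => w /= H k i; [split => //; exact: H|have [] := H k i].
by rewrite E.
Qed.

Let a q (j : box d q) := shrink (@box_val q) (t / n%:R) j.

Let resid_L2 q : L2 := f0 - box_comb psi_basis psi_bound (fun j : box d q => a j * box_coef j).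

Let residE q x : resid (@box_fun q) (@box_val q) t n f0 (@box_coef q) x = (resid_L2 q : T -> R) x.
Proof.
rewrite /resid /resid_L2.
rewrite (_ : ((_ - _ : L2) : T -> R) x = (f0 : T -> R) x -
  (box_comb psi_basis psi_bound (fun j : box d q => a j * box_coef j) : T -> R) x)//.
by rewrite box_combE.
Qed.

Let box_dim_gt0 q : 0 < box_dim q.
Proof.
rewrite /box_dim (bigD1 [ffun=> ord0])//=; apply: ltr_pwDl.
  exact: (shrink_gt0 n_gt0 t_gt0 (@box_val_gt0 q)).
by apply: sumr_ge0 => j _; apply/ltW/(shrink_gt0 n_gt0 t_gt0 (@box_val_gt0 q)).
Qed.

(** The residual of the population regularisation has squared norm
    [tail q + box_bias q]. The noise moments come from [normalR_moments]. *)
Definition mean_bound q p tau : R :=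
  risk_val Cpsi (@box_val q) t n m (@box_coef q) (64 * sigma ^+ 2) (64 * sigma ^+ 4)
    (tail q + box_bias q) (tail q) (Cpsi * F1) p tau + tail q.

Lemma risk_int q p tau : 0 < tau ->
  (\int[sample_law n m sigma]_w (risk q w + tail q)%:E <= (mean_bound q p tau)%:E)%E.
Proof.
move=> tau0.
have tail0 : 0 <= tail q by exact: box_tail_ge0.
have mr : measurable_fun [set: sample] (risk q).
  apply: measurable_risk_bound; first exact: measurable_box_fun.
  exact: measurable_L2.
have r0 w : 0 <= risk q w.
  by apply: risk_bound_ge0 => //; [exact: box_val_gt0|exact: box_dim_gt0].
have [N0 N2 N4] := normalR_moments sigma_gt0.
rewrite /mean_bound EFinD; apply: int_add_le => //; last by rewrite integral_cstP.
have on j k : (\int[P]_x (box_fun j x * box_fun k x)%:E = ((j == k :> box d q)%:R)%:E)%E.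
  by rewrite (basis_fun_on psi_basis psi_bound) (inj_eq (@of_box_inj d q)).
apply: (risk_bound_int n_gt0 m_gt0 t_gt0 (@box_val_gt0 q) (@measurable_box_fun q)
  (@box_fun_le q) (measurable_L2 f0) on N0 N2 N4 (box_dim_gt0 q)) => //.
- move=> j; under eq_integral do rewrite residE.
  set c := _ - _.
  have ipE : ip (resid_L2 q) (basis_L2 psi_basis psi_bound (of_box j)) = c.
    by rewrite ipBl ip_box_comb.
  have I : P.-integrable [set: T] (fun x => (box_fun j x * (resid_L2 q : T -> R) x)%:E).
    have := integrable_mul (basis_L2 psi_basis psi_bound (of_box j)) (resid_L2 q).
    by under eq_fun do rewrite basis_L2E.
  have cI : P.-integrable [set: T] (fun=> (c)%:E) by exact: finite_measure_integrable_cst.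
  under eq_integral do rewrite EFinB.
  rewrite (integralB measurableT I cI) integral_cstP.
  rewrite (_ : (\int[P]_x (box_fun j x * (resid_L2 q : T -> R) x)%:E = c%:E)%E) ?subee//.
  rewrite -ipE ipC -ip_EFin; apply: eq_integral => x _.
  by rewrite basis_L2E.
- under eq_integral do rewrite residE.
  rewrite norm2_EFin lee_fin /resid_L2 norm2_sub_box_comb lerD2l /box_bias.
  apply: ler_sum => j _; rewrite -[leRHS]sqrrN opprB; exact: lexx.
- rewrite (_ : (fun x => _) = fun x => (((f0 - box_comb psi_basis psi_bound (@box_coef q) : L2) : T -> R) x ^+ 2)%:E).
    by rewrite norm2_EFin lee_fin -box_tailE.
  apply/funext => x; congr (_ ^+ 2)%:E.
  rewrite (_ : ((_ - _ : L2) : T -> R) x = (f0 : T -> R) x -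
    (box_comb psi_basis psi_bound (@box_coef q) : T -> R) x)//.
  by rewrite box_combE.
- move=> x; apply: le_trans (ler_norm_sum _ _ _) _.
  apply: (@le_trans _ _ (\sum_(j : box d q) Cpsi * `|box_coef j|)).
    by apply: ler_sum => j _; rewrite normrM mulrC; apply: ler_wpM2r => //; exact: box_fun_le.
  by rewrite -mulr_sumr; apply: ler_wpM2l; [exact: (Cpsi_ge0 psi_bound)|exact: coef_sum].
Qed.

Lemma expected_risk_le p (tau : nat -> R) : (forall q, 0 < tau q) ->
  (expect sigma f0 (fun D : data n m => cube_dist (global_mean K sigma D) f0 ^+ 2) <=
   limn_einf (fun q => (mean_bound q p (tau q))%:E))%E.
Proof.
move=> tau0; rewrite /expect.
have [mA A0] := design_cube_full.
have tail0 q : 0 <= tail q by exact: box_tail_ge0.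
have mr q : measurable_fun [set: sample] (risk q).
  apply: measurable_risk_bound; first exact: measurable_box_fun.
  exact: measurable_L2.
have r0 q w : 0 <= risk q w.
  by apply: risk_bound_ge0 => //; [exact: box_val_gt0|exact: box_dim_gt0].
have [N0 N2 N4] := normalR_moments sigma_gt0.
apply: (fatou_le mA A0 (f_ := fun q w => risk q w + tail q)).
- by move=> q; apply: measurable_funD.
- by move=> q w; rewrite addr_ge0.
- move=> w; rewrite /cube_dist /cube_norm L2_norm_sqr.
  by apply: integral_ge0 => x _; rewrite lee_fin sqr_ge0.
- by move=> w; exact: mean_risk_le.
by move=> q; exact: risk_int.
Qed.

Definition spread_bound q p : R :=
  2 * (t / n%:R) * (Cpsi ^+ 2 * box_dim q) +
  Cpsi ^+ 2 * kappa * bad_prob Cpsi (@box_val q) t n m p.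

(** The inequality of Markov for the squared distance to [f0], with
    [posterior_second_moment]. *)
Lemma expected_spread_le (Pi : data (R := R) (d := d) n m -> probability L2 R) a0 p
    (tau : nat -> R) :
  (forall q, 0 < tau q) ->
  (forall D : data n m, (forall k i, cube (design D k i)) ->
     global_posterior a0 K sigma D (Pi D)) ->
  forall e : R, 0 < e ->
  (expect sigma f0 (fun D : data n m => Pi D [set f : L2 | (e%:E < cube_dist f f0)%E]) <=
   limn_einf (fun q => ((e ^- 2) * (2 * mean_bound q p (tau q) + 512 * spread_bound q p))%:E))%E.
Proof.
move=> tau0 post e e0; rewrite /expect.
have [mA A0] := design_cube_full.
have tail0 q : 0 <= tail q by exact: box_tail_ge0.
have mr q : measurable_fun [set: sample] (risk q).
  apply: measurable_risk_bound; first exact: measurable_box_fun.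
  exact: measurable_L2.
have r0 q w : 0 <= risk q w.
  by apply: risk_bound_ge0 => //; [exact: box_val_gt0|exact: box_dim_gt0].
have mb q : measurable_fun [set: sample] (bad q).
  by apply: measurable_bad_mean; exact: measurable_box_fun.
have Mk : 0 <= Cpsi ^+ 2 * kappa by apply: mulr_ge0 => //; exact: sqr_ge0.
have v0 q w : 0 <= var_bound q w.
  apply: addr_ge0; last by apply: mulr_ge0 => //; exact: bad_mean_ge0.
  apply: mulr_ge0; first by rewrite mulr_ge0// divr_ge0// ltW.
  by apply: mulr_ge0 => //; exact: sqr_ge0.
have mv q : measurable_fun [set: sample] (var_bound q).
  by apply: measurable_funD => //; apply: measurable_funM.
have rt0 q w : 0 <= risk q w + tail q by exact: addr_ge0.
have n2 : 0 <= 2 :> R by exact: ler0n.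
have n512 : 0 <= 512 :> R by exact: ler0n.
have rv0 q w : 0 <= 2 * (risk q w + tail q) + 512 * var_bound q w.
  by apply: addr_ge0; [exact: mulr_ge0 n2 (rt0 q w)|exact: mulr_ge0 n512 (v0 q w)].
have mrt q : measurable_fun [set: sample] (fun w => 2 * (risk q w + tail q)).
  by apply: measurable_funM => //; exact: measurable_funD.
have m512 q : measurable_fun [set: sample] (fun w => 512 * var_bound q w).
  exact: measurable_funM.
have mrv q : measurable_fun [set: sample] (fun w => 2 * (risk q w + tail q) + 512 * var_bound q w).
  exact: measurable_funD.
have e2 : 0 <= e ^- 2 by rewrite invr_ge0 exprn_ge0// ltW.
have S w : design_cube w -> (Pi (observe f0 w) [set f : L2 | (e%:E < cube_dist f f0)%E] <=
    (e ^- 2)%:E * limn_einf (fun q => (2 * (risk q w + tail q) + 512 * var_bound q w)%:E))%E.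
  move=> wc; set D := observe f0 w.
  have dc k i : cube (design D k i) by rewrite design_observe.
  have -> : [set f : L2 | (e%:E < cube_dist f f0)%E] = [set f : L2 | (e%:E < L2_dist P f f0)%E].
    by apply/seteqP; split => f /=; rewrite cube_dist_L2.
  have mS := measurable_dist_gt f0 e.
  apply: (@le_trans _ _ ((e ^- 2)%:E * \int[Pi D]_f (norm2 (f - f0))%:E)%E); last first.
    apply: lee_wpmul2l; first by rewrite lee_fin.
    apply: le_trans (posterior_second_moment dc f0 (post D dc) (mean_var_le wc)) _.
    apply: le_trans (limn_einf_lin (fun q => rt0 q w) (fun q => v0 q w) n2 n512).
    apply: leeD; last exact: lexx.
    by apply: lee_wpmul2l; [rewrite lee_fin|exact: mean_risk_le].
  apply: (@le_trans _ _ (\int[Pi D]_f (e ^- 2 * norm2 (f - f0))%:E)%E); last first.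
    by apply: int_scale_le => //; [exact: measurable_norm2|move=> f; exact: norm2_ge0].
  rewrite -[X in Pi D X]setIT -integral_indic//; apply: int_le (lexx _).
    by move=> f; rewrite indicE.
  move=> f; rewrite indicE; case: (boolP (_ \in _)) => [/set_mem/=|_]; last first.
    by rewrite mulr_ge0// norm2_ge0.
  rewrite L2_dist_sqrt lte_fin => H.
  rewrite ler_pdivlMl ?exprn_gt0// mulr1 -[leRHS]sqr_sqrtr ?norm2_ge0//.
  by rewrite lerXn2r ?nnegrE ?sqrtr_ge0// ltW.
apply: (fatou_le mA A0 (f_ := fun q w => e ^- 2 * (2 * (risk q w + tail q) + 512 * var_bound q w))).
- by move=> q; apply: measurable_funM.
- by move=> q w; exact: mulr_ge0 e2 (rv0 q w).
- by move=> w.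
- move=> w wc; apply: le_trans (S w wc) _.
  have := limn_einf_lin (fun q => rv0 q w) (fun=> lexx (0 : R)) e2 (lexx 0).
  rewrite mul0e adde0 => /le_trans; apply; apply: limn_einf_le => q.
  by rewrite mul0r addr0.
move=> q; rewrite EFinM; apply: int_scale_le; [exact: mrv|exact: rv0|exact: e2|].
rewrite EFinD; apply: int_add_le; [exact: mrt|exact: m512| | | |].
- by move=> w; exact: mulr_ge0 n2 (rt0 q w).
- by move=> w; exact: mulr_ge0 n512 (v0 q w).
- rewrite EFinM; apply: int_scale_le; [exact: measurable_funD|exact: rt0|exact: n2|].
  exact: risk_int.
rewrite EFinM; apply: int_scale_le; [exact: mv|exact: v0|exact: n512|].
rewrite /var_bound /spread_bound EFinD; apply: int_add_le => //.
- exact: measurable_funM.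
- move=> w; apply: mulr_ge0; first by rewrite mulr_ge0// divr_ge0// ltW.
  by apply: mulr_ge0 => //; exact: sqr_ge0.
- by move=> w; apply: mulr_ge0 => //; exact: bad_mean_ge0.
- by rewrite integral_cstP.
rewrite EFinM; apply: int_scale_le => //; first by move=> w; exact: bad_mean_ge0.
have on j k : (\int[P]_x (box_fun j x * box_fun k x)%:E = ((j == k :> box d q)%:R)%:E)%E.
  by rewrite (basis_fun_on psi_basis psi_bound) (inj_eq (@of_box_inj d q)).
exact: (bad_mean_int (normalR 0 sigma) n_gt0 m_gt0 t_gt0 (@box_val_gt0 q) (@measurable_box_fun q)
  (@box_fun_le q) on (box_dim_gt0 q) p).
Qed.

End sample.

End posterior_bounds.

(** * Spectral sums *)

Section spectrum.
Context {R : realType} {d : nat}.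
Variables (lam : nat -> R) (C s : R).
Hypothesis C_gt0 : 0 < C.
Hypothesis s_ge : 3 <= s.
Hypothesis lam_decay : forall i : nat,
  C^-1 * i.+1%:R `^ (- s) <= lam i <= C * i.+1%:R `^ (- s).

Let E := C ^+ d.

Lemma decay_cst_ge1 : 1 <= C.
Proof.
have /andP[H1 H2] := lam_decay 0; have := le_trans H1 H2.
rewrite powR1/= !mulr1 => H.
have {}H : 1 <= C ^+ 2 by rewrite expr2 -ler_pdivrMl// mulr1.
by rewrite -(@expr_ge1 _ 2)// ltW.
Qed.

Let E_ge1 : 1 <= E. Proof. exact: exprn_ege1 decay_cst_ge1. Qed.
Let E_gt0 : 0 < E. Proof. exact: lt_le_trans E_ge1. Qed.

Lemma lam_pos i : 0 < lam i.
Proof.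
have /andP[H _] := lam_decay i; apply: lt_le_trans H.
by rewrite mulr_gt0 ?invr_gt0// powR_gt0.
Qed.

Let val_gt0 q (j : box d q) : 0 < box_val lam j.
Proof. by apply: prodr_gt0 => k _; exact: lam_pos. Qed.

Definition box_prod q (j : box d q) : R := idx_prod j.

Lemma box_prod_ge1 q (j : box d q) : 1 <= box_prod j.
Proof. exact: idx_prod_ge1. Qed.

Let box_prod_gt0 q (j : box d q) : 0 < box_prod j.
Proof. exact: lt_le_trans (box_prod_ge1 j). Qed.

Lemma powR_prod (I : finType) (a : I -> R) (r : R) : (forall i, 0 <= a i) ->
  (\prod_i a i) `^ r = \prod_i (a i `^ r).
Proof.
move=> a0; suff [] : (\prod_i a i) `^ r = \prod_i (a i `^ r) /\ 0 <= \prod_i a i by [].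
apply: (big_ind2 (fun x y => x `^ r = y /\ 0 <= x)).
- by rewrite powR1.
- by move=> x1 y1 x2 y2 [<- x10] [<- x20]; rewrite powRM// mulr_ge0.
- by move=> i _.
Qed.

Lemma box_val_bounds q (j : box d q) :
  E^-1 * box_prod j `^ (- s) <= box_val lam j <= E * box_prod j `^ (- s).
Proof.
have P : box_prod j `^ (- s) = \prod_k ((j k).+1%:R : R) `^ (- s).
  by rewrite /box_prod /idx_prod powR_prod.
have cst (c : R) : c ^+ d * \prod_k ((j k).+1%:R : R) `^ (- s) =
    \prod_k (c * ((j k).+1%:R : R) `^ (- s)).
  by rewrite big_split/= prodr_const card_ord.
rewrite P /E -exprVn !cst /box_val /prod_val; apply/andP; split; apply: ler_prod => k _.
  rewrite ffunE mulr_ge0 ?invr_ge0 ?(ltW C_gt0) ?powR_ge0//=.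
  by case/andP: (lam_decay (j k)).
rewrite ffunE (ltW (lam_pos _))/=.
by case/andP: (lam_decay (j k)).
Qed.

Lemma sum_inv_sqr q : \sum_(j : box d q) box_prod j ^- 2 <= 4 ^+ d.
Proof.
have := @multi_sum_sqr R d q.+1 1 ltr01; rewrite expr1n mulr1; apply: le_trans.
apply: ler_sum => j _; rewrite /trunc2 div1r exprVn.
by rewrite le_min lexx andbT invf_le1 ?exprn_gt0// exprn_ege1// box_prod_ge1.
Qed.

Let pow_le_inv_sqr q (j : box d q) r : 2 <= r -> box_prod j `^ (- r) <= box_prod j ^- 2.
Proof.
move=> r2; rewrite -powR_mulrn ?(ltW (box_prod_gt0 j))// -powRN.
by apply: (ler_powR (box_prod_ge1 j)); rewrite lerN2.
Qed.

Definition trace_bound := E * 4 ^+ d.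

Lemma box_val_sum q : \sum_(j : box d q) box_val lam j <= trace_bound.
Proof.
apply: (@le_trans _ _ (\sum_(j : box d q) E * box_prod j ^- 2)).
  apply: ler_sum => j _; have /andP[_ H] := box_val_bounds j.
  apply: le_trans H _; apply: ler_wpM2l; first exact: ltW.
  by apply: pow_le_inv_sqr; apply: le_trans s_ge; lra.
by rewrite -mulr_sumr; apply: ler_wpM2l; [exact: ltW|exact: sum_inv_sqr].
Qed.

(** A shrinkage factor is at most [1] and at most the eigenvalue divided by the
    regularisation; since [s >= 2], the latter is at most [E] times the square
    of [x / box_prod j] when this ratio is at most [1]. *)
Lemma box_dim_le (x : R) q : 0 < x ->
  \sum_(j : box d q) shrink (@box_val R d lam q) (x `^ (- s)) j <= E * multi_sum d q.+1 x.
Proof.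
move=> x0; rewrite /multi_sum mulr_sumr; apply: ler_sum => j _.
have l0 : 0 < x `^ (- s) by exact: powR_gt0.
have m0 := val_gt0 j.
have m1 : shrink (@box_val R d lam q) (x `^ (- s)) j <= 1.
  by rewrite /shrink ler_pdivrMr ?addr_gt0// mul1r lerDl ltW.
pose y := x / box_prod j.
have y0 : 0 < y by rewrite divr_gt0.
have sE : E^-1 * shrink (@box_val R d lam q) (x `^ (- s)) j <= 1.
  by rewrite ler_pdivrMl// mulr1; exact: le_trans m1 E_ge1.
rewrite /trunc2 -/(box_prod j) -/y -ler_pdivrMl// le_min sE/=.
have [yl|/ltW y1] := leP y 1; last by apply: le_trans sE _; exact: exprn_ege1.
rewrite ler_pdivrMl//.
apply: (@le_trans _ _ (box_val lam j / x `^ (- s))).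
  rewrite /shrink; apply: ler_wpM2l; first exact: ltW.
  by rewrite lef_pV2 ?posrE ?addr_gt0// lerDr ltW.
rewrite ler_pdivrMr// -mulrA; have /andP[_ H] := box_val_bounds j.
apply: le_trans H _; apply: ler_wpM2l; first exact: ltW.
have -> : box_prod j `^ (- s) = y `^ s * x `^ (- s).
  have -> : box_prod j = x * y^-1 by rewrite /y invfM invrK mulrA mulfV ?mul1r// gt_eqF.
  rewrite powRM ?invr_ge0 ?ltW// mulrC; congr (_ * _).
  by rewrite -powR_inv1 ?ltW// -powRrM mulN1r opprK.
apply: ler_wpM2r; first exact: ltW.
rewrite -powR_mulrn ?(ltW y0)//; apply: ger_powR; first by rewrite y0.
by apply: le_trans s_ge; lra.
Qed.

(** The regularisation bias. The factor [1 - a_j] is at most [1], and at most [E]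
    times [(box_prod j / x) ^ s] by the lower bound on the eigenvalues; both are
    dominated by the power [s - 1], which is the one that the weights of the
    ellipsoid compensate by [ellipsoid_weight]. *)
Lemma shrink_bias_le (x : R) q (j : box d q) : 0 < x ->
  (1 - shrink (@box_val R d lam q) (x `^ (- s)) j) ^+ 2 <=
  E * x `^ (- (s - 1)) * box_prod j `^ (s - 1).
Proof.
move=> x0; have l0 : 0 < x `^ (- s) by exact: powR_gt0.
have m0 := val_gt0 j.
set r := 1 - _.
have rE : r = x `^ (- s) / (box_val lam j + x `^ (- s)).
  by rewrite /r /shrink; field; rewrite gt_eqF// addr_gt0.
have r0 : 0 <= r by rewrite rE divr_ge0 ?addr_ge0// ltW.
have r1 : r <= 1 by rewrite rE ler_pdivrMr ?addr_gt0// mul1r lerDr ltW.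
have rr : r ^+ 2 <= r by rewrite expr2 ler_piMl.
pose z := box_prod j / x.
have z0 : 0 < z by rewrite divr_gt0.
have -> : E * x `^ (- (s - 1)) * box_prod j `^ (s - 1) = E * z `^ (s - 1).
  rewrite -mulrA; congr (_ * _); rewrite /z powRM ?invr_ge0 ?(ltW x0) ?(ltW (box_prod_gt0 j))//.
  by rewrite mulrC -powR_inv1 ?(ltW x0)// -powRrM mulN1r.
have [z1|z1] := leP z 1; last first.
  apply: le_trans rr _; apply: le_trans r1 _; rewrite -[leLHS]mulr1; apply: ler_pM => //.
  rewrite -[leLHS](congr1 (fun f => f (s - 1)) (powR1 R)).
  apply: ge0_ler_powR; rewrite ?nnegrE ?(ltW z0) ?(ltW z1)//.
  by have := s_ge; lra.
apply: le_trans rr _.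
apply: (@le_trans _ _ (E * z `^ s)); last first.
  apply: ler_wpM2l; first exact: ltW.
  by apply: ger_powR; [rewrite z0|lra].
rewrite rE ler_pdivrMr ?addr_gt0//.
have /andP[H _] := box_val_bounds j.
apply: (@le_trans _ _ (E * z `^ s * (E^-1 * box_prod j `^ (- s)))); last first.
  apply: ler_wpM2l; first by rewrite mulr_ge0 ?powR_ge0// ltW.
  by apply: le_trans H _; rewrite lerDl ltW.
rewrite mulrACA mulfV ?mul1r ?gt_eqF// /z powRM ?invr_ge0 ?(ltW x0) ?(ltW (box_prod_gt0 j))//.
rewrite mulrAC -powRD ?subrr ?powRr0 ?mul1r; last by rewrite (gt_eqF (box_prod_gt0 j)) implybT.
by rewrite -powR_inv1 ?(ltW x0)// -powRrM mulN1r.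
Qed.

End spectrum.

Section ellipsoid.
Context {R : realType} {d : nat}.
Variables (psi : nat -> R -> R) (Cpsi beta B : R).
Hypothesis d_gt0 : (0 < d)%N.
Hypothesis psi_basis : orthonormal_basis (prod_fun (d := d) psi).
Hypothesis psi_bound : forall (j : multi_index (d := d)) (t : d.-tuple R),
  cube t -> `|prod_fun psi j t| <= Cpsi.
Hypothesis beta_ge0 : 0 <= beta.
Variable f0 : L2 (unif R d).
Hypothesis f0_Theta : Theta (prod_fun psi) beta B f0.

Local Notation coef := (box_coef psi_basis psi_bound f0).

Lemma Theta_box q : \sum_(j : box d q)
   ((\sum_(i < d) ((j i).+1%:R : R) ^+ 2) `^ beta * coef j ^+ 2) <= B ^+ 2.
Proof.
pose g (j : @multi_index d) : \bar R := ((\sum_(i < d) ((j i).+1%:R : R) ^+ 2) `^ beta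
  * inner f0 (prod_fun psi j) ^+ 2)%:E.
have g0 j : (0 <= g j)%E by rewrite lee_fin mulr_ge0 ?powR_ge0 ?sqr_ge0.
rewrite -lee_fin; apply: le_trans f0_Theta.
rewrite -sumEFin.
have -> : (\sum_(j : box d q) ((\sum_(i < d) ((j i).+1%:R : R) ^+ 2) `^ beta * coef j ^+ 2)%:E =
   \sum_(j <- box_set d q) g j)%E.
  rewrite big_imfset/=; last by move=> i j _ _; exact: of_box_inj.
  rewrite undup_id ?enum_uniq// big_enum; apply: eq_bigr => j _.
  rewrite /g (inner_ip psi_basis psi_bound (g := f0))//; congr (_ `^ _ * _)%:E.
  by apply: eq_bigr => i _; rewrite ffunE.
apply: esum_ge; exists [set` box_set d q]; first by split=> //; exact: finite_fset.
by rewrite fsbig_finite//= set_fsetK.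
Qed.

(** Every factor of the product is at most the Euclidean norm of the
    multi-index. *)
Lemma ellipsoid_weight q (j : box d q) :
  box_prod j `^ (2 * beta / d%:R) <= (\sum_(i < d) ((j i).+1%:R : R) ^+ 2) `^ beta.
Proof.
have d0 : 0 < d%:R :> R by rewrite ltr0n.
set S := \sum_(i < d) _.
have S0 : 0 <= S by apply: sumr_ge0 => i _; exact: sqr_ge0.
have P1 := box_prod_ge1 (R := R) j.
have P0 : 0 <= box_prod j :> R by apply: le_trans P1.
have H : box_prod j `^ (2 / d%:R) <= S.
  have le1 (i : 'I_d) : ((j i).+1%:R : R) <= Num.sqrt S.
    rewrite -[leLHS]ger0_norm// -sqrtr_sqr ler_sqrt// /S (bigD1 i)//= lerDl.
    by apply: sumr_ge0 => k _; exact: sqr_ge0.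
  have le2 : box_prod j <= Num.sqrt S ^+ d.
    rewrite -[X in _ ^+ X](card_ord d) -prodr_const; apply: ler_prod => i _.
    by rewrite ler0n le1.
  have le3 : box_prod j `^ (2 / d%:R) <= (Num.sqrt S ^+ d) `^ (2 / d%:R).
    apply: ge0_ler_powR le2; rewrite ?nnegrE ?exprn_ge0 ?sqrtr_ge0//.
  apply: le_trans le3 _; rewrite -powR_mulrn ?sqrtr_ge0// -powRrM.
  by rewrite mulrCA mulfV ?gt_eqF// mulr1 powR_mulrn ?sqrtr_ge0// sqr_sqrtr.
rewrite (_ : 2 * beta / d%:R = 2 / d%:R * beta); last by rewrite mulrAC.
by rewrite powRrM; apply: ge0_ler_powR H => //; rewrite ?nnegrE ?powR_ge0.
Qed.

Lemma weighted_coef_le q : \sum_(j : box d q) box_prod j `^ (2 * beta / d%:R) * coef j ^+ 2 <= B ^+ 2.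
Proof.
apply: le_trans (Theta_box q); apply: ler_sum => j _; apply: ler_wpM2r; first exact: sqr_ge0.
exact: ellipsoid_weight.
Qed.

(** The inequality of Cauchy and Schwarz, as the inverse squares of the products
    are summable; it is completed by [S <= S^2 + 1]. *)
Lemma coef_abs_sum q : 2 <= 2 * beta / d%:R ->
  \sum_(j : box d q) `|coef j| <= B ^+ 2 * 4 ^+ d + 1.
Proof.
move=> b2; set S := \sum_(j : box d q) _.
have w0 (j : box d q) : 0 < box_prod j `^ (2 * beta / d%:R).
  by apply: powR_gt0; apply: lt_le_trans (box_prod_ge1 j).
have H : S ^+ 2 <= B ^+ 2 * 4 ^+ d.
  have := Cauchy_Schwarz_weighted (fun j => `|coef j|) (fun=> 1) w0.
  under eq_bigr do rewrite mulr1.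
  move=> /le_trans; apply; apply: ler_pM.
  - by apply: sumr_ge0 => j _; rewrite mulr_ge0 ?sqr_ge0// ltW.
  - by apply: sumr_ge0 => j _; rewrite divr_ge0 ?sqr_ge0// ltW.
  - by under eq_bigr do rewrite real_normK ?num_real//; exact: weighted_coef_le.
  apply: le_trans (@sum_inv_sqr R d q); apply: ler_sum => j _; rewrite expr1n div1r.
  have P0 : 0 < box_prod j :> R by apply: lt_le_trans (box_prod_ge1 j).
  rewrite lef_pV2 ?posrE ?exprn_gt0// -powR_mulrn ?(ltW P0)//.
  by apply: ler_powR => //; exact: box_prod_ge1.
have : 0 <= (S - 1) ^+ 2 by exact: sqr_ge0.
by move: H; move: (B ^+ 2 * _) => X; nra.
Qed.

Lemma coef_sqr_sum q : \sum_(j : box d q) coef j ^+ 2 <= B ^+ 2.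
Proof.
apply: le_trans (weighted_coef_le q); apply: ler_sum => j _.
rewrite -[leLHS]mul1r; apply: ler_wpM2r; first exact: sqr_ge0.
have e0 : 0 <= 2 * beta / d%:R by rewrite !mulr_ge0 ?invr_ge0.
rewrite -[leLHS](powRr0 (box_prod j)); apply: ler_powR e0; exact: box_prod_ge1.
Qed.

End ellipsoid.

(** * Size of the bounds *)

Section bound_size.
Context {R : realType} {J : finType}.
Variables (M : R) (mu : J -> R) (t : R) (n m : nat) (fc : J -> R).
Variables (v F tail c1 d0 s0 b2 w1 g : R) (p : nat).
Hypothesis n_gt0 : (0 < n)%N.
Hypothesis m_gt0 : (0 < m)%N.
Hypothesis t_gt0 : 0 < t.
Hypothesis mu_gt0 : forall j, 0 < mu j.

Let a := shrink mu (t / n%:R).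
Let D := \sum_j a j.
Let N : R := (n * m)%:R.
Let S := \sum_j (fc j - a j * fc j) ^+ 2.
Let W := coef_weight M mu t n.
Let pb := bad_prob M mu t n m p.

Hypothesis v_ge0 : 0 <= v.
Hypothesis v_le : v <= N.
Hypothesis tail_ge0 : 0 <= tail.
Hypothesis D_n : D / n%:R <= c1.
Hypothesis D_v : D * (v / N) <= d0.
Hypothesis W_le : W <= w1 * N ^+ 2.
Hypothesis S_le : S <= s0.
Hypothesis fc_le : \sum_j fc j ^+ 2 <= b2.
Hypothesis pb_le : pb <= g / N ^+ 12.
Hypothesis g_ge0 : 0 <= g.

Definition risk_cst : R := 3 * (4 * F ^+ 2 * w1 * g + 2 * b2 * g + (w1 + M ^+ 2 * c1) * (g + 64)).
Definition tail_cst : R := 3 * (8 * M ^+ 2 * c1 + 4 * w1 * N ^+ 3).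

Let u := N^-1.

Let n1 : 1 <= n%:R :> R. Proof. by rewrite ler1n. Qed.
Let m1 : 1 <= m%:R :> R. Proof. by rewrite ler1n. Qed.
Let n0 : 0 < n%:R :> R. Proof. exact: lt_le_trans n1. Qed.
Let m0 : 0 < m%:R :> R. Proof. exact: lt_le_trans m1. Qed.
Let NE : N = n%:R * m%:R. Proof. by rewrite /N natrM. Qed.
Let N1 : 1 <= N. Proof. by rewrite NE -[leLHS]mulr1; apply: ler_pM. Qed.
Let N0 : 0 < N. Proof. exact: lt_le_trans N1. Qed.
Let nN : n%:R <= N. Proof. by rewrite NE ler_peMr// ltW. Qed.
Let u0 : 0 < u. Proof. by rewrite invr_gt0. Qed.
Let u1 : u <= 1. Proof. by rewrite invf_le1. Qed.

Let a_gt0 j : 0 < a j. Proof. exact: shrink_gt0. Qed.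
Let a_le1 j : a j <= 1. Proof. exact: shrink_le1. Qed.
Let D_ge0 : 0 <= D. Proof. by apply: sumr_ge0 => j _; exact: ltW. Qed.
Let S_ge0 : 0 <= S. Proof. by apply: sumr_ge0 => j _; exact: sqr_ge0. Qed.
Let M2 : 0 <= M ^+ 2. Proof. exact: sqr_ge0. Qed.
Let F2 : 0 <= F ^+ 2. Proof. exact: sqr_ge0. Qed.
Let SF_ge0 : 0 <= \sum_j fc j ^+ 2. Proof. by apply: sumr_ge0 => j _; exact: sqr_ge0. Qed.
Let W_ge0 : 0 <= W.
Proof.
apply: mulr_ge0; first by apply: sumr_ge0 => j _; exact: sqr_ge0.
by apply: divr_ge0; [apply: mulr_ge0; [exact: sqr_ge0|exact: ler0n]|exact: sqr_ge0].
Qed.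
Let c1_ge0 : 0 <= c1. Proof. by apply: le_trans D_n; rewrite divr_ge0. Qed.
Let w1_ge0 : 0 <= w1.
Proof. by rewrite -(pmulr_lge0 _ (exprn_gt0 2 N0)); exact: le_trans W_le. Qed.

Let sum_cst (z : R) : \sum_(i < n) z = n%:R * z.
Proof. by rewrite sumr_const card_ord mulr_natl. Qed.

Let upow k : (0 < k)%N -> u ^+ k <= u.
Proof.
case: k => // k _; rewrite exprS ler_piMr ?(ltW u0)//.
by apply: exprn_ile1; rewrite ?(ltW u0).
Qed.

Let Nu k l : (k < l)%N -> N ^+ k * u ^+ l <= u.
Proof.
move=> kl; have -> : l = (k + (l - k))%N by rewrite subnKC// ltnW.
rewrite exprD mulrA -exprMn mulfV ?gt_eqF// expr1n mul1r.
by apply: upow; rewrite subn_gt0.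
Qed.

Let pbu : pb <= g * u ^+ 12. Proof. by rewrite /u exprVn. Qed.

Let nW : n%:R * W <= w1 * N ^+ 3.
Proof.
have -> : w1 * N ^+ 3 = N * (w1 * N ^+ 2) by ring.
by apply: ler_pM => //; exact: ltW.
Qed.

Let nW_ge0 : 0 <= n%:R * W. Proof. by apply: mulr_ge0 => //; exact: ltW. Qed.

Let w_pow (x : R) k : 0 <= x -> (3 < k)%N -> n%:R * W * (x * u ^+ k) <= w1 * x * u.
Proof.
move=> x0 k3.
apply: (@le_trans _ _ (w1 * N ^+ 3 * (x * u ^+ k))).
  by apply: ler_wpM2r => //; rewrite mulr_ge0 ?exprn_ge0 ?(ltW u0).
have -> : w1 * N ^+ 3 * (x * u ^+ k) = w1 * x * (N ^+ 3 * u ^+ k) by ring.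
by apply: ler_wpM2l; [exact: mulr_ge0|exact: Nu].
Qed.

Let bias_part : bias_val M mu t n m fc (tail + S) tail F p <=
  8 * M ^+ 2 * c1 * (s0 + tail) + 2 * s0 + 4 * F ^+ 2 * w1 * g * u + 4 * w1 * N ^+ 3 * tail
  + 2 * b2 * g * u.
Proof.
rewrite /bias_val -mulr_suml -/a -/D -/S -/W -/pb sum_cst.
have B1 : 8 * (D * (M ^+ 2 * (tail + S) / n%:R)) <= 8 * M ^+ 2 * c1 * (s0 + tail).
  have -> : 8 * (D * (M ^+ 2 * (tail + S) / n%:R)) = 8 * M ^+ 2 * ((D / n%:R) * (tail + S)) by ring.
  rewrite -[leRHS]mulrA; apply: ler_wpM2l; first by rewrite mulr_ge0.
  apply: ler_pM => //; [by rewrite divr_ge0|exact: addr_ge0|].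
  by rewrite addrC lerD2r.
have B2 : 2 * W * (n%:R * (2 * F ^+ 2 * pb + 2 * tail)) <=
    4 * F ^+ 2 * w1 * g * u + 4 * w1 * N ^+ 3 * tail.
  have -> : 2 * W * (n%:R * (2 * F ^+ 2 * pb + 2 * tail)) =
    4 * F ^+ 2 * (n%:R * W * pb) + 4 * (n%:R * W) * tail by ring.
  apply: lerD; last first.
    rewrite -[leRHS]mulrA -[leLHS]mulrA -[leRHS]mulrA; apply: ler_wpM2l => //.
    by rewrite mulrA; apply: ler_wpM2r.
  have -> : 4 * F ^+ 2 * w1 * g * u = 4 * F ^+ 2 * (w1 * g * u) by ring.
  apply: ler_wpM2l; first by rewrite mulr_ge0.
  by apply: le_trans (ler_wpM2l nW_ge0 pbu) _; exact: w_pow.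
have B3 : 2 * (\sum_j fc j ^+ 2) * pb <= 2 * b2 * g * u.
  apply: (@le_trans _ _ (2 * (\sum_j fc j ^+ 2) * (g * u))).
    apply: ler_wpM2l; first by rewrite mulr_ge0.
    by apply: le_trans pbu _; apply: ler_wpM2l => //; exact: upow.
  rewrite -[leRHS]mulrA; apply: ler_wpM2r; first by rewrite mulr_ge0 ?(ltW u0).
  by rewrite ler_pM2l.
apply: le_trans (lerD (lerD B1 (ler_wpM2l _ S_le)) (lerD B2 B3)) _ => //.
by rewrite !addrA.
Qed.

Let d_part : D * (M ^+ 2 * (64 * v) / n%:R / m%:R) <= 64 * M ^+ 2 * d0.
Proof.
have -> : D * (M ^+ 2 * (64 * v) / n%:R / m%:R) = 64 * M ^+ 2 * (D * (v / N)).
  by rewrite NE; field; rewrite !gt_eqF.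
by apply: ler_wpM2l D_v; rewrite mulr_ge0.
Qed.

Let noise_part : noise_val M mu t n m (64 * v) (64 * v ^+ 2) p (N ^+ 7) <=
  64 * M ^+ 2 * d0 + (w1 + M ^+ 2 * c1) * (g + 64) * u.
Proof.
rewrite /noise_val -mulr_suml -/a -/D -/W -/pb sum_cst.
apply: lerD.
  by apply: le_trans d_part; rewrite le_eqVlt; apply/orP; left; apply/eqP; ring.
set Q := N ^+ 7 * pb + _.
have Qle : Q <= (g + 64) * u ^+ 5.
  have E5 : (g + 64) * u ^+ 5 = N ^+ 7 * (g * u ^+ 12) + u ^+ 7 * (64 * N ^+ 2).
    have Nu1 : N * u = 1 by rewrite mulfV// gt_eqF.
    have -> : N ^+ 7 * (g * u ^+ 12) = g * ((N * u) ^+ 7 * u ^+ 5) by ring.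
    have -> : u ^+ 7 * (64 * N ^+ 2) = 64 * ((N * u) ^+ 2 * u ^+ 5) by ring.
    by rewrite Nu1 !expr1n !mul1r mulrDl.
  rewrite E5; apply: lerD; first by apply: ler_wpM2l => //; exact/exprn_ge0/ltW.
  rewrite /u exprVn; apply: ler_wpM2l; first by rewrite invr_ge0; exact/exprn_ge0/ltW.
  by apply: ler_wpM2l => //; rewrite lerXn2r ?nnegrE// ltW.
have -> : (2 * W + 2 * (M ^+ 2 * D / n%:R)) * (n%:R * (2^-1 * Q)) =
  n%:R * W * Q + M ^+ 2 * (D / n%:R) * n%:R * Q by field; rewrite gt_eqF.
rewrite -[leRHS]mulrA [leRHS]mulrDl; apply: lerD.
  apply: le_trans (ler_wpM2l nW_ge0 Qle) _.
  by rewrite [leRHS]mulrA; apply: w_pow => //; exact: addr_ge0.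
have h0 : 0 <= M ^+ 2 * (D / n%:R) * n%:R by apply: mulr_ge0 => //; apply: mulr_ge0 => //; exact: divr_ge0.
apply: le_trans (ler_wpM2l h0 Qle) _.
apply: (@le_trans _ _ (M ^+ 2 * c1 * N * ((g + 64) * u ^+ 5))).
  apply: ler_wpM2r; first by rewrite mulr_ge0 ?exprn_ge0 ?(ltW u0)// addr_ge0.
  apply: ler_pM => //; last exact: ler_wpM2l.
  by apply: mulr_ge0 => //; exact: divr_ge0.
have -> : M ^+ 2 * c1 * N * ((g + 64) * u ^+ 5) = M ^+ 2 * c1 * (g + 64) * (N ^+ 1 * u ^+ 5) by ring.
rewrite [leRHS]mulrA; apply: ler_wpM2l; last exact: Nu.
by apply: mulr_ge0; [exact: mulr_ge0|exact: addr_ge0].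
Qed.

(** On the bad event, the crude bounds have weight at most [n * W], of order
    [N ^ 3], against a probability of order [N ^ (- 12)]. With [tau = N ^ 7] both
    terms of [bad_noise] are of order [N ^ (- 5)]: the first one is
    [N ^ 7 * N ^ (- 12)], and the second one is [N ^ (- 7) * v ^ 2] with
    [v <= N]. All these contributions are thus at most of order [1 / N]. The
    factor [64] is that of [normalR_moments]. *)
Lemma risk_val_le :
  risk_val M mu t n m fc (64 * v) (64 * v ^+ 2) (tail + S) tail F p (N ^+ 7) <=
  3 * (8 * M ^+ 2 * c1 + 2) * s0 + 384 * M ^+ 2 * d0 + risk_cst / N + tail_cst * tail.
Proof.
have mean (z : R) : m%:R^-1 * (\sum_(k < m) z) = z.
  by rewrite sumr_const card_ord -[z *+ m]mulr_natl mulrA mulVf ?mul1r// gt_eqF.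
rewrite /risk_val !mean.
have last : \sum_j a j ^+ 2 * (M ^+ 2 * (64 * v) / n%:R / m%:R) <= 64 * M ^+ 2 * d0.
  apply: le_trans d_part; rewrite /D mulr_suml; apply: ler_sum => j _.
  apply: ler_wpM2r; first by rewrite !divr_ge0// mulr_ge0// mulr_ge0.
  by rewrite expr2 ler_piMl// ltW.
have three : 0 <= 3 :> R by [].
apply: le_trans (ler_wpM2l three (lerD (lerD bias_part noise_part) last)) _.
rewrite /risk_cst /tail_cst -/u le_eqVlt; apply/orP; left; apply/eqP; ring.
Qed.

End bound_size.

(** * Asymptotics *)

(** This is [ln y <= y - 1] for the root [y] of order [k] of [x]. *)
Lemma log_pow_le {R : realType} (x : R) k : (0 < k)%N -> 1 <= x ->
  (1 + ln x) ^+ k <= k%:R ^+ k * x.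
Proof.
move=> k0 x1; have x0 : 0 < x by exact: lt_le_trans x1.
have k1 : 1 <= k%:R :> R by rewrite ler1n.
have kk : k%:R != 0 :> R by rewrite gt_eqF// (lt_le_trans _ k1).
pose y := x `^ k%:R^-1.
have y0 : 0 < y by exact: powR_gt0.
have yk : y ^+ k = x by rewrite /y -powR_mulrn ?powR_ge0// -powRrM mulVf// powRr1// ltW.
have ly : ln x = k%:R * ln y by rewrite /y ln_powR mulrA mulfV// mul1r.
have lny : ln y <= y - 1.
  have := @le_ln1Dx R (y - 1); rewrite (_ : 1 + (y - 1) = y); last by ring.
  by apply; rewrite ltrBDl addrN.
have l0 : 0 <= ln x by exact: ln_ge0.
rewrite -{2}yk -exprMn lerXn2r ?nnegrE ?addr_ge0 ?mulr_ge0 ?(ltW y0)//.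
have : k%:R * ln y <= k%:R * (y - 1) by rewrite ler_pM2l// (lt_le_trans _ k1).
by rewrite ly; move: (k%:R * ln y) => z; rewrite mulrBr mulr1; lra.
Qed.

Section sample_size.
Context {R : realType} {d : nat}.
Variables (psi : nat -> R -> R) (lam : nat -> R) (Cpsi beta B C c0 cD : R).
Hypothesis d_gt0 : (0 < d)%N.
Hypothesis psi_basis : orthonormal_basis (prod_fun (d := d) psi).
Hypothesis psi_bound : forall (j : multi_index (d := d)) (t : d.-tuple R),
  cube t -> `|prod_fun psi j t| <= Cpsi.
Hypothesis beta_ge : 3%:R * d%:R / 2%:R <= beta.
Hypothesis C_gt0 : 0 < C.
Let s : R := 1 + 2 * beta / d%:R.
Hypothesis lam_decay : forall i : nat,
  C^-1 * i.+1%:R `^ (- s) <= lam i <= C * i.+1%:R `^ (- s).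
Hypothesis c0_gt0 : 0 < c0.
Hypothesis cD_gt0 : 0 < cD.
Hypothesis cD_le : forall q (x : R), 1 <= x ->
  multi_sum d q x <= cD * x * (1 + ln x) ^+ d.-1.

Let E := C ^+ d.
Let kappa : R := trace_bound (d := d) C.
(* Up to constants, [m * D ^ 2 / n = m ^ 2 * D ^ 2 / N] is at most
   [N ^ (- 3 d / (2 beta)) * x ^ 3] with [x] at most of order [N ^ (1 / s)]; one
   factor [x] absorbs the logarithms. *)
Let delta : R := 3 * d%:R / (2 * beta) - 3 * s^-1.

(** The moment of the Gram deviation for which the bad event has probability of
    order [N ^ (- 12)]. *)
Definition gram_power : nat := Num.bound (12 / delta).
Definition gram_size : R := (E * cD) ^+ 2 * ((2 * d)%:R ^+ (2 * d) * (c0^-1) `^ (3 * s^-1)).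
Definition bad_size : R := 4 ^+ gram_power * (gram_cst Cpsi gram_power * gram_size ^+ gram_power).
Definition weight_size : R := kappa ^+ 2 * Cpsi ^+ 2 / c0 ^+ 2.

Variables (n m : nat) (sigma : R).
Hypothesis n_gt0 : (0 < n)%N.
Hypothesis m_gt0 : (0 < m)%N.
Hypothesis sigma_gt0 : 0 < sigma.
Hypothesis sigma_lb : c0 <= sigma ^+ 2.
Let N : R := (n * m)%N%:R.
Let Neff : R := N / sigma ^+ 2.
Hypothesis Neff_ge : expR 1 <= Neff.
Hypothesis m_le : m%:R <= N `^ ((2%:R * beta - 3%:R * d%:R) / (4%:R * beta)).

Let d0 : 0 < d%:R :> R. Proof. by rewrite ltr0n. Qed.
Let d1 : 1 <= d%:R :> R. Proof. by rewrite ler1n. Qed.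
Let beta0 : 0 < beta.
Proof. by apply: lt_le_trans beta_ge; rewrite divr_gt0// mulr_gt0. Qed.
Let ratio : 3 <= 2 * beta / d%:R.
Proof. by rewrite ler_pdivlMr//; have := beta_ge; lra. Qed.
Let s_ge : 3 <= s. Proof. by rewrite /s; have := ratio; lra. Qed.
Let s0 : 0 < s. Proof. by apply: lt_le_trans s_ge. Qed.
Let sE : s^-1 = d%:R / (d%:R + 2 * beta).
Proof. by rewrite /s; field; rewrite !gt_eqF// addr_gt0// mulr_gt0. Qed.

Let delta_gt0 : 0 < delta.
Proof.
rewrite /delta sE subr_gt0 mulrA.
rewrite ltr_pM2l ?mulr_gt0// ltf_pV2 ?posrE ?addr_gt0 ?mulr_gt0//.
by rewrite ltrDr.
Qed.

Let E_gt0 : 0 < E. Proof. exact: exprn_gt0. Qed.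
Let v_gt0 : 0 < sigma ^+ 2. Proof. exact: exprn_gt0. Qed.
Let N1 : 1 <= N. Proof. by rewrite ler1n muln_gt0 n_gt0. Qed.
Let N0 : 0 < N. Proof. exact: lt_le_trans N1. Qed.
Let NE : N = n%:R * m%:R. Proof. by rewrite /N natrM. Qed.
Let n0 : 0 < n%:R :> R. Proof. by rewrite ltr0n. Qed.
Let m0 : 0 < m%:R :> R. Proof. by rewrite ltr0n. Qed.
Let Neff0 : 0 < Neff. Proof. exact: divr_gt0. Qed.
Let ln1 : 1 <= ln Neff.
Proof. by rewrite -[leLHS]expRK ler_ln ?posrE ?expR_gt0. Qed.
Let Neff1 : 1 <= Neff.
Proof. by apply: le_trans Neff_ge; apply: le_trans (expR_ge1Dx 1); rewrite lerDl. Qed.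
Let v_le : sigma ^+ 2 <= N.
Proof. by move: Neff1; rewrite /Neff ler_pdivlMr// mul1r. Qed.

(* The regularisation is [x ^ (- s)]: the eigenvalues of multi-indices with
   product [x] are of its order. *)
Let x := Neff `^ s^-1.
Let x0 : 0 < x. Proof. exact: powR_gt0. Qed.
Let x1 : 1 <= x.
Proof.
rewrite -[leLHS](powRr0 Neff); apply: ler_powR => //.
by rewrite invr_ge0 ltW.
Qed.

Let xs : ridge_reg sigma m / n%:R = x `^ (- s).
Proof.
rewrite /x -powRrM mulrN mulVf ?gt_eqF// powR_inv1 ?(ltW Neff0)//.
by rewrite /ridge_reg /Neff NE; field; rewrite !gt_eqF.
Qed.

Definition rate_log : R :=
  Neff `^ (- (2%:R * beta) / (2%:R * beta + d%:R)) * ln Neff ^+ d.-1.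

Let rate := Neff `^ (- (2%:R * beta) / (2%:R * beta + d%:R)).

Let rateE : x `^ (- (s - 1)) = rate.
Proof.
rewrite /x /rate -powRrM; congr (_ `^ _); rewrite sE /s.
by field; rewrite !gt_eqF// addr_gt0// mulr_gt0.
Qed.

Let rate_ge0 : 0 <= rate. Proof. exact: powR_ge0. Qed.

Let L1 : 1 <= ln Neff ^+ d.-1. Proof. exact: exprn_ege1. Qed.

Let rate_le : rate <= rate_log.
Proof. by rewrite -[leLHS]mulr1; apply: ler_wpM2l. Qed.

Lemma rate_log_ge0 : 0 <= rate_log.
Proof. exact: le_trans rate_le. Qed.

Let invN : N^-1 <= c0^-1 * rate_log.
Proof.
apply: (@le_trans _ _ (c0^-1 * rate)); last first.
  by apply: ler_wpM2l rate_le; rewrite invr_ge0 ltW.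
have -> : N^-1 = (sigma ^+ 2)^-1 * Neff^-1.
  by rewrite /Neff; field; rewrite !gt_eqF.
apply: ler_pM; rewrite ?invr_ge0 ?(ltW v_gt0) ?(ltW Neff0)//.
  by rewrite lef_pV2.
rewrite -powR_inv1 ?(ltW Neff0)// /rate; apply: ler_powR => //.
rewrite mulNr lerN2 ler_pdivrMr ?addr_gt0 ?mulr_gt0// mul1r lerDl.
exact: ltW.
Qed.

Definition dim_size : R := E * cD * x * (1 + ln x) ^+ d.-1.

Let dim_size_ge0 : 0 <= dim_size.
Proof.
apply: mulr_ge0; first by rewrite !mulr_ge0// ltW.
by apply: exprn_ge0; rewrite addr_ge0// ln_ge0.
Qed.

Lemma box_dim_size q : box_dim (d := d) lam sigma n m q <= dim_size.
Proof.
rewrite /box_dim xs; apply: le_trans (box_dim_le C_gt0 s_ge lam_decay q x0) _.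
rewrite /dim_size -/E -!mulrA; apply: ler_wpM2l; first exact: ltW.
by have := cD_le q.+1 x1; rewrite -!mulrA.
Qed.

Let dim_ge0 q : 0 <= box_dim (d := d) lam sigma n m q.
Proof.
rewrite /box_dim; apply: sumr_ge0 => j _; apply/ltW/shrink_gt0 => //.
- by rewrite /ridge_reg mulr_gt0// invr_gt0.
- by move=> k; apply: box_val_gt0; exact: (lam_pos C_gt0 lam_decay).
Qed.

(* The variance [D * sigma ^ 2 / N] has the order of the rate. *)
Let dim_rate : dim_size * (sigma ^+ 2 / N) <= E * cD * 2 ^+ d.-1 * rate_log.
Proof.
have -> : sigma ^+ 2 / N = x `^ (- s).
  by rewrite -xs /ridge_reg NE; field; rewrite !gt_eqF.
have -> : dim_size * x `^ (- s) = E * cD * (rate * (1 + ln x) ^+ d.-1).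
  rewrite /dim_size -rateE opprB powRD; last by rewrite (gt_eqF x0) implybT.
  by rewrite powRr1 ?(ltW x0)//; ring.
rewrite /rate_log -/rate -[leRHS]mulrA; apply: ler_wpM2l.
  by rewrite mulr_ge0// ltW.
rewrite mulrCA; apply: ler_wpM2l => //; rewrite -exprMn.
have lx : ln x <= ln Neff.
  rewrite /x ln_powR ger_pMl; last by apply: lt_le_trans ln1.
  by rewrite invf_le1//; apply: le_trans s_ge; rewrite ler1n.
apply: lerXn2r; rewrite ?nnegrE.
- by rewrite addr_ge0// ln_ge0.
- by rewrite mulr_ge0//; apply: le_trans ln1.
- by have := ln1; move: lx; lra.
Qed.

Let gram_small : m%:R * dim_size ^+ 2 / n%:R <= gram_size * N `^ (- delta).
Proof.
have xN : x ^+ 3 <= (c0^-1) `^ (3 * s^-1) * N `^ (3 * s^-1).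
  rewrite -powRM ?invr_ge0 ?(ltW c0_gt0) ?(ltW N0)//.
  rewrite /x -powR_mulrn ?powR_ge0// -powRrM [s^-1 * _]mulrC.
  apply: ge0_ler_powR; rewrite ?nnegrE ?(ltW Neff0)//.
  - by rewrite mulr_ge0// invr_ge0 ltW.
  - by rewrite mulr_ge0// ?invr_ge0 ltW.
  rewrite /Neff mulrC; apply: ler_wpM2r; first exact: ltW.
  by rewrite lef_pV2.
have dim2 : dim_size ^+ 2 <= (E * cD) ^+ 2 * ((2 * d)%:R ^+ (2 * d) * x ^+ 3).
  have -> : dim_size ^+ 2 = (E * cD) ^+ 2 * (x ^+ 2 * (1 + ln x) ^+ (2 * d.-1)).
    by rewrite /dim_size mulnC exprM; ring.
  apply: ler_wpM2l; first exact: sqr_ge0.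
  have -> : (2 * d)%:R ^+ (2 * d) * x ^+ 3 = x ^+ 2 * ((2 * d)%:R ^+ (2 * d) * x) by ring.
  apply: ler_wpM2l; first exact: sqr_ge0.
  apply: le_trans (log_pow_le _ x1); last by rewrite muln_gt0.
  apply: ler_weXn2l; first by rewrite lerDl ln_ge0.
  by rewrite leq_mul2l leq_pred orbT.
have m2 : m%:R ^+ 2 <= N `^ (1 - 3 * d%:R / (2 * beta)).
  apply: (@le_trans _ _ ((N `^ ((2%:R * beta - 3%:R * d%:R) / (4%:R * beta))) ^+ 2)).
    by rewrite lerXn2r ?nnegrE ?powR_ge0// ltW.
  rewrite -powR_mulrn ?powR_ge0// -powRrM le_eqVlt; apply/orP; left; apply/eqP.
  by congr (_ `^ _); field; rewrite gt_eqF.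
have -> : m%:R * dim_size ^+ 2 / n%:R = N^-1 * (m%:R ^+ 2 * dim_size ^+ 2).
  by rewrite NE; field; rewrite !gt_eqF.
apply: (@le_trans _ _ (N^-1 * (N `^ (1 - 3 * d%:R / (2 * beta)) *
   ((E * cD) ^+ 2 * ((2 * d)%:R ^+ (2 * d) * ((c0^-1) `^ (3 * s^-1) * N `^ (3 * s^-1))))))).
  apply: ler_wpM2l; first by rewrite invr_ge0 ltW.
  apply: ler_pM; rewrite ?sqr_ge0//; apply: le_trans dim2 _.
  apply: ler_wpM2l; first exact: sqr_ge0.
  by apply: ler_wpM2l => //; exact: exprn_ge0.
have -> : N^-1 * (N `^ (1 - 3 * d%:R / (2 * beta)) *
   ((E * cD) ^+ 2 * ((2 * d)%:R ^+ (2 * d) * ((c0^-1) `^ (3 * s^-1) * N `^ (3 * s^-1))))) =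
   gram_size * (N `^ (-1) * N `^ (1 - 3 * d%:R / (2 * beta)) * N `^ (3 * s^-1)).
  by rewrite powR_inv1 ?(ltW N0)// /gram_size; ring.
have Nn : N != 0 by rewrite gt_eqF.
rewrite -!powRD ?Nn ?implybT//.
rewrite le_eqVlt; apply/orP; left; apply/eqP; congr (_ * _ `^ _).
by rewrite /delta; ring.
Qed.

Let gram_size_ge0 : 0 <= gram_size.
Proof.
apply: mulr_ge0; first exact: sqr_ge0.
by apply: mulr_ge0; [exact: exprn_ge0|exact: powR_ge0].
Qed.

Let Ndelta : N `^ (- delta) <= 1.
Proof.
rewrite -[leRHS](powRr0 N); apply: ler_powR => //.
by rewrite oppr_le0 ltW.
Qed.

Let dim_n q : box_dim (d := d) lam sigma n m q / n%:R <= 1 + gram_size.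
Proof.
have D0 := dim_ge0 q; have DD := box_dim_size q.
set D := box_dim _ _ _ _ _ in D0 DD *.
have H : dim_size ^+ 2 / n%:R <= gram_size.
  apply: (@le_trans _ _ (m%:R * dim_size ^+ 2 / n%:R)).
    rewrite ler_pM2r ?invr_gt0// ler_peMl ?sqr_ge0//; by rewrite ler1n.
  by apply: le_trans gram_small _; rewrite ler_piMr.
have : D <= 1 + dim_size ^+ 2.
  by have := sqr_ge0 (dim_size - 1); nra.
rewrite -(ler_pM2r (x := n%:R^-1)) ?invr_gt0// => /le_trans; apply.
rewrite mulrDl mul1r; apply: lerD => //.
by rewrite invf_le1// ler1n.
Qed.

Let gram_cst_ge0 p : 0 <= gram_cst Cpsi p.
Proof.
rewrite /gram_cst; apply: mulr_ge0; first by rewrite !mulr_ge0 ?expR_ge0.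
by apply: exprn_ge0; rewrite mulr_ge0// sqr_ge0.
Qed.

Lemma bad_size_ge0 : 0 <= bad_size.
Proof.
apply: mulr_ge0; first exact: exprn_ge0.
by apply: mulr_ge0; [exact: gram_cst_ge0|exact: exprn_ge0].
Qed.

Let bad_small q : bad_prob Cpsi (@box_val R d lam q) (ridge_reg sigma m) n m gram_power
  <= bad_size / N ^+ 12.
Proof.
rewrite /bad_prob -/(box_dim (d := d) lam sigma n m q).
have D0 := dim_ge0 q; have DD := box_dim_size q.
set D := box_dim _ _ _ _ _ in D0 DD *; set p := gram_power.
have -> : (4 * m%:R) ^+ p * (gram_cst Cpsi p * (D ^+ 2 / n%:R) ^+ p) =
   4 ^+ p * (gram_cst Cpsi p * (m%:R * D ^+ 2 / n%:R) ^+ p).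
  by rewrite -[m%:R * D ^+ 2 / n%:R]mulrA [(m%:R * _) ^+ p]exprMn exprMn; ring.
rewrite /bad_size -/p; have := gram_cst_ge0 p; move: (gram_cst Cpsi p) => G G0.
rewrite -[leRHS]mulrA -[in leRHS]mulrA; apply: ler_wpM2l; first exact: exprn_ge0.
apply: ler_wpM2l => //.
apply: (@le_trans _ _ ((gram_size * N `^ (- delta)) ^+ p)).
  apply: lerXn2r; rewrite ?nnegrE.
  - by rewrite mulr_ge0 ?invr_ge0// mulr_ge0 ?sqr_ge0.
  - by rewrite mulr_ge0 ?powR_ge0.
  apply: le_trans gram_small; rewrite ler_pM2r ?invr_gt0// ler_pM2l//.
  by rewrite lerXn2r ?nnegrE.
rewrite exprMn; apply: ler_wpM2l; first exact: exprn_ge0.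
rewrite -[leLHS]powR_mulrn ?powR_ge0// -powRrM -[N ^+ 12]powR_mulrn ?(ltW N0)// -powRN.
apply: ler_powR => //; rewrite mulNr lerN2.
rewrite -ler_pdivrMl// mulrC ltW//.
by apply: archi_boundP; rewrite divr_ge0// ltW.
Qed.

Let kappa_ge0 : 0 <= kappa.
Proof. by rewrite /kappa /trace_bound mulr_ge0 ?exprn_ge0// ltW. Qed.

Let weight_le q : coef_weight Cpsi (@box_val R d lam q) (ridge_reg sigma m) n <= weight_size * N ^+ 2.
Proof.
have lp := lam_pos C_gt0 lam_decay.
have mu2 : \sum_(j : box d q) box_val lam j ^+ 2 <= kappa ^+ 2.
  have S := box_val_sum C_gt0 s_ge lam_decay (d := d) q.
  have S0 : 0 <= \sum_(j : box d q) box_val lam j.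
    by apply: sumr_ge0 => j _; exact/ltW/box_val_gt0.
  apply: (@le_trans _ _ ((\sum_(j : box d q) box_val lam j) * \sum_(j : box d q) box_val lam j)).
    rewrite mulr_suml; apply: ler_sum => j _; rewrite expr2.
    apply: ler_wpM2l; first exact/ltW/box_val_gt0.
    rewrite [leRHS](bigD1 j)//= lerDl; apply: sumr_ge0 => k _; exact/ltW/box_val_gt0.
  by rewrite expr2; apply: ler_pM.
rewrite /coef_weight.
apply: (@le_trans _ _ (kappa ^+ 2 * (Cpsi ^+ 2 * n%:R / ridge_reg sigma m ^+ 2))).
  apply: ler_wpM2r mu2.
  by apply: divr_ge0; [apply: mulr_ge0; [exact: sqr_ge0|exact: ler0n]|exact: sqr_ge0].
have -> : kappa ^+ 2 * (Cpsi ^+ 2 * n%:R / ridge_reg sigma m ^+ 2) =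
   kappa ^+ 2 * Cpsi ^+ 2 * (n%:R * m%:R ^+ 2 / (sigma ^+ 2) ^+ 2).
  by rewrite /ridge_reg; field; rewrite !gt_eqF.
have -> : weight_size * N ^+ 2 = kappa ^+ 2 * Cpsi ^+ 2 * (N ^+ 2 / c0 ^+ 2).
  by rewrite /weight_size; ring.
apply: ler_wpM2l; first by apply: mulr_ge0; exact: sqr_ge0.
apply: ler_pM.
- by rewrite mulr_ge0 ?sqr_ge0.
- by rewrite invr_ge0 sqr_ge0.
- rewrite NE exprMn; apply: ler_wpM2r; first exact: sqr_ge0.
  by rewrite expr2 ler_peMl// ler1n.
- rewrite lef_pV2 ?posrE ?exprn_gt0//.
  by rewrite lerXn2r ?nnegrE// ltW.
Qed.

Let coef_bound : R := B ^+ 2 * 4 ^+ d + 1.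

Definition mean_cst : R :=
  3 * (8 * Cpsi ^+ 2 * (1 + gram_size) + 2) * (E * B ^+ 2) +
  384 * Cpsi ^+ 2 * (E * cD * 2 ^+ d.-1) +
  risk_cst Cpsi (Cpsi * coef_bound) (1 + gram_size) (B ^+ 2) weight_size bad_size / c0.

Definition spread_cst : R :=
  2 * Cpsi ^+ 2 * (E * cD * 2 ^+ d.-1) + Cpsi ^+ 2 * kappa * bad_size / c0.

Lemma spread_size q :
  spread_bound (d := d) lam Cpsi kappa sigma n m q gram_power <= spread_cst * rate_log.
Proof.
rewrite /spread_bound /spread_cst [leRHS]mulrDl; apply: lerD.
  have -> : 2 * (ridge_reg sigma m / n%:R) * (Cpsi ^+ 2 * box_dim (d := d) lam sigma n m q) =
    2 * Cpsi ^+ 2 * (box_dim (d := d) lam sigma n m q * (sigma ^+ 2 / N)).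
    by rewrite /ridge_reg NE; field; rewrite !gt_eqF.
  rewrite -[leRHS]mulrA; apply: ler_wpM2l; first by rewrite mulr_ge0// sqr_ge0.
  apply: le_trans dim_rate; apply: ler_wpM2r; last exact: box_dim_size.
  by rewrite divr_ge0// ltW.
have -> : Cpsi ^+ 2 * kappa * bad_size / c0 * rate_log =
   Cpsi ^+ 2 * kappa * (bad_size * (c0^-1 * rate_log)) by ring.
apply: ler_wpM2l; first by rewrite mulr_ge0// sqr_ge0.
apply: le_trans (bad_small q) _; apply: ler_wpM2l; first exact: bad_size_ge0.
apply: le_trans invN; rewrite lef_pV2 ?posrE ?exprn_gt0//.
by rewrite exprS ler_peMr ?(ltW N0)//; exact: exprn_ege1.
Qed.

(** The tail of [f0] keeps a factor that grows with the sample size. It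
    disappears in the limit over the boxes, which is taken first. *)
Lemma mean_size (f0 : L2 (unif R d)) q : Theta (prod_fun psi) beta B f0 ->
  mean_bound lam sigma psi_basis psi_bound n m f0 coef_bound q gram_power (N ^+ 7) <=
  mean_cst * rate_log +
  (tail_cst Cpsi n m (1 + gram_size) weight_size + 1) * box_tail psi_basis psi_bound q f0.
Proof.
move=> f0T; have lp := lam_pos C_gt0 lam_decay.
have t0 : 0 < ridge_reg sigma m by rewrite /ridge_reg mulr_gt0// invr_gt0.
have bias : box_bias lam sigma psi_basis psi_bound n m f0 q <= E * B ^+ 2 * rate.
  rewrite /box_bias.
  apply: (@le_trans _ _ (\sum_(j : box d q) E * rate *
      (box_prod j `^ (2 * beta / d%:R) * box_coef psi_basis psi_bound f0 j ^+ 2))).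
    apply: ler_sum => j _; rewrite -{1}[box_coef _ _ _ _]mul1r -mulrBl exprMn mulrA.
    apply: ler_wpM2r; first exact: sqr_ge0.
    have := shrink_bias_le C_gt0 s_ge lam_decay j x0; rewrite -xs rateE.
    by rewrite (_ : s - 1 = 2 * beta / d%:R)// /s addrC addKr.
  rewrite -mulr_sumr [leRHS]mulrAC; apply: ler_wpM2l; first by rewrite mulr_ge0// ltW.
  exact: (weighted_coef_le d_gt0 psi_basis psi_bound (ltW beta0) f0T).
rewrite /mean_bound [sigma ^+ 4](exprM _ 2 2).
have H := @risk_val_le R _ Cpsi (@box_val R d lam q) (ridge_reg sigma m) n m
  (@box_coef R d psi Cpsi psi_basis psi_bound f0 q) (sigma ^+ 2) (Cpsi * coef_bound)
  (box_tail psi_basis psi_bound q f0) (1 + gram_size) (E * cD * 2 ^+ d.-1 * rate_log)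
  (E * B ^+ 2 * rate) (B ^+ 2) weight_size bad_size gram_power
  n_gt0 m_gt0 t0 (@box_val_gt0 R d lam lp q) (ltW v_gt0) v_le
  (box_tail_ge0 psi_basis psi_bound q f0) (dim_n q) _ (weight_le q) bias
  (coef_sqr_sum d_gt0 psi_basis psi_bound (ltW beta0) f0T q) (bad_small q) bad_size_ge0.
rewrite [X in _ <= _ + X]mulrDl mul1r [leRHS]addrA lerD2r.
apply: le_trans (H _) _.
  apply: le_trans dim_rate; apply: ler_wpM2r; last exact: box_dim_size.
  by rewrite divr_ge0// ltW.
rewrite lerD2r /mean_cst (mulrDl _ _ rate_log) (mulrDl _ _ rate_log).
apply: lerD; first apply: lerD.
- have c1 : 0 <= 3 * (8 * Cpsi ^+ 2 * (1 + gram_size) + 2).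
    by rewrite mulr_ge0// addr_ge0// mulr_ge0 ?addr_ge0// mulr_ge0// sqr_ge0.
  rewrite -[leRHS]mulrA; apply: ler_wpM2l => //; apply: ler_wpM2l rate_le.
  by rewrite mulr_ge0 ?sqr_ge0// ltW.
- by rewrite -!mulrA.
- rewrite -mulrA; apply: ler_wpM2l invN.
  have w0 : 0 <= weight_size by rewrite /weight_size divr_ge0 ?sqr_ge0// mulr_ge0 ?sqr_ge0.
  have b0 := bad_size_ge0.
  rewrite /risk_cst; apply: mulr_ge0 => //; apply: addr_ge0; first apply: addr_ge0.
  + by apply: mulr_ge0 => //; apply: mulr_ge0 => //; apply: mulr_ge0 => //; exact: sqr_ge0.
  + by apply: mulr_ge0 => //; apply: mulr_ge0 => //; exact: sqr_ge0.
  + apply: mulr_ge0; last exact: addr_ge0.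
    apply: addr_ge0 => //; apply: mulr_ge0; first exact: sqr_ge0.
    exact: addr_ge0.
Qed.

End sample_size.

Section main_bounds.
Context {R : realType} {d : nat}.
Variables (K : d.-tuple R -> d.-tuple R -> R) (psi : nat -> R -> R) (lam : nat -> R).
Variables (Cpsi beta B C c0 cD : R).
Hypothesis d_gt0 : (0 < d)%N.
Hypothesis K_pd : positive_definite K.
Hypothesis psi_basis : orthonormal_basis (prod_fun (d := d) psi).
Hypothesis K_exp : expansion K (prod_val lam) (prod_fun psi).
Hypothesis psi_bound : forall (j : multi_index (d := d)) (t : d.-tuple R),
  cube t -> `|prod_fun psi j t| <= Cpsi.
Hypothesis beta_ge : 3%:R * d%:R / 2%:R <= beta.
Hypothesis C_gt0 : 0 < C.
Hypothesis lam_decay : forall i : nat,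
  C^-1 * i.+1%:R `^ (- (1 + 2 * beta / d%:R)) <= lam i
    <= C * i.+1%:R `^ (- (1 + 2 * beta / d%:R)).
Hypothesis c0_gt0 : 0 < c0.
Hypothesis cD_gt0 : 0 < cD.
Hypothesis cD_le : forall q (x : R), 1 <= x ->
  multi_sum d q x <= cD * x * (1 + ln x) ^+ d.-1.
Variables (n m : nat) (sigma : R).
Hypothesis n_gt0 : (0 < n)%N.
Hypothesis m_gt0 : (0 < m)%N.
Hypothesis sigma_gt0 : 0 < sigma.
Hypothesis sigma_lb : c0 <= sigma ^+ 2.
Hypothesis Neff_ge : expR 1 <= (n * m)%N%:R / sigma ^+ 2.
Hypothesis m_le : m%:R <= (n * m)%N%:R `^ ((2%:R * beta - 3%:R * d%:R) / (4%:R * beta)) :> R.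

Local Notation rl := (rate_log (d := d) beta n m sigma).
Local Notation cR := (mean_cst (d := d) Cpsi beta B C c0 cD).
Local Notation cS := (spread_cst (d := d) Cpsi beta C c0 cD).

Let beta_d : 3 <= 2 * beta / d%:R.
Proof. by rewrite ler_pdivlMr ?ltr0n//; have := beta_ge; lra. Qed.

Let beta_ge0 : 0 <= beta.
Proof. by apply: le_trans beta_ge; rewrite divr_ge0// mulr_ge0. Qed.

Let tau_gt0 (q : nat) : 0 < (n * m)%N%:R ^+ 7 :> R.
Proof. by rewrite exprn_gt0// ltr0n muln_gt0 n_gt0. Qed.

Let coef_sum f0 (q : nat) : Theta (prod_fun psi) beta B f0 ->
  \sum_(j : box d q) `|box_coef psi_basis psi_bound f0 j| <= B ^+ 2 * 4 ^+ d + 1.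
Proof.
move=> f0T; apply: (coef_abs_sum d_gt0 psi_basis psi_bound beta_ge0 f0T).
by apply: le_trans beta_d; rewrite ler_nat.
Qed.

Lemma expected_risk_rate (f0 : L2 (unif R d)) : Theta (prod_fun psi) beta B f0 ->
  (expect sigma f0 (fun D : data n m => cube_dist (global_mean K sigma D) f0 ^+ 2) <=
   (cR * rl)%:E)%E.
Proof.
move=> f0T.
apply: le_trans (expected_risk_le K_pd K_exp (lam_pos C_gt0 lam_decay) sigma_gt0 n_gt0 m_gt0
  (fun q => coef_sum q f0T) (gram_power (d := d) beta) tau_gt0) _.
set T := tail_cst Cpsi n m (1 + gram_size (d := d) beta C c0 cD) (weight_size (d := d) Cpsi C c0) + 1.
have H : cR * rl + T * box_tail psi_basis psi_bound q f0 @[q --> \oo] --> cR * rl + T * 0.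
  apply: cvgD; first exact: cvg_cst.
  by apply: cvgM; [exact: cvg_cst|exact: box_tail_cvg].
rewrite mulr0 addr0 in H; rewrite -(cvg_limn_einf H); apply: limn_einf_le => q.
exact: (mean_size d_gt0 psi_basis psi_bound beta_ge C_gt0 lam_decay c0_gt0 cD_gt0 cD_le
  n_gt0 m_gt0 sigma_gt0 sigma_lb Neff_ge m_le q f0T).
Qed.

Lemma expected_spread_rate a (Pi : data (R := R) (d := d) n m -> probability (L2 (unif R d)) R)
    (f0 : L2 (unif R d)) (e : R) :
  (forall D : data n m, (forall k i, cube (design D k i)) ->
     global_posterior a K sigma D (Pi D)) ->
  0 < e -> Theta (prod_fun psi) beta B f0 ->
  (expect sigma f0 (fun D : data n m => Pi D [set f : L2 (unif R d) | (e%:E < cube_dist f f0)%E]) <=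
   (e ^- 2 * ((2 * cR + 512 * cS) * rl))%:E)%E.
Proof.
move=> post e0 f0T.
have lp := lam_pos C_gt0 lam_decay.
have s3 : 3 <= 1 + 2 * beta / d%:R by have := beta_d; lra.
apply: le_trans (expected_spread_le K_pd K_exp lp sigma_gt0
  (box_val_sum C_gt0 s3 lam_decay) n_gt0 m_gt0
  (fun q => coef_sum q f0T) (gram_power (d := d) beta) tau_gt0 post e0) _.
set T := tail_cst Cpsi n m (1 + gram_size (d := d) beta C c0 cD) (weight_size (d := d) Cpsi C c0) + 1.
have H : e ^- 2 * (2 * (cR * rl + T * box_tail psi_basis psi_bound q f0) + 512 * (cS * rl))
    @[q --> \oo] --> e ^- 2 * (2 * (cR * rl + T * 0) + 512 * (cS * rl)).
  apply: cvgM; first exact: cvg_cst.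
  apply: cvgD; last exact: cvg_cst.
  apply: cvgM; first exact: cvg_cst.
  apply: cvgD; first exact: cvg_cst.
  by apply: cvgM; [exact: cvg_cst|exact: box_tail_cvg].
rewrite mulr0 addr0 in H.
have -> : (2 * cR + 512 * cS) * rl = 2 * (cR * rl) + 512 * (cS * rl).
  by rewrite [LHS]mulrDl -!mulrA.
rewrite -(cvg_limn_einf H); apply: limn_einf_le => q.
apply: ler_wpM2l; first by rewrite invr_ge0 exprn_ge0// ltW.
apply: lerD; apply: ler_wpM2l; first exact: ler0n.
- exact: (mean_size d_gt0 psi_basis psi_bound beta_ge C_gt0 lam_decay c0_gt0 cD_gt0 cD_le
    n_gt0 m_gt0 sigma_gt0 sigma_lb Neff_ge m_le q f0T).
- exact: ler0n.
- exact: (spread_size Cpsi d_gt0 beta_ge C_gt0 lam_decay c0_gt0 cD_gt0 cD_le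
    n_gt0 m_gt0 sigma_gt0 sigma_lb Neff_ge m_le q).
Qed.

Lemma Theta0 : Theta (prod_fun psi) beta B (0 : L2 (unif R d)).
Proof.
rewrite /Theta/= esum1 ?lee_fin ?sqr_ge0// => j _.
by rewrite (inner_ip psi_basis psi_bound (g := 0))// ip0l expr0n/= mulr0.
Qed.

(** The logarithm is at least [1], so that its real and natural powers can be
    compared. *)
Lemma radius_sqr (M : R) :
  (M * ((n * m)%N%:R / sigma ^+ 2) `^ (- beta / (2%:R * beta + d%:R))
     * ln ((n * m)%N%:R / sigma ^+ 2) `^ ((d%:R - 1) / 2%:R)) ^+ 2 = M ^+ 2 * rl.
Proof.
set Ne := (n * m)%N%:R / sigma ^+ 2.
have l1 : 1 <= ln Ne.
  by rewrite -[leLHS]expRK ler_ln ?posrE ?expR_gt0//; exact: lt_le_trans Neff_ge; exact: expR_gt0.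
have l0 : 0 <= ln Ne by apply: le_trans l1.
rewrite !exprMn -mulrA /rate_log -/Ne; congr (_ * (_ * _)).
  rewrite -powR_mulrn ?powR_ge0// -powRrM; congr (_ `^ _).
  by rewrite mulrAC mulNr [beta * _]mulrC.
rewrite -[LHS]powR_mulrn ?powR_ge0// -powRrM -mulrA mulVf// mulr1.
by rewrite -[d in (d%:R - 1)](prednK d_gt0) -addn1 natrD addrK powR_mulrn.
Qed.

End main_bounds.

Unset Implicit Arguments.

Theorem corollary3p3 (R : realType) (d : nat) (d_gt0 : (0 < d)%N)
  (* kernel *)
  (K : d.-tuple R -> d.-tuple R -> R) (psi : nat -> R -> R) (lam : nat -> R)
  (K_stat : stationary K) (K_pd : positive_definite K)
  (psi_basis : orthonormal_basis (prod_fun (d := d) psi))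
  (K_exp : expansion K (prod_val lam) (prod_fun psi))
  (Cpsi : R) (Cpsi_gt0 : 0 < Cpsi)
  (psi_bound : forall (j : multi_index (d := d)) (t : d.-tuple R),
     cube t -> `|prod_fun psi j t| <= Cpsi)
  (B beta : R) (B_gt0 : 0 < B) (beta_ge : 3%:R * d%:R / 2%:R <= beta)
  (C : R) (C_gt0 : 0 < C)
  (lam_decay : forall i : nat,
     C^-1 * i.+1%:R `^ (- 1 - 2%:R * beta / d%:R) <= lam i
       <= C * i.+1%:R `^ (- 1 - 2%:R * beta / d%:R))
  (* asymptotic regime *)
  (n m : nat -> nat) (n_gt0 : forall l, (0 < n l)%N)
  (m_gt0 : forall l, (0 < m l)%N)
  (N_infty : ((n l * m l)%N%:R : R) @[l --> \oo] --> +oo)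
  (m_small : (fun l => (m l)%:R : R) =o_\oo
     (fun l => (n l * m l)%N%:R `^ ((2%:R * beta - 3%:R * d%:R) / (4%:R * beta))))
  (sigma : nat -> R) (sigma_gt0 : forall l, 0 < sigma l)
  (c0 : R) (c0_gt0 : 0 < c0) (sigma_lb : forall l, c0 <= sigma l ^+ 2)
  (Neff_infty : (n l * m l)%N%:R / sigma l ^+ 2 @[l --> \oo] --> +oo)
  (* aggregated posterior *)
  (a : method)
  (Pi : forall l, data (R := R) (d := d) (n l) (m l) ->
          probability (L2 (unif R d)) R)
  (Pi_post : forall l (D : data (n l) (m l)),
     (forall k i, cube (design D k i)) ->
     global_posterior a K (sigma l) D (Pi l D)) :
  let Neff l := (n l * m l)%N%:R / sigma l ^+ 2 in
  (exists2 C' : R, 0 < C' & \forall l \near \oo,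
     (ereal_sup [set expect (sigma l) f0 (fun D : data (n l) (m l) =>
          cube_dist (global_mean K (sigma l) D) f0 ^+ 2)
        | f0 in Theta (prod_fun psi) beta B]
      <= (C' * (Neff l `^ (- (2%:R * beta) / (2%:R * beta + d%:R))
                * ln (Neff l) ^+ d.-1))%:E)%E)
  /\
  (forall M : nat -> R, M l @[l --> \oo] --> +oo ->
     ereal_sup [set expect (sigma l) f0 (fun D : data (n l) (m l) =>
          Pi l D [set f : L2 (unif R d) |
            ((M l * Neff l `^ (- beta / (2%:R * beta + d%:R))
              * ln (Neff l) `^ ((d%:R - 1) / 2%:R))%:E
             < cube_dist f f0)%E])
        | f0 in Theta (prod_fun psi) beta B]
     @[l --> \oo] --> 0%E).
Proof.
move=> Neff.
have [cD cD_gt0 cD_le'] := multi_sum_le (R := R) d.-1.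
have cD_le q (x : R) : 1 <= x -> multi_sum d q x <= cD * x * (1 + ln x) ^+ d.-1.
  by have := cD_le' q x; rewrite prednK.
have lam_decay' i : C^-1 * i.+1%:R `^ (- (1 + 2 * beta / d%:R)) <= lam i
    <= C * i.+1%:R `^ (- (1 + 2 * beta / d%:R)).
  by have := lam_decay i; rewrite opprD.
have Neff_large : \forall l \near \oo, expR 1 <= Neff l.
  by move/cvgryPge : Neff_infty; apply.
have m_le : \forall l \near \oo, ((m l)%:R : R) <=
    (n l * m l)%N%:R `^ ((2%:R * beta - 3%:R * d%:R) / (4%:R * beta)).
  have /eqoP/(_ 1 ltr01) := m_small; apply: filterS => l.
  by rewrite mul1r ger0_norm// ger0_norm// powR_ge0.
pose cR := mean_cst (d := d) Cpsi beta B C c0 cD.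
pose cS := spread_cst (d := d) Cpsi beta C c0 cD.
split.
  exists (`|cR| + 1); first by rewrite ltr_wpDl.
  near=> l.
  have Ne : expR 1 <= Neff l by near: l.
  have ml : ((m l)%:R : R) <=
    (n l * m l)%N%:R `^ ((2%:R * beta - 3%:R * d%:R) / (4%:R * beta)) by near: l.
  apply: ge_ereal_sup => _ [f0 f0T <-].
  apply: le_trans (expected_risk_rate d_gt0 K_pd psi_basis K_exp psi_bound beta_ge C_gt0
    lam_decay' c0_gt0 cD_gt0 cD_le (n_gt0 l) (m_gt0 l) (sigma_gt0 l) (sigma_lb l) Ne ml f0T) _.
  rewrite lee_fin; apply: ler_wpM2r.
    exact: (rate_log_ge0 (d := d) beta (n_gt0 l) (m_gt0 l) (sigma_gt0 l) Ne).
  by apply: le_trans (ler_norm _) _; rewrite lerDl.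
move=> M M_infty.
pose k := 2 * cR + 512 * cS.
(* The probability is at most [k / M ^ 2]. *)
have M_pos : \forall l \near \oo, 0 < M l.
  have /cvgryPge/(_ 1) := M_infty; apply: filterS => l; exact: lt_le_trans.
have upper : ((M l)^-1 * (M l)^-1 * k)%:E @[l --> \oo] --> (0%:E : \bar R).
  have V : (M l)^-1 @[l --> \oo] --> (0 : R) by apply/(gtr0_cvgV0 M_pos).
  apply: cvg_EFin; first exact: nearW.
  have H : (M l)^-1 * (M l)^-1 * k @[l --> \oo] --> (0 * 0 * k : R).
    by apply: cvgM; [exact: cvgM|exact: cvg_cst].
  by rewrite !mul0r in H.
apply: (@squeeze_cvge _ _ _ _ (fun=> 0%:E) _ (fun l => ((M l)^-1 * (M l)^-1 * k)%:E));
  [|exact: cvg_cst|exact: upper].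
near=> l.
have Ne : expR 1 <= Neff l by near: l.
have ml : ((m l)%:R : R) <=
  (n l * m l)%N%:R `^ ((2%:R * beta - 3%:R * d%:R) / (4%:R * beta)) by near: l.
have Ml : 0 < M l by near: l.
have Ne0 : 0 < Neff l by apply: lt_le_trans Ne; exact: expR_gt0.
have ln0 : 0 < ln (Neff l).
  by apply: lt_le_trans ltr01 _; rewrite -[leLHS]expRK ler_ln ?posrE ?expR_gt0.
apply/andP; split.
  (* The ellipsoid contains zero, so that the supremum is nonnegative. *)
  apply: le_trans (ereal_sup_ubound _); last first.
    by exists 0; [exact: (Theta0 (Cpsi := Cpsi))|reflexivity].
  by apply: integral_ge0 => w _.
apply: ge_ereal_sup => _ [f0 f0T <-].
set r := M l * _ * _.
have r0 : 0 < r by rewrite !mulr_gt0// powR_gt0.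
apply: le_trans (expected_spread_rate d_gt0 K_pd psi_basis K_exp psi_bound beta_ge C_gt0
  lam_decay' c0_gt0 cD_gt0 cD_le (n_gt0 l) (m_gt0 l) (sigma_gt0 l) (sigma_lb l) Ne ml
  (Pi_post l) r0 f0T) _.
set rl := rate_log _ _ _ _.
have rl0 : 0 < rl by rewrite mulr_gt0 ?powR_gt0 ?exprn_gt0.
have r2 : r ^+ 2 = M l ^+ 2 * rl by exact: radius_sqr.
rewrite lee_fin -/cR -/cS -/k r2.
rewrite le_eqVlt; apply/orP; left; apply/eqP; field.
by rewrite !gt_eqF.
Unshelve. all: by end_near. Qed.
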